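(* Let $m\ge 1$ be an integer and let $\lambda\in\mathbb{C}$ satisfy $|\lambda|=1$, $\lambda\ne\pm1$. On $\widetilde{M}=\mathbb{C}\setminus\{0\}$, with the involution $I:z\mapsto-1/\bar z$, consider $$\phi=\frac{z-\lambda}{z-\bar\lambda}\,z^{2m},\qquad \psi=\frac{1+\bar\lambda z}{1+\lambda z}\cdot\frac{1}{z^{2m}},\qquad \mathrm{d}h=\mathrm{i}\,\frac{(z-\bar\lambda)(1+\lambda z)}{z^2}\,\mathrm{d}z .$$ Then the formula $$\mathbf{x}=2\,\mathrm{Re}\int\big(\phi+\psi,\,-\mathrm{i}(\phi-\psi),\,1-\phi\psi,\,1+\phi\psi\big)\,\mathrm{d}h$$ defines a complete immersed stationary Möbius strip $M=\widetilde{M}/\{\mathrm{id},I\}\to\mathbb{R}^4_1$ with a regular end and total Gaussian curvature $-\int_M K\,\mathrm{d}M=2(2m+1)\pi$.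
   Context: $\mathbb{R}^4_1$ is $\mathbb{R}^4$ with the Lorentz inner product $\langle \mathbf{x},\mathbf{x}\rangle=x_1^2+x_2^2+x_3^2-x_4^2$. A stationary surface is a spacelike immersion $\mathbf{x}:M\to\mathbb{R}^4_1$ (i.e. the induced metric is Riemannian) whose mean curvature vector vanishes identically. $K$ and $\mathrm{d}M$ are the Gaussian curvature and area element of the induced metric; ''complete'' refers to this metric. The unique end of $M$ corresponds to the two ends $z=0$ and $z=\infty$ of $\widetilde{M}$, interchanged by $I$. An end $p$ at which $\phi,\psi$ extend meromorphically is regular if $\phi(p)\ne\overline{\psi(p)}$ as points of $\mathbb{C}\cup\{\infty\}$. *)

(* Defs.v *)
From HB Require Import structures.
From mathcomp Require Import all_boot all_order all_algebra complex.
From mathcomp Require Import all_classical all_reals all_analysis.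

Set Implicit Arguments.
Unset Strict Implicit.
Unset Printing Implicit Defensive.

Import Order.TTheory GRing.Theory Num.Theory.
Import numFieldNormedType.Exports.

Local Open Scope classical_set_scope.
Local Open Scope quotient_scope.
Local Open Scope complex_scope.
Local Open Scope ring_scope.

(* Points of the domain are pairs of reals, so that real differentiation and
   Lebesgue measure apply; [toC] and [ofC] identify R * R with R[i]. *)
Definition toC (R : realType) (p : R * R) : R[i] := p.1 +i* p.2.
Definition ofC (R : realType) (z : R[i]) : R * R := (complex.Re z, complex.Im z).

Definition punctured_plane (R : realType) : set (R * R) := [set p | p != 0].
Arguments punctured_plane : clear implicits.

Definition antipode (R : realType) (p : R * R) : R * R :=
  ofC (- ((toC p)^*%C)^-1).

Lemma ofCK (R : realType) : cancel (@ofC R) (@toC R).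
Proof. by case. Qed.

Lemma toCK (R : realType) : cancel (@toC R) (@ofC R).
Proof. by case. Qed.

Lemma antipodeK (R : realType) (p : R * R) : antipode (antipode p) = p.
Proof.
rewrite /antipode ofCK rmorphN fmorphV invrN invrK opprK.
by rewrite -[RHS]toCK -[toC p in RHS]conjcK.
Qed.

Definition antipodal (R : realType) (p q : punctured_plane R) : bool :=
  (val q == val p) || (val q == antipode (val p)).

Lemma antipodal_refl (R : realType) : reflexive (@antipodal R).
Proof. by move=> p; rewrite /antipodal eqxx. Qed.

Lemma antipodal_sym (R : realType) : symmetric (@antipodal R).
Proof.
move=> p q; rewrite /antipodal eq_sym; congr (_ || _).
by apply/eqP/eqP => ->; rewrite antipodeK.
Qed.

Lemma antipodal_trans (R : realType) : transitive (@antipodal R).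
Proof.
move=> q p r; rewrite /antipodal.
by move=> /orP[]/eqP -> /orP[]/eqP ->; rewrite ?antipodeK eqxx ?orbT.
Qed.

Definition antipodal_equiv (R : realType) : equiv_rel (punctured_plane R) :=
  EquivRel (@antipodal R) (@antipodal_refl R) (@antipodal_sym R)
    (@antipodal_trans R).

Definition antipodal_quotient (R : realType) : topologicalType :=
  quotient_topology {eq_quot (antipodal_equiv R)}.

Definition quotient_proj (R : realType) (p : punctured_plane R) :
  antipodal_quotient R := \pi_({eq_quot (antipodal_equiv R)}) p.

(* The open Moebius strip is R^2 modulo (s, t) ~ (s + 1, - t). *)
Definition moebius (R : realType) (p q : R * R) : bool :=
  `[< exists n : int, q = (p.1 + n%:~R, (-1) ^ n * p.2) >].

Lemma moebius_refl (R : realType) : reflexive (@moebius R).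
Proof.
by move=> [s t]; apply/asboolP; exists 0; rewrite /= addr0 expr0z mul1r.
Qed.

Lemma moebius_trans (R : realType) : transitive (@moebius R).
Proof.
move=> q p r /asboolP[n ->] /asboolP[k ->]; apply/asboolP; exists (n + k).
by rewrite /= rmorphD /= addrA expfzDr ?oppr_eq0 ?oner_eq0// mulrA
  [_ ^ k * _]mulrC.
Qed.

Lemma moebius_sym (R : realType) : symmetric (@moebius R).
Proof.
suff H (p q : R * R) : moebius p q -> moebius q p.
  by move=> p q; apply/idP/idP; exact: H.
case: p => s t /asboolP[n ->]; apply/asboolP; exists (- n).
rewrite /= rmorphN /= addrK mulrA -expfzDr ?oppr_eq0 ?oner_eq0//.
by rewrite addNr expr0z mul1r.
Qed.

Definition moebius_equiv (R : realType) : equiv_rel (R * R)%type :=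
  EquivRel (@moebius R) (@moebius_refl R) (@moebius_sym R) (@moebius_trans R).

Definition moebius_strip (R : realType) : topologicalType :=
  quotient_topology {eq_quot (moebius_equiv R)}.

Definition homeomorphic (X Y : topologicalType) : Prop :=
  exists (f : X -> Y) (g : Y -> X),
    [/\ cancel f g, cancel g f, continuous f & continuous g].

Definition lorentz (R : realType) (u v : 'rV[R]_4) : R :=
  \sum_(j < 4) (if j == ord_max then -1 else 1) * u 0 j * v 0 j.

Definition coord_dir (R : realType) (i : 'I_2) : R * R :=
  ((i == 0)%:R, (i == 1)%:R).

Definition coord_val (R : realType) (v : R * R) (i : 'I_2) : R :=
  if i == 0 then v.1 else v.2.

Definition pderiv (R : realType) (V : normedModType R) (i : 'I_2)
  (f : R * R -> V) (p : R * R) : V := 'D_(coord_dir R i) f p.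

Definition smooth_on (R : realType) (V : normedModType R) (U : set (R * R))
  (f : R * R -> V) : Prop :=
  forall (s : seq 'I_2) (p : R * R), U p ->
    differentiable (foldr (@pderiv R V) f s) p.

Definition immersion_on (R : realType) (U : set (R * R))
  (x : R * R -> 'rV[R]_4) : Prop :=
  smooth_on U x /\ forall p, U p -> injective ('d x p).

Definition spacelike_on (R : realType) (U : set (R * R))
  (x : R * R -> 'rV[R]_4) : Prop :=
  forall p, U p -> forall v : R * R, v != 0 ->
    0 < lorentz ('d x p v) ('d x p v).

Definition induced_metric (R : realType) (x : R * R -> 'rV[R]_4)
  (p : R * R) : 'M[R]_2 :=
  \matrix_(i, j) lorentz (pderiv i x p) (pderiv j x p).

Definition normal_part (R : realType) (x : R * R -> 'rV[R]_4) (p : R * R)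
  (w : 'rV[R]_4) : 'rV[R]_4 :=
  w - \sum_(i < 2) \sum_(j < 2)
        (invmx (induced_metric x p) i j * lorentz w (pderiv i x p))
          *: pderiv j x p.

(* The ambient space being flat, II(d_i, d_j) is the normal part of d_i d_j x. *)
Definition second_fundamental_form (R : realType) (x : R * R -> 'rV[R]_4)
  (p : R * R) (i j : 'I_2) : 'rV[R]_4 :=
  normal_part x p (pderiv i (pderiv j x) p).

Definition mean_curvature_vector (R : realType) (x : R * R -> 'rV[R]_4)
  (p : R * R) : 'rV[R]_4 :=
  2^-1 *: \sum_(i < 2) \sum_(j < 2)
    invmx (induced_metric x p) i j *: second_fundamental_form x p i j.

Definition stationary_on (R : realType) (U : set (R * R))
  (x : R * R -> 'rV[R]_4) : Prop :=
  [/\ immersion_on U x, spacelike_on U x &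
      forall p, U p -> mean_curvature_vector x p = 0].

(* Gamma^k_ij *)
Definition christoffel (R : realType) (g : R * R -> 'M[R]_2) (k i j : 'I_2)
  (p : R * R) : R :=
  2^-1 * \sum_(l < 2) invmx (g p) k l *
    (pderiv i (fun q => g q j l : R) p + pderiv j (fun q => g q i l : R) p
     - pderiv l (fun q => g q i j : R) p).

(* The l-th component of R(d_i, d_j) d_k, where
   R(X, Y) = [nabla_X, nabla_Y] - nabla_[X, Y]. *)
Definition riemann (R : realType) (g : R * R -> 'M[R]_2) (l k i j : 'I_2)
  (p : R * R) : R :=
  pderiv i (christoffel g l j k : R * R -> R) p
  - pderiv j (christoffel g l i k : R * R -> R) p
  + \sum_(n < 2) (christoffel g l i n p * christoffel g n j k p
                  - christoffel g l j n p * christoffel g n i k p).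

(* K = g(R(d_0, d_1) d_1, d_0) / det g *)
Definition gauss_curvature (R : realType) (g : R * R -> 'M[R]_2)
  (p : R * R) : R :=
  (\sum_(l < 2) g p 0 l * riemann g l 1 0 1 p) / \det (g p).

Definition area_density (R : realType) (g : R * R -> 'M[R]_2)
  (p : R * R) : R := Num.sqrt (\det (g p)).

(* The integrand of K dM with respect to Lebesgue measure on the plane. *)
Definition curvature_density (R : realType) (g : R * R -> 'M[R]_2)
  (p : R * R) : R := gauss_curvature g p * area_density g p.

(* For an antipode-invariant metric g on the punctured plane, the projection to
   the quotient M is a two-sheeted local isometry, so that integrating over M is
   half of integrating over the punctured plane. *)
Definition total_curvature (R : realType) (g : R * R -> 'M[R]_2) : \bar R :=
  ((2^-1)%:E * \int[(@lebesgue_measure R \x @lebesgue_measure R)%E]_(p in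
      punctured_plane R) (curvature_density g p)%:E)%E.

Definition C1_curve (R : realType) (c : R -> R * R) : Prop :=
  (forall t, derivable c t 1) /\ continuous (derive1 c).

(* Curves are parametrised by [0, 1]; only that part has to lie in U. *)
Definition curve_in (R : realType) (U : set (R * R)) (c : R -> R * R) : Prop :=
  C1_curve c /\ forall t : R, 0 <= t <= 1 -> U (c t).

Definition speed (R : realType) (g : R * R -> 'M[R]_2) (c : R -> R * R)
  (t : R) : R :=
  Num.sqrt (\sum_(i < 2) \sum_(j < 2)
    g (c t) i j * coord_val (derive1 c t) i * coord_val (derive1 c t) j).

Definition curve_length (R : realType) (g : R * R -> 'M[R]_2)
  (c : R -> R * R) : \bar R :=
  (\int[@lebesgue_measure R]_(t in `[0%R, 1%R]) (speed g c t)%:E)%E.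

(* Riemannian distance on M: the curves in M from P to Q are the projections of
   the curves in the punctured plane from a lift of P to a lift of Q. *)
Definition quotient_dist (R : realType) (g : R * R -> 'M[R]_2)
  (P Q : antipodal_quotient R) : \bar R :=
  ereal_inf [set curve_length g c | c in
    [set c : R -> R * R | curve_in (punctured_plane R) c /\
       exists p q : punctured_plane R,
         [/\ quotient_proj p = P, quotient_proj q = Q,
             c 0 = val p & c 1 = val q]]].

Definition quotient_complete (R : realType) (g : R * R -> 'M[R]_2) : Prop :=
  forall u : nat -> antipodal_quotient R,
    (forall e : R, 0 < e -> exists N : nat, forall k l : nat,
       (N <= k)%N -> (N <= l)%N -> (quotient_dist g (u k) (u l) < e%:E)%E) ->
    exists P, (fun k => quotient_dist g (u k) P) @ \oo --> 0%E.

(* R[i]^o carries the topology of the complex modulus. *)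
Definition holomorphic_at (R : realType) (f : R[i]^o -> R[i]^o) (z : R[i]^o) :
  Prop :=
  \forall w \near z, derivable f w 1.

(* The component functions of (phi + psi, - i (phi - psi), 1 - phi psi,
   1 + phi psi) dh, where dh = h dz.  At a pole of phi or psi the formula is
   meaningless, see [weierstrass_integral]. *)
Definition weierstrass_form (R : realType) (phi psi h : R[i] -> R[i])
  (j : 'I_4) (z : R[i]) : R[i] :=
  nth 0 [:: phi z + psi z; - 'i%C * (phi z - psi z);
            1 - phi z * psi z; 1 + phi z * psi z] j * h z.

(* x = 2 Re \int (phi + psi, ...) dh on the punctured plane: the forms extend
   holomorphically (as Phi j dz) across the poles of phi and psi, which are
   listed in S, and the increment of x along any curve is twice the real part
   of the line integral.  This determines x up to an additive constant; that
   such an x exists at all says that the real periods vanish. *)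
Definition weierstrass_integral (R : realType) (phi psi h : R[i] -> R[i])
  (S : seq R[i]) (x : R * R -> 'rV[R]_4) : Prop :=
  exists Phi : 'I_4 -> R[i] -> R[i],
    [/\ forall j (z : R[i]), z != 0 -> holomorphic_at (Phi j) z,
        forall j (z : R[i]), z != 0 -> z \notin S ->
          Phi j z = weierstrass_form phi psi h j z &
        forall c, curve_in (punctured_plane R) c -> forall j,
          x (c 1) 0 j - x (c 0) 0 j =
          2 * \int[@lebesgue_measure R]_(t in `[0, 1])
                complex.Re (Phi j (toC (c t)) * toC (derive1 c t))].

(* [option R[i]] is the Riemann sphere, [None] being the point at infinity.
   f extends meromorphically to 0 with the value v there, i.e. f or 1 / f has a
   holomorphic extension to 0. *)
Definition value_at_0 (R : realType) (f : R[i] -> R[i]) (v : option R[i]) :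
  Prop :=
  match v with
  | Some a => exists F, [/\ holomorphic_at F 0, F 0 = a &
                \forall z \near (0 : R[i]^o)^', f z = F z]
  | None => exists F, [/\ holomorphic_at F 0, F 0 = 0 &
                \forall z \near (0 : R[i]^o)^', F z != 0 /\ f z = (F z)^-1]
  end.

Definition value_at_infty (R : realType) (f : R[i] -> R[i])
  (v : option R[i]) : Prop := value_at_0 (fun w => f w^-1) v.

Definition sphere_conj (R : realType) (v : option R[i]) : option R[i] :=
  omap (@conjc R) v.

Definition regular_end_at_0 (R : realType) (phi psi : R[i] -> R[i]) : Prop :=
  exists a b, [/\ value_at_0 phi a, value_at_0 psi b & a <> sphere_conj b].

Definition regular_end_at_infty (R : realType) (phi psi : R[i] -> R[i]) :
  Prop :=
  exists a b,
    [/\ value_at_infty phi a, value_at_infty psi b & a <> sphere_conj b].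

Definition ex_phi (R : realType) (m : nat) (l z : R[i]) : R[i] :=
  (z - l) / (z - l^*%C) * z ^+ (2 * m).

Definition ex_psi (R : realType) (m : nat) (l z : R[i]) : R[i] :=
  (1 + l^*%C * z) / (1 + l * z) * (z ^+ (2 * m))^-1.

(* dh = ex_h dz *)
Definition ex_h (R : realType) (l z : R[i]) : R[i] :=
  'i%C * ((z - l^*%C) * (1 + l * z) / z ^+ 2).

(* The poles of ex_phi and ex_psi in C \ {0}, when l has modulus 1. *)
Definition ex_poles (R : realType) (l : R[i]) : seq R[i] := [:: l^*%C; - l^*%C].

(* Main.v *)
(* The forms phi dh, psi dh, phi psi dh and dh are Laurent polynomials in z
   without residue, exchanged up to conjugation by the antipode; so x is the
   real part of a Laurent polynomial and factors through the quotient.  The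
   induced metric is conformal to the flat one with factor
   E = 4 |W|^2 / |z|^(4 m + 4), where W is a polynomial in z and conj z.

   Putting rho = |z|^2, the comparison of (rho^2m - 1) / (rho^2m + 1) with
   (rho - 1) / (rho + 1), an inequality between hyperbolic tangents, gives
   |W| >= c (rho + 1) (rho^2m + 1), which is where Im l <> 0 is used.  Hence
   sqrt E >= c' (1 + 1 / rho): the metric is spacelike, and the
   antipode-invariant functions z - 1 / conj z and z / conj z are Lipschitz for
   its distance, so they converge along Cauchy sequences.  As they determine z
   up to the antipode, suitable lifts converge in the punctured plane.

   The integrand of K dM is - 2 Re (d omega / d conj z) for
   omega = d log |W|^2 / dz, which is smooth on the whole plane, including 0;
   it is O(1 / (1 + rho)^2), and since omega = (4 m + 2) / z + O(1 / |z|^2) at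
   infinity, Green's formula on large squares gives its integral. *)
Require Import Defs.
From HB Require Import structures.
From mathcomp Require Import all_boot all_order all_algebra complex.
From mathcomp Require Import all_classical all_reals all_analysis.
From mathcomp Require Import measurable_realfun zify ring lra.
Import Order.TTheory GRing.Theory Num.Theory.
Import numFieldNormedType.Exports.
Local Open Scope classical_set_scope.
Local Open Scope complex_scope.
Local Open Scope ring_scope.

Set Implicit Arguments.
Unset Strict Implicit.
Unset Printing Implicit Defensive.

(** Divide [W] by (rho + 1) (rho^2m + 1) and put s = (rho - 1) / (rho + 1), t = (rho^2m - 1) /
    (rho^2m + 1), y = 2 Im z / (rho + 1), l = a + i b. The real part becomes a s t and the imaginary
    part y t - b, with y^2 <= 1 - s^2. Neither part suffices alone: the first vanishes identically
    for l = i or - i, the second has zeros when b is small. But if y t is close to b, then t is away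
    from 0, and so is s because |t| <= 2m |s|; now either a s t is not small, or a is small and |y
    t| <= sqrt (1 - s^2) stays below |b|, which is close to 1. The residue 4m + 2 comes from the
    degree 2m + 1 of W in each of z and conj z. Squares are used rather than discs because on them
    Green's formula is Fubini plus the one-variable fundamental theorem. Completeness takes two
    invariants because z - 1 / conj z vanishes on the whole unit circle; there z / conj z = z^2
    still separates points up to sign, that is, up to the antipode. *)

(* [f] is real differentiable at [p] with Wirtinger derivatives a = f_z and
   b = f_zbar. *)
Definition wirtinger (R : realType) (f : R * R -> R[i]) (p : R * R)
  (a b : R[i]) : Prop :=
  is_diff p (fun q => complex.Re (f q) : R)
    (fun v => complex.Re (a * toC v + b * (toC v)^*%C) : R) /\
  is_diff p (fun q => complex.Im (f q) : R)
    (fun v => complex.Im (a * toC v + b * (toC v)^*%C) : R).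

Lemma ReIm_eq (R : realType) (z w : R[i]) :
  complex.Re z = complex.Re w -> complex.Im z = complex.Im w -> z = w.
Proof. by case: z w => a b [c d] /= -> ->. Qed.

Section ReIm.
Variable R : realType.
Implicit Types z w : R[i].

Lemma cReD z w : complex.Re (z + w) = complex.Re z + complex.Re w.
Proof. by case: z w => a b [c d]. Qed.
Lemma cImD z w : complex.Im (z + w) = complex.Im z + complex.Im w.
Proof. by case: z w => a b [c d]. Qed.
Lemma cReN z : complex.Re (- z) = - complex.Re z.
Proof. by case: z. Qed.
Lemma cImN z : complex.Im (- z) = - complex.Im z.
Proof. by case: z. Qed.
Lemma cReM z w :
  complex.Re (z * w) = complex.Re z * complex.Re w - complex.Im z * complex.Im w.
Proof. by case: z w => a b [c d]. Qed.
Lemma cImM z w :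
  complex.Im (z * w) = complex.Re z * complex.Im w + complex.Im z * complex.Re w.
Proof. by case: z w => a b [c d]. Qed.
Lemma cReC z : complex.Re z^*%C = complex.Re z.
Proof. by case: z. Qed.
Lemma cImC z : complex.Im z^*%C = - complex.Im z.
Proof. by case: z. Qed.

Definition cReImE :=
  (cReD, cImD, cReN, cImN, cReM, cImM, cReC, cImC).

End ReIm.

(** * Calculus of Wirtinger derivatives *)

Section Wirtinger.
Variable R : realType.
Implicit Types (f g : R * R -> R[i]) (p v : R * R) (a b c d : R[i]).

Lemma wirtinger_eq f p a b a' b' :
  wirtinger f p a b -> a = a' -> b = b' -> wirtinger f p a' b'.
Proof. by move=> H <- <-. Qed.

Lemma is_diff_fst p : is_diff p (fun q => q.1 : R) (fun v => v.1 : R).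
Proof.
have H : linear (fun q : R * R => q.1 : R) by [].
pose L := GRing.isLinear.Build _ _ _ _ (fun q : R * R => q.1 : R) H.
pose f : {linear (R * R)%type -> R} := HB.pack (fun q : R * R => q.1 : R) L.
have cf : continuous f by move=> q; exact: cvg_fst.
split; first exact: (@linear_differentiable _ _ _ f).
by rewrite (@diff_lin _ _ _ f).
Qed.

Lemma is_diff_snd p : is_diff p (fun q => q.2 : R) (fun v => v.2 : R).
Proof.
have H : linear (fun q : R * R => q.2 : R) by [].
pose L := GRing.isLinear.Build _ _ _ _ (fun q : R * R => q.2 : R) H.
pose f : {linear (R * R)%type -> R} := HB.pack (fun q : R * R => q.2 : R) L.
have cf : continuous f by move=> q; exact: cvg_snd.
split; first exact: (@linear_differentiable _ _ _ f).
by rewrite (@diff_lin _ _ _ f).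
Qed.

Lemma wirtinger_id p : wirtinger (@toC R) p 1 0.
Proof.
split => /=.
  by apply: is_diff_eq (is_diff_fst p) _; apply/funext => v /=; ring.
by apply: is_diff_eq (is_diff_snd p) _; apply/funext => v /=; ring.
Qed.

Lemma wirtinger_cst c p : wirtinger (fun=> c) p 0 0.
Proof.
split.
  apply: is_diff_eq (is_diff_cst _ _) _; apply/funext => v.
  by rewrite !mul0r addr0.
apply: is_diff_eq (is_diff_cst _ _) _; apply/funext => v.
by rewrite !mul0r addr0.
Qed.

Lemma wirtingerD f g p a b c d : wirtinger f p a b -> wirtinger g p c d ->
  wirtinger (fun q => f q + g q) p (a + c) (b + d).
Proof.
move=> [f1 f2] [g1 g2]; split.
  have -> : (fun q => complex.Re (f q + g q)) =
      (fun q => complex.Re (f q)) + (fun q => complex.Re (g q)).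
    by apply/funext => q /=; rewrite cReD.
  apply: is_diff_eq; apply/funext => v; rewrite !fctE.
  by rewrite -cReD; congr complex.Re; ring.
have -> : (fun q => complex.Im (f q + g q)) =
    (fun q => complex.Im (f q)) + (fun q => complex.Im (g q)).
  by apply/funext => q /=; rewrite cImD.
apply: is_diff_eq; apply/funext => v; rewrite !fctE.
by rewrite -cImD; congr complex.Im; ring.
Qed.

Lemma wirtingerM f g p a b c d : wirtinger f p a b -> wirtinger g p c d ->
  wirtinger (fun q => f q * g q) p (a * g p + f p * c) (b * g p + f p * d).
Proof.
move=> [f1 f2] [g1 g2]; split.
  have -> : (fun q => complex.Re (f q * g q)) =
      (fun q => complex.Re (f q)) * (fun q => complex.Re (g q)) -
      (fun q => complex.Im (f q)) * (fun q => complex.Im (g q)).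
    by apply/funext => q /=; rewrite cReM.
  apply: is_diff_eq (is_diffB (is_diffM f1 g1) (is_diffM f2 g2)) _.
  apply/funext => v.
  rewrite !fctE !cReImE.
  by rewrite /GRing.scale /=; ring.
have -> : (fun q => complex.Im (f q * g q)) =
    (fun q => complex.Re (f q)) * (fun q => complex.Im (g q)) +
    (fun q => complex.Im (f q)) * (fun q => complex.Re (g q)).
  by apply/funext => q /=; rewrite cImM.
apply: is_diff_eq (is_diffD (is_diffM f1 g2) (is_diffM f2 g1)) _.
apply/funext => v; rewrite !fctE !cReImE.
by rewrite /GRing.scale /=; ring.
Qed.

Lemma wirtingerC f p a b : wirtinger f p a b ->
  wirtinger (fun q => (f q)^*%C) p b^*%C a^*%C.
Proof.
move=> [f1 f2]; split.
  have -> : (fun q => complex.Re (f q)^*%C) = (fun q => complex.Re (f q)).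
    by apply/funext => q /=; rewrite cReC.
  by apply: is_diff_eq; apply/funext => v; rewrite !cReImE /=; ring.
have -> : (fun q => complex.Im (f q)^*%C) = - (fun q => complex.Im (f q)).
  by apply/funext => q /=; rewrite cImC.
by apply: is_diff_eq; apply/funext => v; rewrite !fctE !cReImE /=; ring.
Qed.

Lemma wirtingerN f p a b : wirtinger f p a b ->
  wirtinger (fun q => - f q) p (- a) (- b).
Proof.
move=> Hf; have := wirtingerM (wirtinger_cst (-1) p) Hf.
by rewrite !mul0r !add0r !mulN1r (_ : (fun q => -1 * f q) = (fun q => - f q));
  last by apply/funext => q; rewrite mulN1r.
Qed.

Lemma wirtingerB f g p a b c d : wirtinger f p a b -> wirtinger g p c d ->
  wirtinger (fun q => f q - g q) p (a - c) (b - d).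
Proof. by move=> Hf Hg; apply: wirtingerD => //; exact: wirtingerN. Qed.

Lemma wirtingerZ k f p a b : wirtinger f p a b ->
  wirtinger (fun q => k * f q) p (k * a) (k * b).
Proof.
move=> Hf; apply: wirtinger_eq (wirtingerM (wirtinger_cst k p) Hf) _ _.
  by rewrite mul0r add0r.
by rewrite mul0r add0r.
Qed.

Lemma wirtingerX f p a b n : wirtinger f p a b ->
  wirtinger (fun q => f q ^+ n) p (n%:R * f p ^+ n.-1 * a) (n%:R * f p ^+ n.-1 * b).
Proof.
move=> Hf; elim: n => [|n IH].
  by rewrite !mul0r; under [X in wirtinger X]eq_fun do rewrite expr0;
    exact: wirtinger_cst.
have := wirtingerM Hf IH; under [X in wirtinger X]eq_fun do rewrite -exprS.
move=> H; apply: wirtinger_eq H _ _; case: n {IH} => [|n] /=;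
  rewrite ?expr0 ?mul0r ?mulr0 -?natr1 ?exprS; ring.
Qed.

Lemma cReV (z : R[i]) : complex.Re z^-1 =
  complex.Re z / (complex.Re z ^+ 2 + complex.Im z ^+ 2).
Proof. by case: z => x y. Qed.

Lemma cImV (z : R[i]) : complex.Im z^-1 =
  - complex.Im z / (complex.Re z ^+ 2 + complex.Im z ^+ 2).
Proof. by case: z => x y /=; rewrite mulNr. Qed.

Lemma is_diffVr (h dh : R * R -> R) p : h p != 0 -> is_diff p h dh ->
  is_diff p (fun q => (h q)^-1) (fun v => - dh v / h p ^+ 2).
Proof.
move=> hp0 Hh; split; first by apply: differentiableV.
rewrite diffV // diff_val; apply/funext => v.
by rewrite mulNr mulrC -mulNr.
Qed.

Lemma wirtinger_realV f p a : (forall q, complex.Im (f q) = 0) -> f p != 0 ->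
  wirtinger f p a a^*%C ->
  wirtinger (fun q => (f q)^-1) p (- a / f p ^+ 2) (- a^*%C / f p ^+ 2).
Proof.
move=> fR fp0 [f1 _].
have Ef q : f q = (complex.Re (f q))%:C by apply: ReIm_eq; rewrite ?fR.
have Rfp0 : complex.Re (f p) != 0.
  by apply: contra_neq fp0 => E; rewrite Ef E.
have EV q : (f q)^-1 = ((complex.Re (f q))^-1)%:C by rewrite {1}Ef fmorphV.
split.
  under [X in is_diff p X]eq_fun do rewrite EV /=.
  apply: is_diff_eq (is_diffVr Rfp0 f1) _; apply/funext => v.
  rewrite !mulNr [in RHS]Ef -rmorphXn -fmorphV !cReImE /=; ring.
under [X in is_diff p X]eq_fun do rewrite EV /=.
apply: is_diff_eq (is_diff_cst _ _) _; apply/funext => v.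
transitivity (0 : R) => //.
rewrite !mulNr [in RHS]Ef -rmorphXn -fmorphV !cReImE /=; ring.
Qed.

(** Writing 1 / f = conj f / (f conj f) reduces the rule to the inverse of a real-valued function,
    for which the two Wirtinger derivatives are conjugate. *)
Lemma wirtingerV f p a b : f p != 0 -> wirtinger f p a b ->
  wirtinger (fun q => (f q)^-1) p (- a / f p ^+ 2) (- b / f p ^+ 2).
Proof.
move=> fp0 Hf.
have fbp0 : (f p)^*%C != 0 by rewrite conjc_eq0.
have EV q : (f q)^-1 = (f q)^*%C * (f q * (f q)^*%C)^-1.
  have [->|fq0] := eqVneq (f q) 0; first by rewrite invr0 !mul0r invr0 mulr0.
  have fbq0 : (f q)^*%C != 0 by rewrite conjc_eq0.
  by field; rewrite fq0 fbq0.
have HN := wirtingerM Hf (wirtingerC Hf).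
have := @wirtinger_realV (fun q => f q * (f q)^*%C) p
  (a * (f p)^*%C + f p * b^*%C).
rewrite mulf_neq0 //.
have -> : (a * (f p)^*%C + f p * b^*%C)^*%C = b * (f p)^*%C + f p * a^*%C.
  by rewrite rmorphD !rmorphM /= !conjcK; ring.
move=> /(_ _ isT HN) HV.
under [X in wirtinger X]eq_fun do rewrite EV.
have := wirtingerM (wirtingerC Hf) (HV _).
move=> H; apply: wirtinger_eq (H _) _ _; last 2 first.
- by field; rewrite fp0 fbp0.
- by field; rewrite fp0 fbp0.
by move=> q; rewrite !cReImE; ring.
Qed.

(** The surface is given by a formula only on the punctured plane, so its differential is found by
    comparison with that formula near each point. *)
Lemma near_eq_is_diff (V W : normedModType R) (f g df : V -> W) (p : V) :
  (\forall q \near p, f q = g q) -> is_diff p f df -> is_diff p g df.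
Proof.
move=> fg [dfp <-].
have fgp : f p = g p by exact: (nbhs_singleton fg).
have [cdf Ef] := (diff_locallyP _ _).1 dfp.
have E : g \o shift p = cst (g p) + 'd f p +o_ (0 : V) id.
  apply/eqaddoP => e e0.
  have /eqaddoP /(_ e e0) Ef' := Ef.
  have fg0 : \forall h \near (0 : V), f (h + p) = g (h + p).
    have : h + p @[h --> (0 : V)] --> p.
      by rewrite -[X in _ --> X]add0r; apply: cvgD; [exact: cvg_id|exact: cvg_cst].
    by move=> /(_ _ fg).
  by near=> h; rewrite !fctE /= -fgp -(near fg0 h) //; near: h.
have E' := diff_unique cdf E.
by split; [apply/diff_locallyP; rewrite E'|].
Unshelve. all: by end_near. Qed.

Lemma wirtinger_pderivRe f p a b i : wirtinger f p a b ->
  pderiv i (fun q => complex.Re (f q) : R) p =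
  complex.Re (if i == 0 then a + b else 'i%C * (a - b)).
Proof.
move=> [[df1 f1] _]; rewrite /pderiv deriveE // f1.
case: i => -[|[|//]] hi /=; rewrite /coord_dir /= !cReImE /=; ring.
Qed.

Lemma wirtinger_is_derive_curve f (c : R -> R * R) t a b :
  wirtinger f (c t) a b -> derivable c t 1 ->
  is_derive t 1 (fun s => complex.Re (f (c s)) : R)
    (complex.Re (a * toC (derive1 c t) + b * (toC (derive1 c t))^*%C)).
Proof.
move=> [f1 _] /derivable1_diffP dc.
have dc' : is_diff t c ('d c t) by split.
have [H1 H2] := is_diff_comp dc' f1.
split; first exact: diff_derivable.
by rewrite deriveE // H2 /= derive1E deriveE.
Qed.

Lemma wirtinger_continuous f p a b :
  wirtinger f p a b -> {for p, continuous (fun q => complex.Re (f q) : R)} /\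
  {for p, continuous (fun q => complex.Im (f q) : R)}.
Proof. by move=> [[? _] [? _]]; split; exact: differentiable_continuous. Qed.

End Wirtinger.

(** * The real inequality behind the lower bound of |W| *)

Section RealBound.
Variable R : realFieldType.
Implicit Types a b k q t s rho y : R.

(** Applied with k = (s t)^2, q = y t and t^2 in place of [t]. If |q| <= |b| / 2, the second term is
    at least b^2 / 4. Otherwise t >= q^2 >= b^2 / 4 forces k >= k0, and then either 1 - b^2 >= k0 /
    2, or q^2 <= 1 - k0 keeps q away from b. *)
Lemma core_bound b N : b != 0 -> b ^+ 2 <= 1 -> 1 <= N ->
  exists2 c, 0 < c & forall k q t, k <= t -> t <= 1 -> q ^+ 2 <= t - k ->
    t ^+ 2 <= N * k -> c <= (1 - b ^+ 2) * k + (q - b) ^+ 2.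
Proof.
move=> b0 b1 N1.
have b2 : 0 < b ^+ 2 by rewrite lt_def sqrf_eq0 b0 sqr_ge0.
pose k0 := b ^+ 2 ^+ 2 / (16 * N).
have N0 : 0 < N by lra.
have k0gt0 : 0 < k0 by apply: divr_gt0; [exact: exprn_gt0|lra].
have k0E : 16 * N * k0 = b ^+ 2 ^+ 2 by rewrite /k0; field; lra.
have k0b : k0 <= b ^+ 2 / 16 by nra.
(* The constant comes from the last case: (b - q)^2 (b + q)^2 >= (k0 / 2)^2 with (b + q)^2 <= 4. *)
exists (k0 ^+ 2 / 16); first by rewrite divr_gt0 ?exprn_gt0//; lra.
move=> k q t kt t1 qt tk.
have q2 := sqr_ge0 q.
have k_ge0 : 0 <= k by have := sqr_ge0 t; nra.
have [qs|qs] := lerP (4 * q ^+ 2) (b ^+ 2).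
  have : b ^+ 2 / 4 <= (q - b) ^+ 2.
    rewrite -subr_ge0.
    have -> : (q - b) ^+ 2 - b ^+ 2 / 4 = (b / 2 - q) * (3 * b / 2 - q) by field.
    have [bp|bn] := ltrP 0 b; nra.
  have : 0 <= (1 - b ^+ 2) * k by rewrite mulr_ge0// subr_ge0.
  nra.
have kk0 : k0 <= k.
  rewrite -(ler_pM2l (_ : 0 < 16 * N)); last by lra.
  rewrite k0E.
  have : (4 * q ^+ 2) ^+ 2 <= 16 * t ^+ 2.
    have : q ^+ 2 <= t by lra.
    nra.
  nra.
have [bs|bs] := lerP (b ^+ 2) (1 - k0 / 2).
  have : k0 / 2 * k0 <= (1 - b ^+ 2) * k by apply: ler_pM; lra.
  have := sqr_ge0 (q - b); nra.
have h : k0 / 2 <= (b - q) * (b + q) by nra.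
have hs : (b + q) ^+ 2 <= 4 by have := sqr_ge0 (b - q); nra.
have h2 : (k0 / 2) ^+ 2 <= ((b - q) * (b + q)) ^+ 2.
  by rewrite lerXn2r// nnegrE; lra.
rewrite exprMn in h2.
have : (b - q) ^+ 2 * (b + q) ^+ 2 <= (b - q) ^+ 2 * 4 by rewrite ler_wpM2l ?sqr_ge0.
have : 0 <= (1 - b ^+ 2) * k by rewrite mulr_ge0// subr_ge0.
nra.
Qed.

(* tanh (n x) <= n tanh x in the variable rho = exp (2 x). *)
Lemma tanh_bound n rho : 0 <= rho ->
  let t (j : nat) := (rho ^+ j - 1) / (rho ^+ j + 1) in
  0 <= t n * t 1 /\ `|t n| <= n%:R * `|t 1|.
Proof.
move=> r0 t.
have p (j : nat) : 0 < rho ^+ j + 1 by rewrite ltr_wpDl ?exprn_ge0.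
elim: n => [|n [IH1 IH2]].
  by rewrite /t expr0 subrr !mul0r normr0.
(* Addition formula of the hyperbolic tangent; the denominator is at least 1 because t n and t 1
   have the same sign. *)
have E : t n.+1 = (t n + t 1) / (1 + t n * t 1).
  rewrite /t exprS expr1; have := p n; have := p 1; rewrite expr1 => p1 pn.
  have rn : 0 <= rho ^+ n by rewrite exprn_ge0.
  have rn1 : 0 <= rho ^+ n * rho by rewrite mulr_ge0.
  by field; rewrite ?gt_eqF//; nra.
split.
  rewrite E mulrAC divr_ge0//; last lra.
  by rewrite mulrDl addr_ge0 // -expr2 sqr_ge0.
rewrite E normrM normfV (@ger0_norm _ (1 + _)); last lra.
rewrite ler_pdivrMr; last lra.
apply: le_trans (ler_normD _ _) _.
rewrite -natr1 mulrDl mul1r.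
have : 0 <= (n%:R * `|t 1| + `|t 1|) * (t n * t 1).
  by rewrite mulr_ge0// addr_ge0// mulr_ge0.
lra.
Qed.

(** Division by (rho + 1)^2 (rho^n + 1)^2 turns this into [core_bound] with N = n^2. The bound on q
    comes from y^2 <= rho, which says that s^2 + y'^2 <= 1, and the bound on t^2 from
    [tanh_bound]. *)
Lemma W_bound a b n : b != 0 -> a ^+ 2 + b ^+ 2 = 1 -> (0 < n)%N ->
  exists2 c, 0 < c & forall y rho, y ^+ 2 <= rho ->
    c * (rho + 1) ^+ 2 * (rho ^+ n + 1) ^+ 2 <=
    (a * (rho - 1) * (rho ^+ n - 1)) ^+ 2 +
    (2 * y * (rho ^+ n - 1) - b * (rho + 1) * (rho ^+ n + 1)) ^+ 2.
Proof.
move=> b0 ab n0.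
have n1 : 1 <= (n%:R : R) ^+ 2.
  by rewrite exprn_ege1// ler1n.
have b1 : b ^+ 2 <= 1 by have := sqr_ge0 a; lra.
have [c c0 H] := core_bound b0 b1 n1.
exists c => // y rho yr.
have r0 : 0 <= rho by apply: le_trans yr; rewrite sqr_ge0.
have [] := tanh_bound n r0; rewrite /= expr1 => _.
set t := (rho ^+ n - 1) / _; set s := (rho - 1) / _ => ts.
have p : 0 < rho ^+ n + 1 by rewrite ltr_wpDl ?exprn_ge0.
have p1 : 0 < rho + 1 by lra.
pose y' := 2 * y / (rho + 1).
have t1 : t ^+ 2 <= 1.
  rewrite /t exprMn exprVn ler_pdivrMr ?exprn_gt0// mul1r.
  have : 0 <= rho ^+ n by rewrite exprn_ge0.
  nra.
have ys : y' ^+ 2 <= 1 - s ^+ 2.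
  rewrite -subr_ge0 (_ : _ - _ = 4 * (rho - y ^+ 2) / (rho + 1) ^+ 2).
    by rewrite divr_ge0 ?sqr_ge0//; lra.
  by rewrite /y' /s; field; rewrite gt_eqF.
have t2 : t ^+ 2 <= n%:R ^+ 2 * s ^+ 2.
  have : `|t| ^+ 2 <= (n%:R * `|s|) ^+ 2 by rewrite lerXn2r ?nnegrE ?mulr_ge0.
  by rewrite exprMn !real_normK ?num_real.
have s2 := sqr_ge0 s; have tt2 := sqr_ge0 t; have yy2 := sqr_ge0 y'.
have {}H : c <= (1 - b ^+ 2) * (s ^+ 2 * t ^+ 2) + (y' * t - b) ^+ 2.
  apply: (H _ _ (t ^+ 2)) => //; first nra.
    by rewrite exprMn; nra.
  by rewrite mulrA [X in X <= _]expr2 ler_wpM2r.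
rewrite -mulrA [X in _ <= X](_ : _ =
  ((1 - b ^+ 2) * (s ^+ 2 * t ^+ 2) + (y' * t - b) ^+ 2) *
  ((rho + 1) ^+ 2 * (rho ^+ n + 1) ^+ 2)); last first.
  have -> : 1 - b ^+ 2 = a ^+ 2 by lra.
  by rewrite /y' /s /t; field; rewrite !gt_eqF.
by rewrite ler_pM2r// mulr_gt0 ?exprn_gt0.
Qed.

End RealBound.

(** * The real-valued modulus *)

Section Modulus.
Variable R : realType.
Implicit Types z w : R[i].
Import Normc.

Lemma normc_norm z : `|z| = (normc z)%:C.
Proof. by rewrite normc_def; case: z. Qed.

Lemma normc_ge0 z : 0 <= normc z.
Proof. by case: z => x y; rewrite sqrtr_ge0. Qed.

Lemma normc_gt0 z : z != 0 -> 0 < normc z.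
Proof.
by move=> z0; rewrite lt_neqAle normc_ge0 andbT eq_sym;
  apply: contra z0 => /eqP/eq0_normc ->.
Qed.

Lemma sqr_normc z : normc z ^+ 2 = complex.Re z ^+ 2 + complex.Im z ^+ 2.
Proof. by case: z => x y; rewrite sqr_sqrtr // addr_ge0 ?sqr_ge0. Qed.

Lemma normcD z w : normc (z + w) <= normc z + normc w.
Proof. exact: le_normcD. Qed.

Lemma normcB z w : normc (z - w) <= normc z + normc w.
Proof. by rewrite (le_trans (normcD _ _))// normcN. Qed.

Lemma normcX z n : normc (z ^+ n) = normc z ^+ n.
Proof. by elim: n => [|n IH]; rewrite ?normc1 // !exprS normcM IH. Qed.

Lemma normcC z : normc z^*%C = normc z.
Proof. by case: z => x y /=; rewrite sqrrN. Qed.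

Lemma normcR (x : R) : normc x%:C = `|x|.
Proof. by rewrite /= expr0n addr0 sqrtr_sqr. Qed.

Lemma normc_nat n : normc (n%:R : R[i]) = n%:R.
Proof. by rewrite -(rmorph_nat (real_complex R)) normcR ger0_norm. Qed.

Lemma normc_i : normc ('i%C : R[i]) = 1.
Proof. by rewrite /= expr0n expr1n add0r sqrtr1. Qed.

Lemma ler_Re_normc z : `|complex.Re z| <= normc z.
Proof.
by case: z => x y /=; rewrite -sqrtr_sqr ler_wsqrtr// lerDl sqr_ge0.
Qed.

Lemma ler_Im_normc z : `|complex.Im z| <= normc z.
Proof.
by case: z => x y /=; rewrite -sqrtr_sqr ler_wsqrtr// lerDr sqr_ge0.
Qed.

Lemma mul_conjc z : z * z^*%C = (normc z ^+ 2)%:C.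
Proof.
by rewrite sqr_normc; case: z => x y; apply: ReIm_eq; rewrite !cReImE /=; ring.
Qed.

End Modulus.

(** * The polynomial W and its derivatives *)

Section W.
Variables (R : realType) (l : R[i]) (N : nat).
Implicit Types (p : R * R) (z w : R[i]).
Import Normc.
Local Notation lb := (l^*%C).
Local Notation z_ p := (toC p).
Local Notation zb_ p := ((toC p)^*%C).

(** For N = 2 m - 1, phi is alp / bet at z, and conj psi is gam / del at conj z. Counting from N
    keeps the exponents of the first derivatives free of predecessors. *)
Definition alp z := (z - l) * z ^+ N.+1.
Definition alp' z := (N.+2%:R * z - N.+1%:R * l) * z ^+ N.
Definition alp'' z := N.+2%:R * z ^+ N +
  (N.+2%:R * z - N.+1%:R * l) * (N%:R * z ^+ N.-1).
Definition bet z := z - lb.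
Definition gam w := 1 + l * w.
Definition del w := (1 + lb * w) * w ^+ N.+1.
Definition del' w := (N.+1%:R + N.+2%:R * lb * w) * w ^+ N.
Definition del'' w := N.+2%:R * lb * w ^+ N +
  (N.+1%:R + N.+2%:R * lb * w) * (N%:R * w ^+ N.-1).

(* phi - conj psi = W / (bet z * del (conj z)), with N = 2 m - 1. *)
Definition W p := alp (z_ p) * del (zb_ p) - bet (z_ p) * gam (zb_ p).
Definition Wz p := alp' (z_ p) * del (zb_ p) - gam (zb_ p).
Definition Wzb p := alp (z_ p) * del' (zb_ p) - bet (z_ p) * l.
Definition Wzz p := alp'' (z_ p) * del (zb_ p).
Definition Wzzb p := alp' (z_ p) * del' (zb_ p) - l.
Definition Wzbzb p := alp (z_ p) * del'' (zb_ p).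

Let wid p := wirtinger_id p.
Let widb p := wirtingerC (wirtinger_id p).

Lemma wirtinger_alp p : wirtinger (fun q => alp (z_ q)) p (alp' (z_ p)) 0.
Proof.
have H := wirtingerM (wirtingerB (wid p) (wirtinger_cst l p)) (wirtingerX N.+1 (wid p)).
apply: wirtinger_eq H _ _; rewrite /alp' /= ?exprS -?natr1; ring.
Qed.

Lemma wirtinger_alp' p : wirtinger (fun q => alp' (z_ q)) p (alp'' (z_ p)) 0.
Proof.
have H := wirtingerM (wirtingerB (wirtingerZ N.+2%:R (wid p))
  (wirtinger_cst (N.+1%:R * l) p)) (wirtingerX N (wid p)).
apply: wirtinger_eq H _ _; rewrite /alp'' /= -?natr1; ring.
Qed.

Lemma wirtinger_bet p : wirtinger (fun q => bet (z_ q)) p 1 0.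
Proof.
apply: wirtinger_eq (wirtingerB (wid p) (wirtinger_cst lb p)) _ _; ring.
Qed.

Lemma wirtinger_gam p : wirtinger (fun q => gam (zb_ q)) p 0 l.
Proof.
apply: wirtinger_eq (wirtingerD (wirtinger_cst 1 p) (wirtingerZ l (widb p))) _ _;
  rewrite ?conjc0 ?conjc1; ring.
Qed.

Lemma wirtinger_del p : wirtinger (fun q => del (zb_ q)) p 0 (del' (zb_ p)).
Proof.
have H := wirtingerM (wirtingerD (wirtinger_cst 1 p) (wirtingerZ lb (widb p)))
  (wirtingerX N.+1 (widb p)).
apply: wirtinger_eq H _ _; rewrite /del' ?succnK ?conjc0 ?conjc1 ?exprS -?natr1; ring.
Qed.

Lemma wirtinger_del' p : wirtinger (fun q => del' (zb_ q)) p 0 (del'' (zb_ p)).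
Proof.
have H := wirtingerM (wirtingerD (wirtinger_cst N.+1%:R p)
  (wirtingerZ (N.+2%:R * lb) (widb p))) (wirtingerX N (widb p)).
apply: wirtinger_eq H _ _; rewrite /del'' ?conjc0 ?conjc1 -?natr1; ring.
Qed.

Lemma wirtinger_W p : wirtinger W p (Wz p) (Wzb p).
Proof.
have H := wirtingerB (wirtingerM (wirtinger_alp p) (wirtinger_del p))
  (wirtingerM (wirtinger_bet p) (wirtinger_gam p)).
by apply: wirtinger_eq H _ _; rewrite /Wz /Wzb; ring.
Qed.

Lemma wirtinger_Wz p : wirtinger Wz p (Wzz p) (Wzzb p).
Proof.
have H := wirtingerB (wirtingerM (wirtinger_alp' p) (wirtinger_del p))
  (wirtinger_gam p).
by apply: wirtinger_eq H _ _; rewrite /Wzz /Wzzb; ring.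
Qed.

Lemma wirtinger_Wzb p : wirtinger Wzb p (Wzzb p) (Wzbzb p).
Proof.
have H := wirtingerB (wirtingerM (wirtinger_alp p) (wirtinger_del' p))
  (wirtingerM (wirtinger_bet p) (wirtinger_cst l p)).
by apply: wirtinger_eq H _ _; rewrite /Wzbzb /Wzzb; ring.
Qed.

Hypothesis hl : l * lb = 1.

Let hab : complex.Re l ^+ 2 + complex.Im l ^+ 2 = 1.
Proof.
have := congr1 (@complex.Re R) hl; rewrite !cReImE /= => <-; ring.
Qed.

Definition nq p : R := p.1 ^+ 2 + p.2 ^+ 2.

Lemma zzbE p : z_ p * zb_ p = (nq p)%:C.
Proof. by apply: ReIm_eq; rewrite !cReImE /nq /=; ring. Qed.

(** Since l conj l = 1, the products (z - l) (1 + conj l conj z) and (z - conj l) (1 + l conj z) are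
    both z - conj z plus a function of rho; hence W depends on z only through rho and Im z. *)
Lemma W_ReIm p : W p =
  (complex.Re l * (nq p - 1) * (nq p ^+ N.+1 - 1)) +i*
  (2 * p.2 * (nq p ^+ N.+1 - 1) -
   complex.Im l * (nq p + 1) * (nq p ^+ N.+1 + 1)).
Proof.
have -> : W p = (nq p ^+ N.+1)%:C * ((z_ p - zb_ p) + (nq p)%:C * lb - l) -
   ((z_ p - zb_ p) + (nq p)%:C * l - lb).
  have -> : (nq p ^+ N.+1)%:C = z_ p ^+ N.+1 * zb_ p ^+ N.+1.
    by rewrite -exprMn zzbE; exact: rmorphXn.
  rewrite -zzbE /W /alp /del /bet /gam.
  ring: hl.
by apply: ReIm_eq; rewrite !cReImE /=; ring.
Qed.

Lemma nq_ge0 p : 0 <= nq p.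
Proof. by rewrite addr_ge0 ?sqr_ge0. Qed.

Lemma W_lower : complex.Im l != 0 ->
  exists2 c, 0 < c & forall p,
    c * (nq p + 1) * (nq p ^+ N.+1 + 1) <= normc (W p).
Proof.
move=> b0; have [c c0 H] := W_bound b0 hab (ltn0Sn N).
exists (Num.sqrt c); first by rewrite sqrtr_gt0.
move=> p; have h : 0 <= nq p ^+ N.+1 by rewrite exprn_ge0 // nq_ge0.
have h0 := nq_ge0 p.
rewrite -(@ler_pXn2r _ 2)// ?nnegrE ?normc_ge0 ?mulr_ge0 ?sqrtr_ge0 //; try lra.
have -> : (Num.sqrt c * (nq p + 1) * (nq p ^+ N.+1 + 1)) ^+ 2 =
    c * (nq p + 1) ^+ 2 * (nq p ^+ N.+1 + 1) ^+ 2.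
  by rewrite !exprMn (sqr_sqrtr (ltW c0)).
by rewrite sqr_normc W_ReIm; apply: H; rewrite /nq lerDr sqr_ge0.
Qed.

Definition Wnum p := Wzzb p * W p - Wz p * Wzb p.

(* The Hessian of log W factors like the Wronskians of (alp, bet) and
   (del, gam). *)
Lemma Wnum_factor p : Wnum p =
  (alp' (z_ p) * bet (z_ p) - alp (z_ p)) *
  (del (zb_ p) * l - del' (zb_ p) * gam (zb_ p)).
Proof. by rewrite /Wnum /Wzzb /Wz /Wzb /W; ring. Qed.

Lemma normc_l : normc l = 1.
Proof.
have : normc l ^+ 2 = 1 by rewrite sqr_normc hab.
move/eqP; rewrite sqrf_eq1 => /orP[/eqP //|/eqP h].
by have := normc_ge0 l; rewrite h; lra.
Qed.

Lemma Wnum_le p : normc (Wnum p) <=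
  4 * N.+1%:R ^+ 2 * nq p ^+ N * (nq p + 1) ^+ 2.
Proof.
(* Each Wronskian is a power times a quadratic with outer coefficients N + 1 and a middle
   coefficient of modulus at most 2 N + 2, so that 2 r <= r^2 + 1 absorbs the middle term. *)
have key (u v w : R[i]) : normc u = 1 -> normc v = 1 -> normc w ^+ 2 = nq p ->
  normc (N.+1%:R * w ^+ 2 + (N%:R * u + N.+2%:R * v) * w + N.+1%:R) <=
  2 * N.+1%:R * (nq p + 1).
  move=> hu hv hw.
  have h1 := normcD (N.+1%:R * w ^+ 2 + (N%:R * u + N.+2%:R * v) * w) N.+1%:R.
  have h2 := normcD (N.+1%:R * w ^+ 2) ((N%:R * u + N.+2%:R * v) * w).
  have h3 := normcD (N%:R * u) (N.+2%:R * v).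
  move: h1 h2 h3; rewrite !(normcX, normcM) !normc_nat hu hv hw.
  set r := normc w; set A := normc (_ + _); set B := normc (_ + _).
  set C := normc (_ + _) => h1 h2 h3.
  have r0 : 0 <= r := normc_ge0 _.
  have : C * r <= (N%:R * 1 + N.+2%:R * 1) * r by rewrite ler_wpM2r.
  rewrite -hw -/r in h1 h2 *; rewrite -!natr1 in h1 h2 h3 *.
  have n0 : 0 <= (N%:R : R) by [].
  have := sqr_ge0 (r - 1).
  nra.
have nz : normc (z_ p) ^+ 2 = nq p by rewrite sqr_normc.
have nzb : normc (zb_ p) ^+ 2 = nq p by rewrite normcC.
have nlb : normc lb = 1 by rewrite normcC normc_l.
rewrite Wnum_factor normcM.
have -> : alp' (z_ p) * bet (z_ p) - alp (z_ p) = z_ p ^+ N *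
  (N.+1%:R * z_ p ^+ 2 + (N%:R * (- l) + N.+2%:R * (- lb)) * z_ p + N.+1%:R).
  rewrite /alp' /alp /bet -!natr1 exprS; ring: hl.
have -> : del (zb_ p) * l - del' (zb_ p) * gam (zb_ p) = - zb_ p ^+ N *
  (N.+1%:R * zb_ p ^+ 2 + (N%:R * l + N.+2%:R * lb) * zb_ p + N.+1%:R).
  rewrite /del' /del /gam -!natr1 exprS; ring: hl.
have h1 := key _ _ _ (etrans (normcN l) normc_l) (etrans (normcN lb) nlb) nz.
have h2 := key _ _ _ normc_l nlb nzb.
rewrite !normcM normcN !normcX normcC mulrACA -expr2 -exprM mulnC exprM nz.
rewrite -mulrA [X in X <= _]mulrC [X in _ <= X](_ : _ =
  (2 * N.+1%:R * (nq p + 1)) * (2 * N.+1%:R * (nq p + 1)) * nq p ^+ N); last ring.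
rewrite ler_wpM2r ?exprn_ge0 ?nq_ge0 // ler_pM ?normc_ge0 //.
Qed.

End W.

(** * Conformal metrics *)

Section ConformalCurvature.
Variable R : realType.
Implicit Types (p q : R * R) (g : R * R -> 'M[R]_2).

Lemma sum_ord2 (V : nmodType) (F : 'I_2 -> V) : \sum_(i < 2) F i = F 0 + F 1.
Proof.
by rewrite !big_ord_recl big_ord0 addr0; congr (_ + F _); exact: val_inj.
Qed.

(* [christoffel] is the real part of [conformal_coef * om], where om is the
   z-derivative of the logarithm of the conformal factor. *)
Definition conformal_coef (k i j : 'I_2) : R[i] :=
  let e (n : 'I_2) : R[i] := if n == 0 then 1 else 'i%C in
  (j == k)%:R * e i + (i == k)%:R * e j - (i == j)%:R * e k.

Variables (U : set (R * R)) (g : R * R -> 'M[R]_2) (E om : R * R -> R[i]).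
Hypothesis oU : open U.
Hypothesis gE : forall q, U q -> g q = (complex.Re (E q))%:M.
Hypothesis E_gt0 : forall q, U q -> 0 < complex.Re (E q).
Hypothesis E_real : forall q, U q -> complex.Im (E q) = 0.
Hypothesis dE : forall q, U q ->
  wirtinger E q (E q * om q) (E q * (om q)^*%C).

Lemma christoffel_conformal q k i j : U q ->
  christoffel g k i j q = complex.Re (conformal_coef k i j * om q).
Proof.
move=> Uq.
have nU : \forall r \near q, U r by exact: open_nbhs_nbhs.
have dg i' j' l' : pderiv i' (fun r => g r j' l' : R) q =
    (j' == l')%:R * (2 * complex.Re (E q) *
      complex.Re ((if i' == 0 then 1 else 'i%C) * om q)).
  rewrite /pderiv (@near_eq_derive _ _ _ _
    (fun r => complex.Re ((j' == l')%:R * E r) : R)).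
    rewrite -/(pderiv _ _ _).
    rewrite (wirtinger_pderivRe i' (wirtingerZ (j' == l')%:R (dE Uq))).
    by case: (j' == l'); case: ifP => _; rewrite !cReImE (E_real Uq) /=; ring.
  apply: filterS nU => r /gE ->; rewrite !mxE cReM.
  by case: (j' == l') => /=; rewrite ?(mulr1n, mulr0n) /=; ring.
have E0 : complex.Re (E q) != 0 by rewrite gt_eqF // E_gt0.
rewrite /christoffel gE // invmx_scalar (bigD1 k) //= big1 ?addr0; last first.
  by move=> l' /negbTE; rewrite eq_sym !mxE => ->; rewrite mulr0n mul0r.
rewrite !dg !mxE eqxx mulr1n /conformal_coef.
case: (j == k); case: (i == k); case: (i == j);
  rewrite ?(mulr1n, mulr0n) !cReImE /=; by field.
Qed.

(** This is the classical K dM = - (1/2) Laplacian (log E) dx dy, the Laplacian being 4 d^2 / dz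
    dconj z and [om] being (log E)_z. *)
Lemma curvature_density_conformal p c d : U p -> wirtinger om p c d ->
  curvature_density g p = - (2 * complex.Re d).
Proof.
move=> Up Hom.
have nU : \forall r \near p, U r by exact: open_nbhs_nbhs.
have dC k i j a : pderiv a (christoffel g k i j : R * R -> R) p =
  complex.Re (conformal_coef k i j * if a == 0 then c + d else 'i%C * (c - d)).
  rewrite /pderiv (@near_eq_derive _ _ _ _
    (fun r => complex.Re (conformal_coef k i j * om r) : R)); last first.
    by apply: filterS nU => r; exact: christoffel_conformal.
  rewrite -/(pderiv _ _ _) (wirtinger_pderivRe a (wirtingerZ _ Hom)).
  by case: ifP => _; congr complex.Re; ring.
have E0 : complex.Re (E p) != 0 by rewrite gt_eqF // E_gt0.
rewrite /curvature_density /gauss_curvature /area_density /riemann.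
rewrite !sum_ord2 !dC !christoffel_conformal // gE // det_scalar.
rewrite sqrtr_sqr ger0_norm ?ltW ?E_gt0 //.
have EM (i j : 'I_2) :
  ((complex.Re (E p))%:M : 'M[R]_2) i j = complex.Re (E p) *+ (i == j).
  by rewrite mxE.
have c000 : conformal_coef 0 0 0 = 1 by rewrite /conformal_coef /=; ring.
have c001 : conformal_coef 0 0 1 = 'i%C by rewrite /conformal_coef /=; ring.
have c010 : conformal_coef 0 1 0 = 'i%C by rewrite /conformal_coef /=; ring.
have c011 : conformal_coef 0 1 1 = -1 by rewrite /conformal_coef /=; ring.
have c111 : conformal_coef 1 1 1 = 'i%C by rewrite /conformal_coef /=; ring.
have c101 : conformal_coef 1 0 1 = 1 by rewrite /conformal_coef /=; ring.
rewrite !EM mulr1n mulr0n mul0r addr0 c000 c001 c010 c011 c111 c101 [0 == 0]/= [1 == 0]/=.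
by rewrite !cReImE /=; field.
Qed.

End ConformalCurvature.

(** * Integrals over the plane *)

Section PlaneIntegral.
Variable R : realType.
Implicit Types (p q : R * R) (h : R * R -> R).
Local Notation mu := (@lebesgue_measure R).
Local Notation RR := (measurableTypeR R * measurableTypeR R)%type.

(** An open set is the countable union of the boxes with rational endpoints that it contains, and
    boxes are measurable for the product. *)
Lemma open_measurable_prod (U : set (R * R)) : open U -> measurable (U : set RR).
Proof.
move=> oU.
pose box (a : rat * rat * (rat * rat)) : set (R * R) :=
  `]ratr a.1.1, ratr a.1.2[ `*` `]ratr a.2.1, ratr a.2.2[.
pose F a := if pselect (box a `<=` U) then box a else set0.
have -> : U = \bigcup_a F a.
  apply/seteqP; split=> [p Up|p [a _]]; last first.
    by rewrite /F; case: pselect => // + /=; exact.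
  have /nbhs_ballP[e /= e0 HU] : nbhs p U by exact: open_nbhs_nbhs.
  have lte x : x - e < x /\ x < x + e by rewrite ltrBlDr ltrDl.
  have [a1] := rat_in_itvoo (lte p.1).1; have [a2] := rat_in_itvoo (lte p.1).2.
  have [a3] := rat_in_itvoo (lte p.2).1; have [a4] := rat_in_itvoo (lte p.2).2.
  rewrite !in_itv /= => /andP[h1 h2] /andP[h3 h4] /andP[h5 h6] /andP[h7 h8].
  exists (a1, a2, (a3, a4)) => //; rewrite /F; case: pselect => /= [_|[]].
    by split; rewrite /= in_itv /=; apply/andP.
  move=> q [/= ]; rewrite !in_itv /= => /andP[q1 q2] /andP[q3 q4].
  apply: HU; split; rewrite /ball /= ltr_distl; lra.
apply: countable_bigcupT_measurable => // a.
rewrite /F; case: pselect => //= _.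
by apply: measurableX; exact: measurable_itv.
Qed.

Lemma continuous_measurable_prod h : continuous h -> measurable_fun setT (h : RR -> R).
Proof.
move=> /continuousP ch.
apply: (measurability _ (measurable_realfun.RGenOpens.measurableE R)).
move=> _ [_ [a [b ->] <-]]; rewrite setTI.
by apply: open_measurable_prod; apply: ch; exact: interval_open.
Qed.

Definition sqbox (X : R) : set (R * R) := `[- X, X] `*` `[- X, X].

Lemma measurable_sqbox X : measurable (sqbox X : set RR).
Proof. by apply: measurableX; exact: measurable_itv. Qed.

Lemma integrable_sqbox X h : continuous h ->
  (mu \x mu)%E.-integrable (sqbox X) (EFin \o h).
Proof.
move=> ch; apply: measurable_bounded_integrable.
- exact: measurable_sqbox.
- have E : (mu \x mu)%E (sqbox X) = (mu `[(- X)%R, X] * mu `[(- X)%R, X])%E.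
    by apply: product_measure1E; exact: measurable_itv.
  rewrite [ltLHS]E lebesgue_measure_itv /=; case: ifP => _; last by rewrite mule0 ltry.
  by rewrite -EFinD -EFinM ltry.
- by apply: measurable_funTS; exact: continuous_measurable_prod.
- have : compact [set h q | q in sqbox X].
    apply: continuous_compact; first exact: continuous_subspaceT.
    by apply: compact_setX; exact: segment_compact.
  move=> /compact_bounded [M [Mr HM]]; exists M; split => // x Mx q Bq.
  by apply: (HM x Mx); exists q.
Qed.

Lemma integral_sqbox1 X h : continuous h ->
  (\int[mu \x mu]_(p in sqbox X) (h p)%:E =
   \int[mu]_(x in `[(- X)%R, X]) \int[mu]_(y in `[(- X)%R, X]) (h (x, y))%:E)%E.
Proof.
move=> ch; rewrite integral_mkcond -integral12_prod_meas1; last first.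
  apply/(integrable_mkcond (mu := (mu \x mu)%E) _ (measurable_sqbox X)).
  exact: integrable_sqbox.
rewrite [RHS]integral_mkcond; apply: eq_integral => x _.
rewrite /fubini_F patchE; case: ifPn => [|] xX.
  rewrite [RHS]integral_mkcond; apply: eq_integral => y _.
  rewrite !patchE; congr (if _ then _ else _).
  apply/idP/idP => [|Hy]; first by rewrite !inE => -[].
  by move: xX Hy; rewrite !inE.
rewrite -[RHS]/(0 : \bar R)%E; apply: integral0_eq => y _; rewrite patchE ifN //.
by apply: contra xX; rewrite !inE => -[].
Qed.

Lemma integral_sqbox2 X h : continuous h ->
  (\int[mu \x mu]_(p in sqbox X) (h p)%:E =
   \int[mu]_(y in `[(- X)%R, X]) \int[mu]_(x in `[(- X)%R, X]) (h (x, y))%:E)%E.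
Proof.
move=> ch; rewrite integral_mkcond -integral21_prod_meas1; last first.
  apply/(integrable_mkcond (mu := (mu \x mu)%E) _ (measurable_sqbox X)).
  exact: integrable_sqbox.
rewrite [RHS]integral_mkcond; apply: eq_integral => y _.
rewrite /fubini_G patchE; case: ifPn => [|] yX.
  rewrite [RHS]integral_mkcond; apply: eq_integral => x _.
  rewrite !patchE; congr (if _ then _ else _).
  apply/idP/idP => [|Hx]; first by rewrite !inE => -[].
  by move: yX Hx; rewrite !inE.
rewrite -[RHS]/(0 : \bar R)%E; apply: integral0_eq => x _; rewrite patchE ifN //.
by apply: contra yX; rewrite !inE => -[].
Qed.

Lemma FTC_segment (F f : R -> R) (a b : R) : a < b ->
  (forall x : R, is_derive x (1 : R) F (f x)) -> continuous f ->
  (\int[mu]_(x in `[a, b]) (f x)%:E = (F b - F a)%:E)%E.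
Proof.
move=> ab dF cf.
have cF : continuous F.
  by move=> x; apply: differentiable_continuous; apply/derivable1_diffP; case: (dF x).
rewrite (@continuous_FTC2 _ f F) //.
- exact: continuous_subspaceT.
- split; first by move=> x _; case: (dF x).
  + by apply: cvg_at_right_filter; exact: cF.
  + by apply: cvg_at_left_filter; exact: cF.
- by move=> x _; rewrite derive1E; case: (dF x).
Qed.

Lemma integrable_oneDsqrV : mu.-integrable setT (EFin \o (fun x : R => (oneDsqr x)^-1)).
Proof.
apply/integrableP; split.
  apply/measurable_EFinP; apply: continuous_measurable_fun.
  exact: continuous_oneDsqrV.
rewrite (eq_integral (fun x : measurableTypeR R => ((oneDsqr x)^-1)%:E)); last first.
  by move=> x _ /=; rewrite ger0_norm // invr_ge0 (le_trans ler01) // oneDsqr_ge1.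
rewrite ge0_symfun_integralT.
- have -> : [set x : R | 0 <= x] = `[0, +oo[%classic.
    by apply/seteqP; split => x /=; rewrite in_itv /= andbT.
  by rewrite integral0y_oneDsqr -EFinM ltry.
- by move=> x; rewrite invr_ge0 (le_trans ler01) // oneDsqr_ge1.
- exact: continuous_oneDsqrV.
- by move=> x /=; rewrite /oneDsqr sqrrN.
Qed.

(** This product is the dominating function for the curvature: it majorises (1 + rho)^-2, since (1 +
    x^2) (1 + y^2) <= (1 + rho)^2, and its integrability follows from Tonelli without polar
    coordinates. *)
Lemma integrable_oneDsqrV2 : (mu \x mu)%E.-integrable setT
  (EFin \o (fun p : R * R => (oneDsqr p.1)^-1 * (oneDsqr p.2)^-1)).
Proof.
have ch : continuous (fun p : R * R => (oneDsqr p.1)^-1 * (oneDsqr p.2)^-1).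
  move=> p; apply: cvgM.
    by apply: (@continuous_comp _ _ _ fst (fun x => (oneDsqr x)^-1));
      [exact: cvg_fst|exact: continuous_oneDsqrV].
  by apply: (@continuous_comp _ _ _ snd (fun x => (oneDsqr x)^-1));
    [exact: cvg_snd|exact: continuous_oneDsqrV].
apply/integrable12ltyP.
  by apply/measurable_EFinP; exact: continuous_measurable_prod.
have [m1 h1] := integrableP _ _ _ integrable_oneDsqrV.
have p0 (x : R) : 0 <= (oneDsqr x)^-1.
  by rewrite invr_ge0 (le_trans ler01) // oneDsqr_ge1.
pose k (x : measurableTypeR R) : R := (oneDsqr x)^-1.
have mk : measurable_fun setT (fun x => `|(k x)%:E|%E).
  by apply: measurableT_comp.
rewrite (eq_integral (fun x => (k x)%:E * \int[mu]_y `|(k y)%:E|)%E); last first.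
  move=> x _; rewrite -ge0_integralZl //; last by rewrite lee_fin p0.
  by apply: eq_integral => y _ /=; rewrite -EFinM !ger0_norm ?mulr_ge0 ?p0.
rewrite ge0_integralZr //; last 2 first.
- by move=> x _; rewrite lee_fin p0.
- by apply: integral_ge0.
apply: lte_mul_pinfty.
- by apply: integral_ge0 => x _; rewrite lee_fin p0.
- exact: (integrable_fin_num measurableT integrable_oneDsqrV).
- by [].
Qed.

End PlaneIntegral.

(** * Green's formula on squares and the flux at infinity *)

Section Flux.
Variable R : realType.
Implicit Types (p q : R * R).
Import Normc.
Local Notation mu := (@lebesgue_measure R).
Local Notation RR := (measurableTypeR R * measurableTypeR R)%type.

Lemma is_diff_pairr (s y : R) :
  is_diff s (fun t : R => (t, y)) (fun v : R => (v, 0 : R)).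
Proof. exact: (is_diff_pair (is_diff_id s) (is_diff_cst y s)). Qed.

Lemma is_diff_pairl (s x : R) :
  is_diff s (fun t : R => (x, t)) (fun v : R => (0 : R, v)).
Proof. exact: (is_diff_pair (is_diff_cst x s) (is_diff_id s)). Qed.

Lemma is_derive_pairr (s y : R) : is_derive s (1 : R) (fun t : R => (t, y)) (1, 0).
Proof.
have [d1 d2] := is_diff_pairr s y.
by split; [exact: diff_derivable|rewrite deriveE // d2].
Qed.

Lemma is_derive_pairl (s x : R) : is_derive s (1 : R) (fun t : R => (x, t)) (0, 1).
Proof.
have [d1 d2] := is_diff_pairl s x.
by split; [exact: diff_derivable|rewrite deriveE // d2].
Qed.

Variables (om c d : R * R -> R[i]) (K C : R).
Hypothesis dom : forall p, wirtinger om p (c p) (d p).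
Hypothesis cc : continuous (fun p => complex.Re (c p) : R).
Hypothesis cd : continuous (fun p => complex.Re (d p) : R).

Lemma is_derive_Re_om x y : is_derive x (1 : R)
  (fun s => complex.Re (om (s, y)) : R) (complex.Re (c (x, y)) + complex.Re (d (x, y))).
Proof.
have [d1 d2] := is_derive_pairr x y.
have := wirtinger_is_derive_curve (dom (x, y)) d1.
by rewrite derive1E d2 /toC !cReImE /= !mulr1 !mulr0 !subr0 oppr0 mulr0 subr0.
Qed.

Lemma is_derive_Im_om x y : is_derive y (1 : R)
  (fun s => - complex.Im (om (x, s)) : R) (complex.Re (d (x, y)) - complex.Re (c (x, y))).
Proof.
have [d1 d2] := is_derive_pairl y x.
(* The rule for real parts is applied to i om, whose real part is - Im om. *)
have := wirtinger_is_derive_curve (wirtingerZ 'i%C (dom (x, y))) d1.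
rewrite derive1E d2 /toC.
under [X in is_derive _ _ X]eq_fun do rewrite cReM /= mul0r mul1r sub0r.
set u := complex.Re _; set v := _ - _; suff -> : u = v by [].
by rewrite /u /v !cReImE /=; ring.
Qed.
Let cRe : continuous (fun p => complex.Re (om p) : R).
Proof. by move=> p; have [] := wirtinger_continuous (dom p). Qed.
Let cIm : continuous (fun p => complex.Im (om p) : R).
Proof. by move=> p; have [] := wirtinger_continuous (dom p). Qed.

Lemma continuous_pairr (h : R * R -> R) y : continuous h ->
  continuous (fun x => h (x, y)).
Proof.
move=> ch x; apply: (@continuous_comp _ _ _ (fun s : R => (s, y)) h); last exact: ch.
by apply: differentiable_continuous; case: (is_diff_pairr x y).
Qed.

Lemma continuous_pairl (h : R * R -> R) x : continuous h ->
  continuous (fun y => h (x, y)).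
Proof.
move=> ch y; apply: (@continuous_comp _ _ _ (fun s : R => (x, s)) h); last exact: ch.
by apply: differentiable_continuous; case: (is_diff_pairl y x).
Qed.

(** The outward flux density of the field (Re om, - Im om), whose divergence is 2 Re d, through the
    four sides of the square at once. *)
Let S (X t : R) : R := complex.Re (om (X, t)) - complex.Re (om (- X, t)) +
  (complex.Im (om (t, - X)) - complex.Im (om (t, X))).

Let cS X : continuous (S X).
Proof.
move=> t; apply: cvgD; apply: cvgB.
- exact: (@continuous_pairl (fun p => complex.Re (om p))).
- exact: (@continuous_pairl (fun p => complex.Re (om p))).
- exact: (@continuous_pairr (fun p => complex.Im (om p))).
- exact: (@continuous_pairr (fun p => complex.Im (om p))).
Qed.

Let int1 (f : R -> R) a b : continuous f ->
  mu.-integrable `[a, b] (EFin \o f).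
Proof.
move=> cf; apply: continuous_compact_integrable; first exact: segment_compact.
exact: continuous_subspaceT.
Qed.

Lemma green_square X : 0 < X ->
  (\int[mu \x mu]_(p in sqbox X) (2 * complex.Re (d p))%:E =
   \int[mu]_(t in `[(- X)%R, X]) (S X t)%:E)%E.
Proof.
move=> X0; have NX : - X < X by rewrite gtrN.
pose h1 p : R := complex.Re (c p) + complex.Re (d p).
pose h2 p : R := complex.Re (d p) - complex.Re (c p).
have ch1 : continuous h1 by move=> p; apply: cvgD; [exact: cc|exact: cd].
have ch2 : continuous h2 by move=> p; apply: cvgB; [exact: cd|exact: cc].
transitivity (\int[mu \x mu]_(p in sqbox X) ((EFin \o h1) p + (EFin \o h2) p))%E.
  by apply: eq_integral => p _; rewrite /= -EFinD; congr EFin; rewrite /h1 /h2; ring.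
have -> := @integralD _ _ _ (mu \x mu)%E (sqbox X) (measurable_sqbox X)
  (EFin \o h1) (EFin \o h2) (integrable_sqbox X ch1) (integrable_sqbox X ch2).
rewrite (integral_sqbox2 X ch1) (integral_sqbox1 X ch2).
have FTC1 y := FTC_segment NX (is_derive_Re_om^~ y) (@continuous_pairr h1 y ch1).
have FTC2 x := FTC_segment NX (is_derive_Im_om x) (@continuous_pairl h2 x ch2).
transitivity (\int[mu]_(y in `[(- X)%R, X]) (complex.Re (om (X, y)) - complex.Re (om (- X, y)))%:E +
  \int[mu]_(x in `[(- X)%R, X]) (- complex.Im (om (x, X)) - - complex.Im (om (x, - X)))%:E)%E.
  by congr (_ + _)%E; apply: eq_integral => t _; [exact: FTC1|exact: FTC2].
rewrite -(@integralD _ _ _ mu `[(- X)%R, X] _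
  (EFin \o (fun t => complex.Re (om (X, t)) - complex.Re (om (- X, t))))
  (EFin \o (fun t => - complex.Im (om (t, X)) - - complex.Im (om (t, - X))))) //.
- apply: eq_integral => t _; rewrite /S -EFinD; congr EFin; ring.
- apply: int1 => t; apply: cvgB;
    exact: (@continuous_pairl (fun p => complex.Re (om p))).
- apply: int1 => t; apply: cvgB; apply: cvgN;
    exact: (@continuous_pairr (fun p => complex.Im (om p))).
Qed.

Hypothesis om_asym : forall p, 1 <= nq p ->
  normc (om p - K%:C / toC p) <= C / nq p.

(** The field K / z contributes K X / (X^2 + t^2) on each of the four sides; as |z|^2 >= X^2 on the
    boundary, each side adds an error of at most C / X^2. *)
Lemma S_asym X t : 1 <= X ->
  `|S X t - 4 * K * X / (X ^+ 2 + t ^+ 2)| <= 4 * C / X ^+ 2.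
Proof.
move=> X1.
have X2 : 1 <= X ^+ 2 by rewrite exprn_ege1.
have C0 : 0 <= C.
  have n1 : 1 <= nq (1, 0 : R) by rewrite /nq /= expr1n expr0n /= addr0.
  have := le_trans (normc_ge0 _) (om_asym n1).
  by rewrite /nq /= expr1n expr0n /= addr0 divr1.
have key p : X ^+ 2 <= nq p -> normc (om p - K%:C / toC p) <= C / X ^+ 2.
  move=> h; apply: le_trans (om_asym (le_trans X2 h)) _.
  by rewrite ler_wpM2l // lef_pV2 // posrE; lra.
have t2 := sqr_ge0 t.
have h1 : `|complex.Re (om (X, t)) - K * X / (X ^+ 2 + t ^+ 2)| <= C / X ^+ 2.
  apply: le_trans (key (X, t) _); last by rewrite /nq /=; lra.
  apply: le_trans (ler_Re_normc _); rewrite le_eqVlt; apply/orP; left; apply/eqP.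
  by congr `|_|; rewrite !cReImE cReV cImV /=; field; nra.
have h2 : `|complex.Re (om (- X, t)) + K * X / (X ^+ 2 + t ^+ 2)| <= C / X ^+ 2.
  apply: le_trans (key (- X, t) _); last by rewrite /nq /= sqrrN; lra.
  apply: le_trans (ler_Re_normc _); rewrite le_eqVlt; apply/orP; left; apply/eqP.
  by congr `|_|; rewrite !cReImE cReV cImV /=; field; nra.
have h3 : `|complex.Im (om (t, X)) + K * X / (X ^+ 2 + t ^+ 2)| <= C / X ^+ 2.
  apply: le_trans (key (t, X) _); last by rewrite /nq /=; lra.
  apply: le_trans (ler_Im_normc _); rewrite le_eqVlt; apply/orP; left; apply/eqP.
  by congr `|_|; rewrite !cReImE cReV cImV /=; field; nra.
have h4 : `|complex.Im (om (t, - X)) - K * X / (X ^+ 2 + t ^+ 2)| <= C / X ^+ 2.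
  apply: le_trans (key (t, - X) _); last by rewrite /nq /= sqrrN; lra.
  apply: le_trans (ler_Im_normc _); rewrite le_eqVlt; apply/orP; left; apply/eqP.
  by congr `|_|; rewrite !cReImE cReV cImV /=; field; nra.
rewrite /S; set k := K * X / _ in h1 h2 h3 h4.
have -> : 4 * K * X / (X ^+ 2 + t ^+ 2) = 4 * k by rewrite /k; ring.
have -> : 4 * C / X ^+ 2 = 4 * (C / X ^+ 2) by ring.
move: h1 h2 h3 h4; rewrite !ler_norml; lra.
Qed.

Lemma integral_kernel X : 0 < X ->
  (\int[mu]_(t in `[(- X)%R, X]) (4 * K * X / (X ^+ 2 + t ^+ 2))%:E =
   (2 * pi * K)%:E)%E.
Proof.
move=> X0.
have p0 t : 0 < X ^+ 2 + t ^+ 2 by rewrite ltr_pwDl ?exprn_gt0 ?sqr_ge0.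
have X0' : X != 0 by rewrite gt_eqF.
(* Whatever X is, the arctangent of t / X grows by pi / 2 between - X and X. *)
pose F t := 4 * K * atan (t / X).
have dF t : is_derive t (1 : R) F (4 * K * X / (X ^+ 2 + t ^+ 2)).
  have d1 : is_derive t (1 : R) (fun t : R => t / X) X^-1.
    have := is_deriveM (is_derive_id t 1) (is_derive_cst X^-1 t (1 : R)).
    move=> H; apply: is_derive_eq H _.
    by rewrite /GRing.scale /= mulr0 add0r mulr1.
  have := is_deriveZ (4 * K) (@is_derive1_comp _ atan (fun t : R => t / X) _ _ _
    (is_derive1_atan (t / X)) d1).
  move=> H; apply: is_derive_eq H _.
  rewrite /GRing.scale /= expr_div_n.
  by field; rewrite X0' /= gt_eqF //.
have ck : continuous (fun t : R => 4 * K * X / (X ^+ 2 + t ^+ 2)).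
  move=> t; apply: cvgM; first exact: cvg_cst.
  apply: cvgV; first by rewrite gt_eqF.
  by apply: cvgD; [exact: cvg_cst|exact: exprn_continuous].
have NX : - X < X by rewrite gtrN.
by rewrite (FTC_segment NX dF ck) /F mulNr divff // atanN atan1; congr EFin; field.
Qed.

Lemma flux_square X : 1 <= X ->
  exists2 j : R, (\int[mu \x mu]_(p in sqbox X) (2 * complex.Re (d p))%:E = j%:E)%E &
    `|j - 2 * pi * K| <= 8 * C / X.
Proof.
move=> X1; have X0 : 0 < X by lra.
have p0 t : 0 < X ^+ 2 + t ^+ 2 by rewrite ltr_pwDl ?exprn_gt0 ?sqr_ge0.
pose k t := 4 * K * X / (X ^+ 2 + t ^+ 2).
have ck : continuous k.
  move=> t; apply: cvgM; first exact: cvg_cst.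
  apply: cvgV; first by rewrite gt_eqF.
  by apply: cvgD; [exact: cvg_cst|exact: exprn_continuous].
exists (\int[mu]_(t in `[(- X), X]) S X t).
  rewrite green_square // /Rintegral fineK //.
  by apply: integrable_fin_num => //; apply: int1; exact: cS.
have -> : 2 * pi * K = \int[mu]_(t in `[(- X), X]) k t.
  by rewrite /Rintegral integral_kernel.
rewrite -RintegralB //; [|exact: int1|exact: int1].
have cSk : continuous (fun t => S X t - k t).
  by move=> t; apply: cvgB; [exact: cS|exact: ck].
apply: le_trans (le_normr_Rintegral _ (int1 _ _ cSk)) _ => //.
(* The error is the length 2 X of the interval times the bound 4 C / X^2 of [S_asym]. *)
have -> : 8 * C / X = \int[mu]_(t in `[(- X), X]) (4 * C / X ^+ 2).
  rewrite Rintegral_cst //.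
  have E : mu `[(- X), X] = (2 * X)%:E.
    by rewrite lebesgue_measure_itv /= lte_fin gtrN // -EFinD; congr EFin; ring.
  by rewrite [X in fine X]E /=; field; rewrite gt_eqF.
apply: le_Rintegral => //.
- apply: int1 => t; apply: (@continuous_comp _ _ _ (fun t => S X t - k t) (fun x : R => `|x|)).
    exact: cSk.
  exact: norm_continuous.
- by apply: int1 => t; exact: cvg_cst.
- by move=> t _; exact: S_asym.
Qed.

Hypothesis fi : (mu \x mu)%E.-integrable setT
  (EFin \o (fun p => 2 * complex.Re (d p))).

(** [flux_square] gives the limit over growing squares; with [fi], dominated convergence identifies
    this limit with the Lebesgue integral. *)
Theorem flux_plane :
  (\int[mu \x mu]_p (2 * complex.Re (d p))%:E = (2 * pi * K)%:E)%E.
Proof.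
pose f : RR -> \bar R := EFin \o (fun p => 2 * complex.Re (d p)).
have mf : measurable_fun setT f by case/integrableP: fi.
pose fn (n : nat) : RR -> \bar R := f \_ (sqbox n.+1%:R).
have h1 n : measurable_fun setT (fn n).
  apply/(measurable_restrictT _ (measurable_sqbox _)).
  exact: measurable_funTS.
have h2 p : fn ^~ p @ \oo --> f p.
  apply: cvg_near_cst; near=> n.
  rewrite /fn patchE mem_set //.
  have hn : `|p.1| + `|p.2| <= n.+1%:R.
    apply: (@le_trans _ _ n%:R); last by rewrite ler_nat.
    by near: n; exact: nbhs_infty_ger.
  have [a1 a2] := (normr_ge0 p.1, normr_ge0 p.2).
  by split; rewrite /= in_itv /= -ler_norml; lra.
have h3 n p : (`|fn n p| <= `|f p|)%E.
  by rewrite /fn patchE; case: ifP => // _; rewrite abse0.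
have h2' : \forall p \ae (mu \x mu)%E, setT p -> fn ^~ p @ \oo --> f p.
  by apply: aeW => p _; exact: h2.
have h3' : \forall p \ae (mu \x mu)%E, forall n, setT p -> (`|fn n p| <= `|f p|)%E.
  by apply: aeW => p n _; exact: h3.
have [_ _ H] := dominated_convergence measurableT h1 mf h2' (integrable_abse fi) h3'.
have H2 : (fun n => \int[mu \x mu]_p fn n p)%E @ \oo --> (2 * pi * K)%:E.
  have [j Hj hj] : exists2 j : nat -> R,
      (forall n, \int[mu \x mu]_p fn n p = (j n)%:E)%E &
      forall n, `|j n - 2 * pi * K| <= 8 * C / n.+1%:R.
    have /choice[j Hj] n : exists y : R, (\int[mu \x mu]_p fn n p = y%:E)%E /\
        `|y - 2 * pi * K| <= 8 * C / n.+1%:R.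
      have [y Hy1 Hy2] := @flux_square n.+1%:R (ler1n _ _).
      by exists y; split => //; rewrite -Hy1 [RHS]integral_mkcond.
    by exists j => n; case: (Hj n).
  under eq_fun do rewrite Hj.
  apply: cvg_EFin; first exact: nearW.
  apply/cvgrPdist_lt => e e0; near=> n; rewrite distrC /=.
  have hn : 8 * C / e <= n%:R by near: n; exact: nbhs_infty_ger.
  apply: le_lt_trans (hj n) _.
  rewrite ltr_pdivrMr // -natr1; move: hn; rewrite ler_pdivrMr //.
  by move: e0; rewrite /=; nra.
exact: (cvg_unique (@ereal_hausdorff R) H H2).
Unshelve. all: by end_near. Qed.

End Flux.

(** * The integral of the Hessian of log |W|^2 *)

Section WIntegral.
Variables (R : realType) (l : R[i]) (N : nat).
Hypothesis hl : l * l^*%C = 1.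
Hypothesis hb : complex.Im l != 0.
Implicit Types (p q : R * R).
Import Normc.
Local Notation mu := (@lebesgue_measure R).
Local Notation W := (W l N).
Local Notation Wz := (Wz l N).
Local Notation Wzb := (Wzb l N).
Local Notation Wzz := (Wzz l N).
Local Notation Wzzb := (Wzzb l N).
Local Notation Wzbzb := (Wzbzb l N).
Local Notation Wnum := (Wnum l N).

Lemma W_neq0 p : W p != 0.
Proof.
have [c c0 H] := W_lower N hl hb.
have h1 : 0 < nq p + 1 by rewrite ltr_wpDl ?nq_ge0.
have h2 : 0 < nq p ^+ N.+1 + 1 by rewrite ltr_wpDl ?exprn_ge0 ?nq_ge0.
apply/eqP => W0; have := H p; rewrite W0 normc0 leNgt => /negP; apply.
by rewrite !mulr_gt0.
Qed.

(* d(log |W|^2)/dz *)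
Definition dlogW p : R[i] := Wz p / W p + (Wzb p / W p)^*%C.
Definition dlogW_z p : R[i] := (Wzz p * W p - Wz p ^+ 2) / W p ^+ 2 +
  ((Wzbzb p * W p - Wzb p ^+ 2) / W p ^+ 2)^*%C.
Definition dlogW_zb p : R[i] := Wnum p / W p ^+ 2 + (Wnum p / W p ^+ 2)^*%C.

Lemma wirtinger_dlogW p : wirtinger dlogW p (dlogW_z p) (dlogW_zb p).
Proof.
have W0 := W_neq0 p.
have HV := wirtingerV W0 (wirtinger_W l N p).
have H := wirtingerD (wirtingerM (wirtinger_Wz l N p) HV)
  (wirtingerC (wirtingerM (wirtinger_Wzb l N p) HV)).
apply: wirtinger_eq H _ _; rewrite /dlogW_z /dlogW_zb /Wnum;
  congr (_ + (_)^*%C); by field.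
Qed.

(** Only continuity is wanted from this predicate; the Wirtinger rules make it stable under the
    field operations and conjugation, which build both derivatives of [dlogW]. *)
Definition wdiff (f : R * R -> R[i]) := forall p, exists a b, wirtinger f p a b.

Lemma wdiff_Re_continuous f : wdiff f -> continuous (fun p => complex.Re (f p) : R).
Proof. by move=> H p; have [a [b /wirtinger_continuous[]]] := H p. Qed.

Lemma wdiff_cst c : wdiff (fun=> c).
Proof. by move=> p; exists 0, 0; exact: wirtinger_cst. Qed.

Lemma wdiff_id : wdiff (@toC R).
Proof. by move=> p; exists 1, 0; exact: wirtinger_id. Qed.

Lemma wdiffD f g : wdiff f -> wdiff g -> wdiff (fun p => f p + g p).
Proof.
move=> Hf Hg p; have [[a [b hf]] [c [d hg]]] := (Hf p, Hg p).
by exists (a + c), (b + d); exact: wirtingerD.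
Qed.

Lemma wdiffN f : wdiff f -> wdiff (fun p => - f p).
Proof.
move=> Hf p; have [a [b hf]] := Hf p.
by exists (- a), (- b); exact: wirtingerN.
Qed.

Lemma wdiffM f g : wdiff f -> wdiff g -> wdiff (fun p => f p * g p).
Proof.
move=> Hf Hg p; have [[a [b hf]] [c [d hg]]] := (Hf p, Hg p).
by eexists; eexists; exact: wirtingerM hf hg.
Qed.

Lemma wdiffX f n : wdiff f -> wdiff (fun p => f p ^+ n).
Proof.
move=> Hf p; have [a [b hf]] := Hf p.
by eexists; eexists; exact: wirtingerX hf.
Qed.

Lemma wdiffC f : wdiff f -> wdiff (fun p => (f p)^*%C).
Proof.
move=> Hf p; have [a [b hf]] := Hf p.
by eexists; eexists; exact: wirtingerC hf.
Qed.

Lemma wdiffV f : (forall p, f p != 0) -> wdiff f -> wdiff (fun p => (f p)^-1).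
Proof.
move=> f0 Hf p; have [a [b hf]] := Hf p.
by eexists; eexists; exact: wirtingerV (f0 p) hf.
Qed.

Let wdiffW : wdiff W. Proof. by move=> p; exists (Wz p), (Wzb p); exact: wirtinger_W. Qed.
Let wdiffWz : wdiff Wz. Proof. by move=> p; exists (Wzz p), (Wzzb p); exact: wirtinger_Wz. Qed.
Let wdiffWzb : wdiff Wzb. Proof. by move=> p; exists (Wzzb p), (Wzbzb p); exact: wirtinger_Wzb. Qed.

Ltac wd := repeat first
  [ exact: wdiffW | exact: wdiffWz | exact: wdiffWzb
  | exact: wdiff_id | exact: wdiff_cst
  | (apply: wdiffV; [by move=> ?; rewrite ?expf_neq0 ?W_neq0|])
  | apply: wdiffC | apply: wdiffN | apply: wdiffX | apply: wdiffD | apply: wdiffM].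

Let wdiffWzz : wdiff Wzz.
Proof. by rewrite /Wzz /alp'' /del; wd. Qed.
Let wdiffWzbzb : wdiff Wzbzb.
Proof. by rewrite /Wzbzb /alp /del''; wd. Qed.
Let wdiffWzzb : wdiff Wzzb.
Proof. by rewrite /Wzzb /alp' /del'; wd. Qed.

Lemma continuous_dlogW_z : continuous (fun p => complex.Re (dlogW_z p) : R).
Proof.
have V2 : wdiff (fun p => (W p ^+ 2)^-1).
  by apply: wdiffV; [move=> p; rewrite expf_neq0 ?W_neq0|exact: wdiffX].
apply: wdiff_Re_continuous; apply: wdiffD; last apply: wdiffC.
  apply: wdiffM V2; apply: wdiffD; first exact: wdiffM wdiffWzz wdiffW.
  by apply: wdiffN; exact: wdiffX wdiffWz.
apply: wdiffM V2; apply: wdiffD; first exact: wdiffM wdiffWzbzb wdiffW.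
by apply: wdiffN; exact: wdiffX wdiffWzb.
Qed.

Lemma continuous_dlogW_zb : continuous (fun p => complex.Re (dlogW_zb p) : R).
Proof.
have V2 : wdiff (fun p => (W p ^+ 2)^-1).
  by apply: wdiffV; [move=> p; rewrite expf_neq0 ?W_neq0|exact: wdiffX].
have H : wdiff (fun p => Wnum p / W p ^+ 2).
  apply: wdiffM V2; apply: wdiffD; first exact: wdiffM wdiffWzzb wdiffW.
  by apply: wdiffN; exact: wdiffM wdiffWz wdiffWzb.
by apply: wdiff_Re_continuous; apply: wdiffD => //; exact: wdiffC.
Qed.

Lemma expr_le1D (x : R) j k : 0 <= x -> (j <= k)%N -> x ^+ j <= 1 + x ^+ k.
Proof.
move=> x0 jk; have [x1|x1] := lerP x 1.
  by rewrite (le_trans (exprn_ile1 _ x0 x1)) // lerDl exprn_ge0.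
by rewrite (le_trans (ler_weXn2l (ltW x1) jk)) // lerDr.
Qed.

Lemma integrable_dlogW_zb : (0 < N)%N -> (mu \x mu)%E.-integrable setT
  (EFin \o (fun p => 2 * complex.Re (dlogW_zb p))).
Proof.
move=> N0; have [c c0 Hc] := W_lower N hl hb.
(* The number 64 is the product of a 4 from twice the real part of two conjugate terms, a 4 from
   [Wnum_le] and a 4 from [h2]. *)
pose M := 64 * N.+1%:R ^+ 2 / c ^+ 2.
have I2 := integrableZl measurableT M (integrable_oneDsqrV2 R).
apply: (le_integrable measurableT _ _ I2).
  apply/measurable_EFinP; apply: continuous_measurable_prod => p.
  by apply: cvgM; [exact: cvg_cst|exact: continuous_dlogW_zb].
move=> p _ /=; rewrite lee_fin.
have r0 := nq_ge0 p.
set rho := nq p in r0 *.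
have Wp : 0 < normc (W p) by apply: normc_gt0; exact: W_neq0.
have h1 : `|2 * complex.Re (dlogW_zb p)| <= 4 * (normc (Wnum p) / normc (W p) ^+ 2).
  have -> : 2 * complex.Re (dlogW_zb p) = 4 * complex.Re (Wnum p / W p ^+ 2).
    by rewrite /dlogW_zb cReD cReC; ring.
  rewrite normrM ger0_norm // ler_wpM2l //.
  by rewrite (le_trans (ler_Re_normc _)) // normcM normcV normcX.
apply: le_trans h1 _.
have rn : 0 <= rho ^+ N.+1 by rewrite exprn_ge0.
(* One factor rho^(N+1) + 1 absorbs (rho + 1)^2, which takes N + 1 >= 2; the other absorbs rho^N. *)
have h2 : rho ^+ N * (rho + 1) ^+ 2 <= 4 * (rho ^+ N.+1 + 1) ^+ 2.
  have e1 := expr_le1D r0 (leqnSn N).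
  have e2 := expr_le1D r0 (N0 : (2 <= N.+1)%N).
  have e3 : 0 <= rho ^+ N by rewrite exprn_ge0.
  have := sqr_ge0 (rho - 1).
  have : (rho + 1) ^+ 2 <= 4 * (rho ^+ N.+1 + 1) by nra.
  by nra.
have h3 : (oneDsqr p.1) * (oneDsqr p.2) <= (rho + 1) ^+ 2.
  rewrite /oneDsqr /rho /nq; have := sqr_ge0 p.1; have := sqr_ge0 p.2; nra.
have od (x : R) : 0 < oneDsqr x by rewrite (lt_le_trans ltr01) // oneDsqr_ge1.
have M0 : 0 <= M by rewrite divr_ge0 ?sqr_ge0 // mulr_ge0 ?sqr_ge0.
rewrite (ger0_norm (x := M * _)) ?mulr_ge0 ?invr_ge0 ?(ltW (od _)) //.
rewrite -invfM !mulrA ler_pdivrMr ?exprn_gt0 // mulrAC ler_pdivlMr ?mulr_gt0 //.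
have hA := Wnum_le N hl p; rewrite -/rho in hA.
have hB := Hc p; rewrite -/rho in hB.
have n2 : 0 <= N.+1%:R ^+ 2 :> R by rewrite sqr_ge0.
have r1 : 0 <= (rho + 1) ^+ 2 by rewrite sqr_ge0.
apply: (@le_trans _ _ (4 * (4 * N.+1%:R ^+ 2 * rho ^+ N * (rho + 1) ^+ 2) * (rho + 1) ^+ 2)).
  apply: ler_pM => //; rewrite ?mulr_ge0 ?normc_ge0 ?(ltW (od _)) //.
  by rewrite ler_wpM2l.
have B2 : (c * (rho + 1) * (rho ^+ N.+1 + 1)) ^+ 2 <= normc (W p) ^+ 2.
  rewrite lerXn2r // nnegrE ?normc_ge0 // !mulr_ge0 ?(ltW c0) //; lra.
apply: le_trans (ler_wpM2l M0 B2).
have -> : M * (c * (rho + 1) * (rho ^+ N.+1 + 1)) ^+ 2 =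
  16 * N.+1%:R ^+ 2 * (rho + 1) ^+ 2 * (4 * (rho ^+ N.+1 + 1) ^+ 2).
  by rewrite /M; field; rewrite gt_eqF.
have -> : 4 * (4 * N.+1%:R ^+ 2 * rho ^+ N * (rho + 1) ^+ 2) * (rho + 1) ^+ 2 =
  16 * N.+1%:R ^+ 2 * (rho + 1) ^+ 2 * (rho ^+ N * (rho + 1) ^+ 2) by ring.
by rewrite ler_wpM2l // mulr_ge0 // mulr_ge0.
exact: sqr_ge0.
Qed.

Lemma dlogW_asym : exists C, forall p, 1 <= nq p ->
  normc (dlogW p - (2 * N.+2%:R)%:C / toC p) <= C / nq p.
Proof.
have [c c0 Hc] := W_lower N hl hb.
exists (2 * (4 * N%:R + 10) / c) => p n1.
set z := toC p; set w := z^*%C; set r := normc z.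
have nlr : normc l = 1 by exact: normc_l.
have nlb : normc l^*%C = 1 by rewrite normcC.
have nz : r ^+ 2 = nq p by rewrite /r sqr_normc.
have rw : normc w = r by rewrite normcC.
have r1 : 1 <= r.
  by rewrite -(@ler_pXn2r _ 2) ?nnegrE ?normc_ge0 // expr1n nz.
have r0 : 0 < r by lra.
have z0 : z != 0 by apply: contraTneq r0 => E; rewrite /r E normc0 ltxx.
have W0 := W_neq0 p.
(* W has degree N + 2 in z and in w = conj z. Subtracting N + 2 from the Euler operators z d/dz and
   w d/dw kills the top power, which lowers the growth from r^(2N+4) to r^(2N+3). *)
pose A1 := z * Wz p - N.+2%:R * W p.
pose A2 := w * Wzb p - N.+2%:R * W p.
have E : dlogW p - (2 * N.+2%:R)%:C / z = (A1 / W p + (A2 / W p)^*%C) / z.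
  have -> : (2 * N.+2%:R)%:C = N.+2%:R + (N.+2%:R)^*%C :> R[i].
    by rewrite conjc_nat rmorphM !rmorph_nat; ring.
  have -> : A1 / W p = z * (Wz p / W p) - N.+2%:R by rewrite /A1; field.
  have -> : A2 / W p = w * (Wzb p / W p) - N.+2%:R by rewrite /A2; field.
  have -> : (w * (Wzb p / W p) - N.+2%:R)^*%C =
      w^*%C * (Wzb p / W p)^*%C - (N.+2%:R)^*%C.
    by rewrite [LHS]raddfB; congr (_ - _); exact: rmorphM.
  have -> : w^*%C = z by exact: conjcK.
  have F (a b n n' y : R[i]) : y != 0 ->
      a + b - (n + n') / y = (y * a - n + (y * b - n')) / y.
    by move=> ?; field.
  exact: F.
have E1 : A1 = l * z ^+ N.+1 * del l N w - (N.+2%:R * l^*%C - N.+1%:R * z) * gam l w.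
  rewrite /A1 /Wz /W -/z -/w /alp' /alp /bet exprS -!natr1; ring.
have E2 : A2 = - (alp l N z * w ^+ N.+1) + bet l z * (N.+2%:R + N.+1%:R * l * w).
  rewrite /A2 /Wzb /W -/z -/w /del' /del /gam exprS -!natr1; ring.
have g1 : normc (gam l w) <= 1 + r.
  by rewrite (le_trans (normcD _ _)) // normcM nlr rw mul1r normc1.
have g2 : normc (bet l z) <= 1 + r.
  by rewrite (le_trans (normcB _ _)) // nlb addrC.
have g3 : normc (del l N w) <= r ^+ N.+1 * (1 + r).
  rewrite normcM normcX rw mulrC ler_wpM2l ?exprn_ge0 ?(ltW r0) //.
  by rewrite (le_trans (normcD _ _)) // normcM nlb rw mul1r normc1.
have g4 : normc (alp l N z) <= r ^+ N.+1 * (1 + r).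
  rewrite normcM normcX mulrC ler_wpM2l ?exprn_ge0 ?(ltW r0) //.
  by rewrite (le_trans (normcB _ _)) // nlr addrC.
have N2 : 0 <= N%:R :> R by [].
have g5 : normc (N.+2%:R * l^*%C - N.+1%:R * z) <= N.+2%:R * (1 + r).
  rewrite (le_trans (normcB _ _)) // !normcM !normc_nat nlb -/r -!natr1; nra.
have g6 : normc (N.+2%:R + N.+1%:R * l * w) <= N.+2%:R * (1 + r).
  rewrite (le_trans (normcD _ _)) // !normcM !normc_nat nlr rw -!natr1; nra.
have rN : 0 <= r ^+ N.+1 by rewrite exprn_ge0 // ltW.
(* 4 N + 10 is 2 + 4 (N + 2), from 1 + r <= 2 r in the two products of [hB]. *)
pose B := (4 * N%:R + 10) * (r ^+ N.+1 * r ^+ N.+1 * r).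
have rN1 : r <= r ^+ N.+1 * r ^+ N.+1.
  have h : r <= r ^+ N.+1 by rewrite ler_eXnr.
  by rewrite (le_trans h) // ler_peMr // (le_trans r1).
have hB : r ^+ N.+1 * (r ^+ N.+1 * (1 + r)) + N.+2%:R * (1 + r) * (1 + r) <= B.
  rewrite /B -!natr1; set t := r ^+ N.+1 in rN rN1 *.
  have : t * t * 1 <= t * t * r by rewrite ler_wpM2l ?mulr_ge0.
  have : r * r <= t * t * r by rewrite ler_wpM2r // ltW.
  have : (1 + r) * (1 + r) <= 4 * (r * r) by nra.
  nra.
have hA1 : normc A1 <= B.
  apply: le_trans hB; rewrite E1 (le_trans (normcB _ _)) // lerD //.
    by rewrite (normcM (l * z ^+ N.+1)) (normcM l) nlr mul1r normcX; apply: ler_wpM2l.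
  by rewrite normcM ler_pM ?normc_ge0.
have hA2 : normc A2 <= B.
  apply: le_trans hB; rewrite E2 (le_trans (normcD _ _)) // normcN lerD //.
    by rewrite (normcM (alp l N z)) normcX rw mulrC; apply: ler_wpM2l.
  by rewrite normcM mulrC ler_pM ?normc_ge0.
rewrite E normcM normcV -/r.
have Wp : 0 < normc (W p) by exact: normc_gt0.
have hW : c * (r * r * (r ^+ N.+1 * r ^+ N.+1)) <= normc (W p).
  apply: le_trans (Hc p); rewrite -nz -exprM mulnC exprM.
  rewrite -[X in _ <= X]mulrA; apply: ler_wpM2l; first exact: ltW.
  rewrite [r ^+ N.+1 ^+ 2]expr2 [r ^+ 2]expr2.
  have := mulr_ge0 rN rN; have := mulr_ge0 (ltW r0) (ltW r0); nra.
rewrite ler_pdivrMr // -nz.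
apply: (@le_trans _ _ (2 * (B / normc (W p)))).
  rewrite (le_trans (normcD _ _)) // normcC !normcM normcV.
  have : normc A1 / normc (W p) <= B / normc (W p) by rewrite ler_pM2r ?invr_gt0.
  have : normc A2 / normc (W p) <= B / normc (W p) by rewrite ler_pM2r ?invr_gt0.
  lra.
have -> : 2 * (4 * N%:R + 10) / c / r ^+ 2 * r = 2 * ((4 * N%:R + 10) / (c * r)).
  by field; rewrite !gt_eqF.
rewrite ler_wpM2l // ler_pdivrMr // mulrAC ler_pdivlMr ?mulr_gt0 // /B.
have -> : (4 * N%:R + 10) * (r ^+ N.+1 * r ^+ N.+1 * r) * (c * r) =
  (4 * N%:R + 10) * (c * (r * r * (r ^+ N.+1 * r ^+ N.+1))) by ring.
by rewrite ler_wpM2l // addr_ge0 // mulr_ge0.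
Qed.

Theorem integral_dlogW_zb : (0 < N)%N ->
  (\int[mu \x mu]_p (2 * complex.Re (dlogW_zb p))%:E =
   (4 * N.+2%:R * pi)%:E)%E.
Proof.
move=> N0; have [C HC] := dlogW_asym.
rewrite (flux_plane wirtinger_dlogW continuous_dlogW_z continuous_dlogW_zb HC
  (integrable_dlogW_zb N0)).
by congr EFin; ring.
Qed.

End WIntegral.

(** * Laurent polynomials *)

Section Laurent.
Variable R : realType.
Implicit Types (p q : R * R) (s : seq (R[i] * int)) (z k : R[i]).

(* A Laurent polynomial is the list of its (coefficient, exponent) pairs. *)
Definition laurent s z : R[i] := \sum_(c <- s) c.1 * z ^ c.2.
Definition laurent_scale k s := [seq (k * c.1, c.2) | c <- s].
Definition laurent_deriv s := [seq (c.1 * c.2%:~R, c.2 - 1) | c <- s].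
Definition laurent_prim s := [seq (c.1 / (c.2 + 1)%:~R, c.2 + 1) | c <- s].

Lemma laurent_nil z : laurent [::] z = 0.
Proof. exact: big_nil. Qed.

Lemma laurent_cons c s z : laurent (c :: s) z = c.1 * z ^ c.2 + laurent s z.
Proof. by rewrite /laurent big_cons. Qed.

Lemma laurent_cat s t z : laurent (s ++ t) z = laurent s z + laurent t z.
Proof. by rewrite /laurent big_cat. Qed.

Lemma laurent_scaleE k s z : laurent (laurent_scale k s) z = k * laurent s z.
Proof.
rewrite /laurent big_map mulr_sumr; apply: eq_bigr => c _ /=.
by rewrite mulrA.
Qed.

Lemma laurent_prim_cat s t :
  laurent_prim (s ++ t) = laurent_prim s ++ laurent_prim t.
Proof. exact: map_cat. Qed.

Lemma laurent_prim_scale k s :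
  laurent_prim (laurent_scale k s) = laurent_scale k (laurent_prim s).
Proof. by elim: s => //= c s ->; rewrite mulrA. Qed.

(** A term of exponent -1 would be lost, its primitive dividing by 0. Its absence is the vanishing
    of the residue, which makes the periods of x vanish. *)
Lemma laurent_primK s : all (fun c => c.2 != -1) s ->
  laurent_deriv (laurent_prim s) = s.
Proof.
move=> /allP H; rewrite /laurent_deriv -map_comp -[RHS]map_id.
apply/eq_in_map => -[a n] /H /= n1.
by rewrite addrK divfK // intr_eq0 addr_eq0.
Qed.

Lemma wirtinger_exprz p (n : int) : toC p != 0 ->
  wirtinger (fun q => toC q ^ n) p (n%:~R * toC p ^ (n - 1)) 0.
Proof.
move=> p0; case: n => n.
  apply: wirtinger_eq (wirtingerX n (wirtinger_id p)) _ _; last by rewrite mulr0.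
  case: n => [|n]; first by rewrite !mul0r.
  by rewrite mulr1 -pmulrn intS addrC addKr.
have pn0 : toC p ^+ n.+1 != 0 by rewrite expf_neq0.
apply: wirtinger_eq (wirtingerV pn0 (wirtingerX n.+1 (wirtinger_id p))) _ _;
  last by rewrite mulr0 oppr0 mul0r.
rewrite mulr1 NegzE rmorphN /= -pmulrn !mulNr; congr (- _).
rewrite -opprD -exprnN /= -mulrA addn1; congr (_ * _).
by rewrite !exprS; field; rewrite p0 expf_neq0.
Qed.

Lemma wirtinger_laurent s p : toC p != 0 ->
  wirtinger (fun q => laurent s (toC q)) p (laurent (laurent_deriv s) (toC p)) 0.
Proof.
move=> p0; elim: s => [|c s IH].
  have -> : (fun q : R * R => laurent [::] (toC q)) = fun=> 0.
    by apply/funext => q; exact: laurent_nil.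
  by rewrite laurent_nil; exact: wirtinger_cst.
under [X in wirtinger X]eq_fun do rewrite laurent_cons.
rewrite laurent_cons /=.
apply: wirtinger_eq (wirtingerD (wirtingerZ c.1 (wirtinger_exprz c.2 p0)) IH) _ _.
  by rewrite mulrA.
by rewrite mulr0 addr0.
Qed.

Lemma derivable_exprz (n : int) (z : R[i]^o) : z != 0 ->
  derivable ((fun w => w ^ n) : R[i]^o -> R[i]^o) z 1.
Proof.
move=> z0; case: n => n.
  by apply: exprn_derivable.
apply: (@derivableV _ _ (fun w : R[i]^o => (w ^+ n.+1 : R[i]^o))).
  by rewrite expf_neq0.
exact: exprn_derivable.
Qed.

Lemma near_neq0 (z : R[i]^o) : z != 0 -> \forall w \near z, w != 0.
Proof.
move=> z0.
have nz : 0 < `|z| by rewrite normr_gt0.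
apply/nbhs_ballP; exists `|z| => //= w; rewrite -ball_normE /= => h.
by apply: contraTneq h => ->; rewrite subr0 ltxx.
Qed.

Lemma derivable_laurent s (z : R[i]^o) : z != 0 ->
  derivable (laurent s : R[i]^o -> R[i]^o) z 1.
Proof.
move=> z0; elim: s => [|c s IH].
  have -> : laurent [::] = cst 0 by apply/funext => w; exact: laurent_nil.
  exact: derivable_cst.
have -> : laurent (c :: s) = (fun w => c.1 * w ^ c.2 + laurent s w) :> (R[i]^o -> R[i]^o).
  by apply/funext => w; exact: laurent_cons.
exact: (derivableD (derivableZ (k := c.1) (derivable_exprz (n := c.2) z0)) IH).
Qed.

Lemma holomorphic_laurent s z : z != 0 -> holomorphic_at (laurent s) z.
Proof.
move=> z0; rewrite /holomorphic_at; near=> w; apply: derivable_laurent.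
near: w; exact: near_neq0.
Unshelve. all: by end_near. Qed.

End Laurent.

Section RowDiff.
Variable R : realType.

Lemma is_diff_row (V : normedModType R) n (f df : 'I_n -> V -> R) (p : V) :
  (forall j, is_diff p (f j) (df j)) ->
  is_diff p (fun q => \row_j f j q) (fun v => \row_j df j v).
Proof.
move=> H.
have dE : differentiable (fun q => \row_j f j q) p.
  have -> : (fun q => \row_j f j q) =
      \sum_j (fun q => f j q *: delta_mx (0 : 'I_1) j).
    apply/funext => q; apply/rowP => k; rewrite fct_sumE !mxE summxE.
    rewrite (bigD1 k) //= !mxE !eqxx mulr1 big1 ?addr0 // => j jk.
    by rewrite !mxE eq_sym (negbTE jk) andbF mulr0.
  by apply: differentiable_sum => j; apply: differentiableZl; case: (H j).
split => //; apply/funext => v; rewrite -deriveE // derive_mx; last exact: diff_derivable.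
apply/rowP => j; rewrite !mxE.
have -> : (fun q => (\row_j f j q : 'rV[R]_n) 0 j) = f j by apply/funext => q; rewrite mxE.
by have [d1 d2] := H j; rewrite deriveE // d2.
Qed.

End RowDiff.

Section Conj.
Variable R : realType.
Implicit Types a b : R[i].

Lemma conjcD a b : (a + b)^*%C = a^*%C + b^*%C. Proof. exact: rmorphD. Qed.
Lemma conjcB a b : (a - b)^*%C = a^*%C - b^*%C. Proof. exact: rmorphB. Qed.
Lemma conjcN a : (- a)^*%C = - a^*%C. Proof. exact: rmorphN. Qed.
Lemma conjcM a b : (a * b)^*%C = a^*%C * b^*%C. Proof. exact: rmorphM. Qed.
Lemma conjcX a n : (a ^+ n)^*%C = a^*%C ^+ n. Proof. exact: rmorphXn. Qed.
Lemma conjcV a : (a^-1)^*%C = a^*%C^-1. Proof. exact: fmorphV. Qed.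
Lemma conjci : ('i%C : R[i])^*%C = - 'i%C.
Proof. by apply: ReIm_eq; rewrite /= ?oppr0. Qed.

Definition conjcE :=
  (conjcB, conjcD, conjcN, conjcM, conjcX, conjcV, conjc1, conjcK, conjci, conjc_nat).

End Conj.

(** * The Weierstrass forms and the conformal factor *)

Section LorentzForm.
Variable R : realType.
Import Normc.

Definition null_form (A B C D : R[i]) (j : 'I_4) : R[i] :=
  nth 0 [:: A + B; - 'i%C * (A - B); D - C; D + C] j.

(** The first term is the complex bilinear part. It vanishes for Weierstrass data, where A B and C D
    are both phi psi dh^2; the remaining Hermitian part makes the induced metric conformal. *)
Lemma lorentz_null_form (A B C D k k' : R[i]) :
  lorentz (\row_j (2 * complex.Re (k * null_form A B C D j)))
          (\row_j (2 * complex.Re (k' * null_form A B C D j))) =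
  8 * complex.Re (k * k' * (A * B - C * D)) +
  4 * complex.Re (k * k'^*%C) *
    complex.Re (A * A^*%C + B * B^*%C - 2 * (C * D^*%C)).
Proof.
rewrite /lorentz !big_ord_recl big_ord0 !mxE /null_form /=.
by rewrite !cReImE /=; ring.
Qed.

End LorentzForm.

Section Forms.
Variables (R : realType) (m : nat) (l : R[i]).
Hypothesis hm : (1 <= m)%N.
Hypothesis hl : l * l^*%C = 1.
Implicit Types (p q : R * R) (z : R[i]).
Local Notation lb := (l^*%C).
Local Notation n := ((2 * m)%N%:Z).

(* phi dh, psi dh, phi psi dh and dh as Laurent polynomials *)
Definition formA := [:: (- ('i%C * l), n - 2); ('i%C * (1 - l ^+ 2), n - 1); ('i%C * l, n)].
Definition formB :=
  [:: (- ('i%C * lb), - n - 2); ('i%C * (1 - lb ^+ 2), - n - 1); ('i%C * lb, - n)].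
Definition formC := [:: (- ('i%C * l), - 2 : int); ('i%C * lb, 0)].
Definition formD := [:: (- ('i%C * lb), - 2 : int); ('i%C * l, 0)].

Definition formPhi (j : 'I_4) := nth [::]
  [:: formA ++ formB;
      laurent_scale (- 'i%C) (formA ++ laurent_scale (-1) formB);
      formD ++ laurent_scale (-1) formC; formD ++ formC] j.

Lemma laurent_formPhi j z : laurent (formPhi j) z =
  null_form (laurent formA z) (laurent formB z) (laurent formC z) (laurent formD z) j.
Proof.
rewrite /formPhi /null_form.
case: j => -[|[|[|[|//]]]] hj.
- exact: laurent_cat.
- rewrite -[LHS]/(laurent (laurent_scale (- 'i%C) (formA ++ laurent_scale (-1) formB)) z).
  by rewrite laurent_scaleE laurent_cat laurent_scaleE mulN1r.
- rewrite -[LHS]/(laurent (formD ++ laurent_scale (-1) formC) z).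
  by rewrite laurent_cat laurent_scaleE mulN1r.
- exact: laurent_cat.
Qed.

Lemma formAE z : z != 0 ->
  laurent formA z = 'i%C * (z - l) * (1 + l * z) * z ^+ (2 * m) / z ^+ 2.
Proof.
move=> z0; rewrite !laurent_cons laurent_nil /= !expfzDr //.
rewrite -[z ^ n]/(z ^+ (2 * m)) -[z ^ (-2)]/((z ^+ 2)^-1) -[z ^ (-1)]/((z ^+ 1)^-1).
by field.
Qed.

Lemma formBE z : z != 0 ->
  laurent formB z = 'i%C * (z - lb) * (1 + lb * z) / (z ^+ (2 * m) * z ^+ 2).
Proof.
move=> z0; rewrite !laurent_cons laurent_nil /= !expfzDr //.
have -> : z ^ (- n) = (z ^+ (2 * m))^-1 by rewrite exprnN.
rewrite -[z ^ (-2)]/((z ^+ 2)^-1) -[z ^ (-1)]/((z ^+ 1)^-1).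
by field; rewrite z0 expf_neq0.
Qed.

(** The term in 1 / z has coefficient i (1 - l conj l), so |l| = 1 is what makes phi psi dh free of
    residue; the same happens for dh below. *)
Lemma formCE z : z != 0 ->
  laurent formC z = 'i%C * (z - l) * (1 + lb * z) / z ^+ 2.
Proof.
move=> z0; rewrite !laurent_cons laurent_nil /=.
rewrite -[z ^ (-2)]/((z ^+ 2)^-1) expr0z.
by field: hl.
Qed.

Lemma formDE z : z != 0 ->
  laurent formD z = 'i%C * (z - lb) * (1 + l * z) / z ^+ 2.
Proof.
move=> z0; rewrite !laurent_cons laurent_nil /=.
rewrite -[z ^ (-2)]/((z ^+ 2)^-1) expr0z.
by field: hl.
Qed.

Lemma form_weierstrass j z : z != 0 -> z \notin ex_poles l ->
  laurent (formPhi j) z =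
  weierstrass_form (ex_phi m l) (ex_psi m l) (ex_h l) j z.
Proof.
move=> z0; rewrite !inE negb_or => /andP[z1 z2].
have h1 : z - lb != 0 by rewrite subr_eq0.
have h2 : 1 + l * z != 0.
  apply: contra z2 => /eqP E; apply/eqP.
  have : lb * (1 + l * z) = 0 by rewrite E mulr0.
  by rewrite mulrDr mulr1 mulrA [lb * l]mulrC hl mul1r => /eqP; rewrite addrC addr_eq0 => /eqP.
have h3 : z ^+ (2 * m) != 0 by rewrite expf_neq0.
rewrite laurent_formPhi /null_form /weierstrass_form formAE // formBE // formCE // formDE //.
rewrite /ex_phi /ex_psi /ex_h.
by case: j => -[|[|[|[|//]]]] hj /=; field; rewrite ?z0 ?h1 ?h2 ?h3.
Qed.

(** The exponents are at least 2 m - 2 >= 0 in A, at most - 2 m <= - 2 in B, and - 2 or 0 in C and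
    D; none is - 1. *)
Lemma laurent_primPhi j : laurent_deriv (laurent_prim (formPhi j)) = formPhi j.
Proof.
apply: laurent_primK.
have m2 : (2 <= 2 * m)%N by rewrite -[X in (X <= _)%N]muln1 leq_mul2l.
case: j => -[|[|[|[|//]]]] hj; rewrite /formPhi /= ?all_cat /=; lia.
Qed.

(* The conformal factor of the metric induced by x, see [lorentz_formPhi]. *)
Definition Ec p : R[i] := 4 * (W l (2 * m).-1 p * (W l (2 * m).-1 p)^*%C) /
  (toC p * (toC p)^*%C) ^+ (2 * m).+2.

(** The left side is |phi - conj psi|^2 |dh/dz|^2. The zeros of dh cancel the denominators [bet] and
    1 + conj l conj z of phi - conj psi, so only powers of |z| remain below |W|^2. *)
Lemma conformal_identity p (z := toC p) : z != 0 ->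
  laurent formA z * (laurent formA z)^*%C + laurent formB z * (laurent formB z)^*%C
  - laurent formC z * (laurent formD z)^*%C - (laurent formC z)^*%C * laurent formD z =
  W l (2 * m).-1 p * (W l (2 * m).-1 p)^*%C / (z * z^*%C) ^+ (2 * m).+2.
Proof.
rewrite {}/z => z0.
have zb0 : (toC p)^*%C != 0 by rewrite conjc_eq0.
have h3 : toC p ^+ (2 * m) != 0 by rewrite expf_neq0.
have h4 : (toC p)^*%C ^+ (2 * m) != 0 by rewrite expf_neq0.
have m2 : (2 * m).-1.+1 = (2 * m)%N by rewrite prednK // muln_gt0.
rewrite formAE // formBE // formCE // formDE // /W /alp /del m2 /bet /gam !conjcE.
rewrite !exprSr exprMn.
have i2 : 'i%C * 'i%C = -1 :> R[i] by rewrite -expr2 sqr_i.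
by field: i2; rewrite z0 zb0 h3 h4.
Qed.

Lemma lorentz_formPhi p k k' : toC p != 0 ->
  lorentz (\row_j (2 * complex.Re (k * laurent (formPhi j) (toC p))))
          (\row_j (2 * complex.Re (k' * laurent (formPhi j) (toC p)))) =
  complex.Re (k * k'^*%C) * complex.Re (Ec p).
Proof.
move=> p0.
have RE k0 : \row_j (2 * complex.Re (k0 * laurent (formPhi j) (toC p))) =
  \row_j (2 * complex.Re (k0 * null_form (laurent formA (toC p))
    (laurent formB (toC p)) (laurent formC (toC p)) (laurent formD (toC p)) j)).
  by apply/rowP => j; rewrite !mxE laurent_formPhi.
rewrite !RE lorentz_null_form.
have -> : laurent formA (toC p) * laurent formB (toC p) -
    laurent formC (toC p) * laurent formD (toC p) = 0.
  have h3 : toC p ^+ (2 * m) != 0 by rewrite expf_neq0.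
  by rewrite formAE // formBE // formCE // formDE //; field; rewrite p0 h3.
rewrite !mulr0 add0r.
have E := conformal_identity p0.
have -> : Ec p = 4 * (laurent formA (toC p) * (laurent formA (toC p))^*%C +
  laurent formB (toC p) * (laurent formB (toC p))^*%C -
  laurent formC (toC p) * (laurent formD (toC p))^*%C -
  (laurent formC (toC p))^*%C * laurent formD (toC p)).
  by rewrite E /Ec !mulrA.
rewrite [in RHS]mulrC -!mulrA.
move: (laurent formA _) (laurent formB _) (laurent formC _) (laurent formD _) => A B C D.
by rewrite !cReImE /=; ring.
Qed.

End Forms.

(** * The surface *)

Section Surface.
Variables (R : realType) (m : nat) (l : R[i]).
Hypothesis hm : (1 <= m)%N.
Hypothesis hl : l * l^*%C = 1.
Hypothesis hb : complex.Im l != 0.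
Implicit Types (p q v : R * R) (z : R[i]).
Import Normc.
Local Notation N := (2 * m).-1.
Local Notation Ec := (Ec m l).

Let m2 : (2 * m).-1.+1 = (2 * m)%N.
Proof. by rewrite prednK // muln_gt0. Qed.

Lemma toC_eq0 p : (toC p == 0) = (p == 0).
Proof. by case: p => x y; rewrite eq_complex /= -pair_eqE. Qed.

Lemma nq_gt0 p : p != 0 -> 0 < nq p.
Proof.
rewrite -toC_eq0 => p0; have := normc_gt0 p0.
by rewrite /nq -(sqr_normc (toC p)) => h; rewrite exprn_gt0.
Qed.

Lemma EcE p : Ec p = (4 * normc (W l N p) ^+ 2 / nq p ^+ (2 * m).+2)%:C.
Proof.
rewrite /Ec zzbE mul_conjc.
have -> : (nq p)%:C ^+ (2 * m).+2 = (nq p ^+ (2 * m).+2)%:C :> R[i].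
  by rewrite -[RHS]/(real_complex R _) rmorphXn.
have -> : (4 : R[i]) = 4%:C by rewrite -[RHS]/(real_complex R _) rmorph_nat.
by rewrite -fmorphV -!rmorphM.
Qed.

Lemma Ec_real p : complex.Im (Ec p) = 0.
Proof. by rewrite EcE. Qed.

Lemma Ec_gt0 p : p != 0 -> 0 < complex.Re (Ec p).
Proof.
move=> p0; rewrite EcE /= divr_gt0 ?exprn_gt0 ?nq_gt0 // mulr_gt0 //.
by rewrite exprn_gt0 // normc_gt0 // W_neq0.
Qed.

Lemma Ec_lower : exists2 c, 0 < c & forall p, p != 0 ->
  c ^+ 2 * (1 + (nq p)^-1) ^+ 2 <= complex.Re (Ec p).
Proof.
have [c c0 H] := W_lower N hl hb.
(* A factor 4 of (4 c)^2 is the one in [Ec]; the other comes from (rho^2m + 1)^2 >= 4 rho^2m. *)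
exists (4 * c); first by rewrite mulr_gt0.
move=> p p0; rewrite EcE /=; have r0 := nq_gt0 p0.
have := H p; rewrite m2; set rho := nq p in r0 *; set w := normc _ => h.
have rm : 0 < rho ^+ (2 * m) by rewrite exprn_gt0.
rewrite ler_pdivlMr ?exprn_gt0 //.
have -> : (4 * c) ^+ 2 * (1 + rho^-1) ^+ 2 * rho ^+ (2 * m).+2 =
    4 * ((c * (rho + 1)) ^+ 2 * (4 * rho ^+ (2 * m))).
  by rewrite !exprS; field; rewrite gt_eqF.
rewrite ler_wpM2l //.
have h2 : (c * (rho + 1) * (rho ^+ (2 * m) + 1)) ^+ 2 <= w ^+ 2.
  rewrite lerXn2r // nnegrE ?normc_ge0 // !mulr_ge0 ?(ltW c0) //; lra.
apply: le_trans h2; rewrite [X in _ <= X]exprMn ler_wpM2l ?sqr_ge0 //.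
have := sqr_ge0 (rho ^+ (2 * m) - 1); lra.
Qed.

Definition dlogE p : R[i] := dlogW l N p - (2 * m).+2%:R / toC p.

Lemma wirtinger_Ec p : p != 0 ->
  wirtinger Ec p (Ec p * dlogE p) (Ec p * (dlogE p)^*%C).
Proof.
rewrite -toC_eq0 => p0.
have zb0 : (toC p)^*%C != 0 by rewrite conjc_eq0.
have W0 := W_neq0 N hl hb p.
have Wb0 : (W l N p)^*%C != 0 by rewrite conjc_eq0.
have zz0 : toC p * (toC p)^*%C != 0 by rewrite mulf_neq0.
have HW := wirtingerZ 4 (wirtingerM (wirtinger_W l N p) (wirtingerC (wirtinger_W l N p))).
have Hz := wirtingerV (expf_neq0 (2 * m).+2 zz0) (wirtingerX (2 * m).+2
  (wirtingerM (wirtinger_id p) (wirtingerC (wirtinger_id p)))).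
have e0 : (toC p * (toC p)^*%C) ^+ (2 * m).+1 != 0 by rewrite expf_neq0.
(* The quotient rule for 4 w wb / (z zb)^(2m+2), with e = (z zb)^(2m+1) and k = 2m + 2; exchanging
   plain and barred variables gives the other derivative. *)
have F (w wb wz wzb z zb e k : R[i]) : w != 0 -> wb != 0 -> z != 0 -> zb != 0 -> e != 0 ->
    4 * (wz * wb + w * wzb) * (z * zb * e)^-1 +
    4 * (w * wb) * (- (k * e * zb) / (z * zb * e) ^+ 2) =
    4 * (w * wb) / (z * zb * e) * (wz / w + wzb / wb - k / z).
  by move=> ? ? ? ? ?; field; apply/and5P; split.
have E1 : Ec p * dlogE p = 4 * (W l N p * (W l N p)^*%C) /
    (toC p * (toC p)^*%C * (toC p * (toC p)^*%C) ^+ (2 * m).+1) *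
    (Wz l N p / W l N p + (Wzb l N p)^*%C / (W l N p)^*%C - (2 * m).+2%:R / toC p).
  by rewrite /Ec /dlogE /dlogW (exprS _ (2 * m).+1) conjcM conjcV.
have F2 (w wz wzb z : R[i]) (k : nat) : (wz / w + (wzb / w)^*%C - k%:R / z)^*%C =
    wz^*%C / w^*%C + wzb / w - k%:R / z^*%C.
  by rewrite conjcB conjcD conjcK !conjcM !conjcV conjc_nat.
have E2 : Ec p * (dlogE p)^*%C = 4 * ((W l N p)^*%C * W l N p) /
    ((toC p)^*%C * toC p * (toC p * (toC p)^*%C) ^+ (2 * m).+1) *
    ((Wz l N p)^*%C / (W l N p)^*%C + Wzb l N p / W l N p - (2 * m).+2%:R / (toC p)^*%C).
  rewrite /Ec /dlogE /dlogW (exprS _ (2 * m).+1).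
  by rewrite F2 [(W l N p)^*%C * _]mulrC [(toC p)^*%C * toC p]mulrC.
rewrite E1 E2.
apply: wirtinger_eq (wirtingerM HW Hz) _ _.
  by rewrite succnK (exprS _ (2 * m).+1) conjc0 mul1r mulr0 addr0; exact: F.
rewrite succnK (exprS _ (2 * m).+1) conjc1 mul0r mulr1 add0r -F //.
rewrite [(W l N p)^*%C * W l N p]mulrC [(toC p)^*%C * toC p]mulrC.
by rewrite [X in _ = 4 * X / _ + _]addrC [(W l N p)^*%C * _]mulrC [(Wz l N p)^*%C * _]mulrC.
Qed.

(** The power of |z| in the metric contributes only the term (2m + 2) / z, which is holomorphic off
    0; so the curvature density involves W alone. *)
Lemma wirtinger_dlogE p : p != 0 -> exists c,
  wirtinger dlogE p c (dlogW_zb l N p).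
Proof.
rewrite -toC_eq0 => p0.
have H := wirtingerB (wirtinger_dlogW N hl hb p)
  (wirtingerZ (2 * m).+2%:R (wirtingerV p0 (wirtinger_id p))).
eexists; apply: wirtinger_eq H _ _; first by [].
by rewrite oppr0 mul0r mulr0 subr0.
Qed.

Lemma open_punctured : open (punctured_plane R).
Proof.
rewrite (_ : punctured_plane R = ~` [set 0]).
  by apply: closed_openC; exact/accessible_closed_set1/hausdorff_accessible/norm_hausdorff.
by apply/seteqP; split => p /= /eqP.
Qed.

Section Immersion.
Variables (x : R * R -> 'rV[R]_4) (x0 : 'rV[R]_4).

(** The factor k is there for derivatives: differentiating along v multiplies it by [toC v] and
    differentiates S, so all iterated partial derivatives stay in this family. *)
Definition row_Re (k : R[i]) (S : 'I_4 -> seq (R[i] * int)) p : 'rV[R]_4 :=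
  \row_j (2 * complex.Re (k * laurent (S j) (toC p))).

Lemma is_diff_row_Re (y : 'rV[R]_4) k S p : p != 0 ->
  is_diff p (fun q => y + row_Re k S q)
    (fun v => row_Re (k * toC v) (fun j => laurent_deriv (S j)) p).
Proof.
rewrite -toC_eq0 => p0.
have H j : is_diff p (fun q => 2 * complex.Re (k * laurent (S j) (toC q)) : R)
  (fun v => 2 * complex.Re (k * toC v * laurent (laurent_deriv (S j)) (toC p)) : R).
  have [H1 _] := wirtingerZ k (wirtinger_laurent (S j) p0).
  have [d1 d2] := is_diffZ 2 H1.
  split; first exact: d1.
  rewrite [LHS]d2; apply/funext => v; rewrite /GRing.scale /=.
  by rewrite mulr0 mul0r addr0 [RHS](congr1 _ (congr1 _ (mulrAC _ _ _))).
have := is_diffD (is_diff_cst y p) (is_diff_row H).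
move=> {}H; apply: is_diff_eq H _; apply/funext => v.
by rewrite fctE add0r.
Qed.

Hypothesis xE : forall p, p != 0 ->
  x p = x0 + row_Re 1 (fun j => laurent_prim (formPhi m l j)) p.

Definition dirC (i : 'I_2) : R[i] := if i == 0 then 1 else 'i%C.

Lemma toC_coord_dir i : toC (coord_dir R i) = dirC i.
Proof. by case: i => -[|[|//]] hi; apply: ReIm_eq. Qed.

Lemma pderiv_row_Re (f : R * R -> 'rV[R]_4) y k S p i : p != 0 ->
  (forall q, q != 0 -> f q = y + row_Re k S q) ->
  differentiable f p /\ pderiv i f p =
    row_Re (k * dirC i) (fun j => laurent_deriv (S j)) p.
Proof.
move=> p0 fE.
have H : \forall q \near p, y + row_Re k S q = f q.
  near=> q; rewrite fE //; near: q.
  by apply: open_nbhs_nbhs; split; [exact: open_punctured|].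
have [d1 d2] := near_eq_is_diff H (is_diff_row_Re y k S p0).
by split => //; rewrite /pderiv deriveE // d2 toC_coord_dir.
Unshelve. all: by end_near. Qed.

Lemma smooth_x : smooth_on (punctured_plane R) x.
Proof.
move=> s; suff : exists y k S, forall p, p != 0 ->
    foldr (@pderiv R 'rV[R]_4) x s p = y + row_Re k S p.
  move=> [y [k [S H]]] p p0.
  by have [] := pderiv_row_Re 0 p0 H.
elim: s => [|i s [y [k [S H]]]] /=; first by exists x0, 1, (fun j => laurent_prim (formPhi m l j)).
exists 0, (k * dirC i), (fun j => laurent_deriv (S j)) => p p0.
by have [_ ->] := pderiv_row_Re i p0 H; rewrite add0r.
Qed.

Lemma diff_x p v : p != 0 -> 'd x p v = row_Re (toC v) (formPhi m l) p.
Proof.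
move=> p0.
have H : \forall q \near p, x0 + row_Re 1 (fun j => laurent_prim (formPhi m l j)) q = x q.
  near=> q; rewrite xE //; near: q.
  by apply: open_nbhs_nbhs; split; [exact: open_punctured|].
have [d1 ->] := near_eq_is_diff H (is_diff_row_Re x0 1 _ p0).
by rewrite mul1r; apply/rowP => j; rewrite !mxE laurent_primPhi.
Unshelve. all: by end_near. Qed.

Lemma pderiv_x p i : p != 0 -> pderiv i x p = row_Re (dirC i) (formPhi m l) p.
Proof.
move=> p0; rewrite /pderiv deriveE ?diff_x ?toC_coord_dir //.
exact: (@smooth_x [::] p).
Qed.

Lemma pderiv2_x p i j : p != 0 -> pderiv i (pderiv j x) p =
  row_Re (dirC j * dirC i) (fun k => laurent_deriv (formPhi m l k)) p.
Proof.
move=> p0.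
have H q : q != 0 -> pderiv j x q = 0 + row_Re (dirC j) (formPhi m l) q.
  by move=> q0; rewrite add0r pderiv_x.
by have [] := pderiv_row_Re i p0 H.
Qed.

Lemma metric_x p : p != 0 -> induced_metric x p = (complex.Re (Ec p))%:M.
Proof.
move=> p0; apply/matrixP => i j; rewrite !mxE !pderiv_x // lorentz_formPhi ?toC_eq0 //.
move: (complex.Re (Ec p)) => e.
case: i => -[|[|//]] hi; case: j => -[|[|//]] hj; rewrite /dirC /=;
  rewrite ?(mulr1n, mulr0n); ring.
Qed.

Lemma spacelike_x : spacelike_on (punctured_plane R) x.
Proof.
move=> p p0 v v0; rewrite !diff_x // lorentz_formPhi ?toC_eq0 //.
by rewrite mulr_gt0 ?Ec_gt0 // zzbE /= nq_gt0.
Qed.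

Lemma lorentz0 (u : 'rV[R]_4) : lorentz u 0 = 0.
Proof. by rewrite /lorentz big1 // => j _; rewrite mxE mulr0. Qed.

Lemma lorentzN (u w : 'rV[R]_4) : lorentz (- u) w = - lorentz u w.
Proof.
by rewrite /lorentz -sumrN; apply: eq_bigr => j _; rewrite mxE mulrN mulNr.
Qed.

Lemma normal_partN (y : R * R -> 'rV[R]_4) p (w : 'rV[R]_4) :
  normal_part y p (- w) = - normal_part y p w.
Proof.
rewrite /normal_part opprD; congr (_ + - _); rewrite -sumrN.
apply: eq_bigr => i _; rewrite -sumrN; apply: eq_bigr => j _.
by rewrite lorentzN mulrN scaleNr.
Qed.

(** In isothermal coordinates the mean curvature vector is the normal part of the Laplacian divided
    by 2 e, and here the coordinates are harmonic. *)
Lemma mean_curvature_conformal (y : R * R -> 'rV[R]_4) p (e : R) :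
  induced_metric y p = e%:M ->
  pderiv 1 (pderiv 1 y) p = - pderiv 0 (pderiv 0 y) p ->
  mean_curvature_vector y p = 0.
Proof.
move=> gE Hy; have EM (a : R) (i j : 'I_2) :
  (a%:M : 'M[R]_2) i j = a *+ (i == j) by rewrite mxE.
have : second_fundamental_form y p 1 1 = - second_fundamental_form y p 0 0.
  by rewrite /second_fundamental_form Hy normal_partN.
rewrite /mean_curvature_vector gE invmx_scalar.
move: (second_fundamental_form y p) => II H.
rewrite !sum_ord2 !EM [0 == 0]/= [1 == 1]/= !(mulr1n, mulr0n) !scale0r addr0 add0r.
by rewrite -scalerDr H subrr !scaler0.
Qed.

Lemma stationary_x : stationary_on (punctured_plane R) x.
Proof.
split; last 1 first.
- move=> p p0; apply: (mean_curvature_conformal (metric_x p0)).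
  (* Two derivatives in the second direction bring the factor i^2 = - 1, so x is harmonic. *)
  rewrite !pderiv2_x //; apply/rowP => j; rewrite !mxE /dirC /=.
  by rewrite -mulrN -cReN -mulNr -expr2 sqr_i mulr1.
- split; first exact: smooth_x.
  (* Injectivity follows from spacelikeness: a nonzero kernel vector would have Lorentz square 0. *)
  move=> p p0 v w E; apply/eqP; rewrite -subr_eq0; apply/negPn/negP => vw.
  by have := spacelike_x p0 vw; rewrite raddfB /= E subrr lorentz0 ltxx.
- exact: spacelike_x.
Qed.

Lemma curvature_density_x p : p != 0 -> curvature_density (induced_metric x) p =
  - (2 * complex.Re (dlogW_zb l N p)).
Proof.
move=> p0; have [c Hc] := wirtinger_dlogE p0.
apply: (curvature_density_conformal open_punctured metric_x Ec_gt0
  (fun q _ => Ec_real q) wirtinger_Ec p0 Hc).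
Qed.

End Immersion.
End Surface.

(** * Total curvature *)

Section TotalCurvature.
Variables (R : realType) (m : nat) (l : R[i]).
Hypothesis hm : (1 <= m)%N.
Hypothesis hl : l * l^*%C = 1.
Hypothesis hb : complex.Im l != 0.
Variables (x : R * R -> 'rV[R]_4) (x0 : 'rV[R]_4).
Hypothesis xE : forall p, p != 0 ->
  x p = x0 + row_Re 1 (fun j => laurent_prim (formPhi m l j)) p.
Local Notation N := (2 * m).-1.
Local Notation mu := (@lebesgue_measure R).
Local Notation RR := (measurableTypeR R * measurableTypeR R)%type.

Let N0 : (0 < N)%N.
Proof. by case: m hm => // k _; rewrite mulnS. Qed.

Lemma puncturedE : punctured_plane R = setT `\` [set 0].
Proof. by apply/seteqP; split => [p /= /eqP|p /= [_ /eqP]]. Qed.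

Lemma set0_setX : [set (0 : R * R)] = [set 0] `*` [set 0].
Proof.
apply/seteqP; split=> [p -> //|[a b] /= [/= -> ->]//].
Qed.

Lemma measurable_origin : measurable ([set 0] : set RR).
Proof. by rewrite set0_setX; apply: measurableX; exact: measurable_set1. Qed.

Lemma measure_origin : (mu \x mu)%E ([set 0] : set RR) = 0%E.
Proof.
rewrite set0_setX product_measure1E; try exact: measurable_set1.
by rewrite [X in (_ * X)%E](lebesgue_measure_set1 (0 : R)) mule0.
Qed.

Lemma measurable_punctured : measurable (punctured_plane R : set RR).
Proof. by apply: open_measurable_prod; exact: open_punctured. Qed.

Let curvE p : p \in (punctured_plane R : set RR) ->
  (- (2 * complex.Re (dlogW_zb l N p)))%:E =
  (curvature_density (induced_metric x) p)%:E.
Proof. by move=> /set_mem p0; rewrite (curvature_density_x hm hl hb xE). Qed.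

Lemma integrable_curvature : (mu \x mu)%E.-integrable (punctured_plane R)
  (EFin \o curvature_density (induced_metric x)).
Proof.
apply: (eq_integrable measurable_punctured); first exact: curvE.
apply: (integrableS measurableT) => //; first exact: measurable_punctured.
by have := integrableN (integrable_dlogW_zb hl hb N0).
Qed.

Lemma total_curvature_x :
  (- total_curvature (induced_metric x))%E = (2 * (2 * m%:R + 1) * pi)%:E.
Proof.
have IT := integrable_dlogW_zb hl hb N0.
rewrite /total_curvature
  (eq_integral (fun p : RR => - (2 * complex.Re (dlogW_zb l N p))%:E)%E); last first.
  by move=> p /curvE <-.
rewrite integralN; last first.
  apply: (integrable_add_def measurable_punctured).
  exact: (integrableS measurableT measurable_punctured (@subsetT _ _) IT).
(* The origin is a null set, and the integrand written with W makes sense on the whole plane. *)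
rewrite puncturedE -(negligible_integral measurable_origin measurableT IT measure_origin).
rewrite (integral_dlogW_zb hl hb N0) muleN oppeK -EFinM; congr EFin.
have -> : N.+2 = (2 * m + 1)%N by rewrite prednK ?addn1 // muln_gt0.
by rewrite natrD natrM; field.
Qed.

End TotalCurvature.

(** * Line integrals along curves *)

Section Curves.
Variable R : realType.
Implicit Types (p q v : R * R) (c : R -> R * R).
Local Notation mu := (@lebesgue_measure R).

Definition segment p q (t : R) : R * R := p + t *: (q - p).

Lemma is_derive_segment p q (t : R) : is_derive t (1 : R) (segment p q) (q - p).
Proof.
have H : is_diff t (fun s : R => s *: (q - p)) (fun s : R => s *: (q - p)).
  exact: is_diff_scalel.
have [H1 H2] := is_diffD (is_diff_cst p t) H.
split; first exact: diff_derivable.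
by rewrite deriveE // H2 fctE add0r scale1r.
Qed.

Lemma C1_segment p q : C1_curve (segment p q).
Proof.
split; first by move=> t; case: (is_derive_segment p q t).
have -> : derive1 (segment p q) = cst (q - p).
  by apply/funext => t; rewrite derive1E; case: (is_derive_segment p q t).
by move=> t; exact: cvg_cst.
Qed.

Lemma derive1_segment p q t : derive1 (segment p q) t = q - p.
Proof. by rewrite derive1E; case: (is_derive_segment p q t). Qed.

Lemma segment0 p q : segment p q 0 = p.
Proof. by rewrite /segment scale0r addr0. Qed.

Lemma segment1 p q : segment p q 1 = q.
Proof. by rewrite /segment scale1r addrC subrK. Qed.

Lemma C1_curve_continuous c t : C1_curve c -> {for t, continuous c}.
Proof.
by move=> [dc _]; apply: differentiable_continuous; apply/derivable1_diffP.
Qed.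

Lemma continuous_ReM (f : R * R -> R[i]) c t :
  {for c t, continuous (fun q => complex.Re (f q) : R)} ->
  {for c t, continuous (fun q => complex.Im (f q) : R)} ->
  C1_curve c ->
  {for t, continuous (fun s => complex.Re (f (c s) * toC (derive1 c s)) : R)}.
Proof.
move=> f1 f2 c1; under [X in {for t, continuous X}]eq_fun do rewrite cReM /=.
have cc := C1_curve_continuous (t := t) c1; have cc' := c1.2 t.
apply: cvgB; apply: cvgM.
- exact: (continuous_comp cc f1).
- by apply: (cvg_comp _ _ cc'); exact: cvg_fst.
- exact: (continuous_comp cc f2).
- by apply: (cvg_comp _ _ cc'); exact: cvg_snd.
Qed.

(** Here dF = Re (h dz). The curve avoids the origin only over [0, 1], hence continuity within that
    interval; it is part of the conclusion because length estimates need the integrand to be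
    measurable. *)
Lemma FTC_curve (F : R * R -> R) (h : R * R -> R[i]) c :
  curve_in (punctured_plane R) c ->
  (forall p, p != 0 -> is_diff p F (fun v => complex.Re (h p * toC v) : R)) ->
  (forall p, p != 0 -> {for p, continuous (fun q => complex.Re (h q) : R)} /\
    {for p, continuous (fun q => complex.Im (h q) : R)}) ->
  {within `[0, 1], continuous (fun t => complex.Re (h (c t) * toC (derive1 c t)) : R)} /\
  (\int[mu]_(t in `[0%R, 1%R]) (complex.Re (h (c t) * toC (derive1 c t)))%:E =
  (F (c 1) - F (c 0))%:E)%E.
Proof.
move=> [c1 cU] Fh hc.
have U (t : R) : t \in `[0, 1] -> c t != 0 by rewrite in_itv /= => /cU.
have dF (t : R) : t \in `[0, 1] -> is_derive t (1 : R) (F \o c)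
    (complex.Re (h (c t) * toC (derive1 c t))).
  move=> /U ct0; have /derivable1_diffP dc := c1.1 t.
  have dc' : is_diff t c ('d c t) by split.
  have [H1 H2] := is_diff_comp dc' (Fh _ ct0).
  split; first exact: diff_derivable.
  by rewrite deriveE // H2 /= derive1E deriveE.
have Fc (t : R) : t \in `[0, 1] -> {for t, continuous (F \o c)}.
  by move=> /dF[d _]; apply: differentiable_continuous; apply/derivable1_diffP.
have cD : {within `[0, 1], continuous (fun t => complex.Re (h (c t) * toC (derive1 c t)) : R)}.
  apply: continuous_in_subspaceT => t /set_mem /U ct0.
  by have [h1 h2] := hc _ ct0; exact: continuous_ReM.
split => //; rewrite (@continuous_FTC2 _ _ (F \o c)) //.
- split.
  + by move=> t t01; case: (dF t) => //; exact: subset_itv_oo_cc t01.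
  + by apply: cvg_at_right_filter; apply: Fc; rewrite in_itv /= lexx ler01.
  + by apply: cvg_at_left_filter; apply: Fc; rewrite in_itv /= lexx ler01.
- by move=> t t01; rewrite derive1E; case: (dF t) => //; exact: subset_itv_oo_cc t01.
Qed.

Lemma FTC_laurent (S T : seq (R[i] * int)) c : curve_in (punctured_plane R) c ->
  laurent_deriv S = T ->
  \int[mu]_(t in `[0, 1]) complex.Re (laurent T (toC (c t)) * toC (derive1 c t)) =
  complex.Re (laurent S (toC (c 1))) - complex.Re (laurent S (toC (c 0))).
Proof.
move=> cU <-; rewrite /Rintegral.
have [||_ ->] // := FTC_curve (F := fun p => complex.Re (laurent S (toC p)))
  (h := fun p => laurent (laurent_deriv S) (toC p)) cU => p.
  rewrite -toC_eq0 => p0; have [H _] := wirtinger_laurent S p0.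
  by apply: is_diff_eq H _; apply/funext => v; rewrite mul0r addr0.
by rewrite -toC_eq0 => p0; exact: (wirtinger_continuous (wirtinger_laurent _ p0)).
Qed.

End Curves.

(** * Existence and uniqueness of the Weierstrass integral *)

Section Weierstrass.
Variables (R : realType) (m : nat) (l : R[i]).
Hypothesis hm : (1 <= m)%N.
Hypothesis hl : l * l^*%C = 1.
Local Notation WI := (weierstrass_integral (ex_phi m l) (ex_psi m l) (ex_h l) (ex_poles l)).
Local Notation prim := (fun j => laurent_prim (formPhi m l j)).

Lemma row_Re_prim p j : row_Re 1 prim p 0 j =
  2 * complex.Re (laurent (laurent_prim (formPhi m l j)) (toC p)).
Proof. by rewrite mxE mul1r. Qed.

Let incr p q j : row_Re 1 prim q 0 j - row_Re 1 prim p 0 j =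
  2 * (complex.Re (laurent (laurent_prim (formPhi m l j)) (toC q)) -
       complex.Re (laurent (laurent_prim (formPhi m l j)) (toC p))).
Proof. by rewrite mulrBr; congr (_ - _); exact: row_Re_prim. Qed.

Let subM (u v u' v' : 'rV[R]_4) j : u 0 j - u' 0 j = v 0 j - v' 0 j ->
  (u - v) 0 j = (u' - v') 0 j.
Proof. by rewrite !mxE; lra. Qed.

Lemma weierstrass_exists : exists x : R * R -> 'rV[R]_4, WI x.
Proof.
exists (row_Re 1 prim), (fun j => laurent (formPhi m l j)); split.
- by move=> j z; exact: holomorphic_laurent.
- by move=> j z z0 zS; exact: form_weierstrass.
- move=> c cU j; apply: etrans (incr _ _ j) _; congr (_ * _).
  exact/esym/(FTC_laurent cU (laurent_primPhi l hm j)).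
Qed.

(** By continuity, as z is a limit of points outside the finite set S. This determines [Phi] at the
    poles of phi and psi, where its defining formula says nothing. *)
Lemma holomorphic_unique (f g : R[i] -> R[i]) (S : seq R[i]) z :
  holomorphic_at f z -> holomorphic_at g z ->
  (\forall w \near (z : R[i]^o), w \notin S -> f w = g w) -> f z = g z.
Proof.
move=> hf hg fg.
have C h : holomorphic_at h z ->
    (h : R[i]^o -> R[i]^o) w @[w --> (z : R[i]^o)^'] --> (h z : R[i]^o).
  move=> hh; apply: (@cvg_trans _ (h w @[w --> (z : R[i]^o)])).
    by move=> A; exact: nbhs_dnbhs.
  have dh : derivable (h : R[i]^o -> R[i]^o) (z : R[i]^o) 1 by exact: (nbhs_singleton hh).
  exact: (@differentiable_continuous _ _ _ _ _ ((derivable1_diffP _ _).1 dh)).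
have nS : \forall w \near (z : R[i]^o)^', w \notin S.
  elim: {fg} S => [|s S IH]; first by near=> w.
  suff : \forall w \near (z : R[i]^o)^', w != s.
    by move=> H; apply: filterS2 H IH => w ws wS; rewrite inE negb_or ws.
  have [->|sz] := eqVneq s z; first exact: (@nbhs_dnbhs_neq R[i]^o z).
  apply: nbhs_dnbhs; apply/nbhs_ballP.
  exists `|z - s|; first by rewrite /= normr_gt0 subr_eq0 eq_sym.
  move=> w; rewrite -ball_normE /= => h.
  by apply: contraTneq h => ->; rewrite ltxx.
apply: (cvg_unique _ (C f hf)); first exact: norm_hausdorff.
apply: cvg_trans (C g hg); apply: near_eq_cvg.
near=> w; symmetry; near: w.
have fg' : \forall w \near (z : R[i]^o)^', w \notin S -> f w = g w by exact: nbhs_dnbhs.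
by apply: filterS2 nS fg' => w wS; exact.
Unshelve. all: by end_near. Qed.

Lemma weierstrass_unique x : WI x -> exists x0, forall p, p != 0 ->
  x p = x0 + row_Re 1 prim p.
Proof.
move=> [Phi [H1 H2 H3]].
have PhiE j z : z != 0 -> Phi j z = laurent (formPhi m l j) z.
  move=> z0; apply: (@holomorphic_unique _ _ (ex_poles l)).
  - exact: H1.
  - exact: holomorphic_laurent.
  - near=> w => wS; have w0 : w != 0 by near: w; exact: near_neq0.
    by rewrite H2 // form_weierstrass.
have step c : curve_in (punctured_plane R) c ->
    x (c 1) - row_Re 1 prim (c 1) = x (c 0) - row_Re 1 prim (c 0).
  move=> cU; apply/rowP => j; have := H3 c cU j.
  have -> : \int[lebesgue_measure]_(t in `[0, 1]) complex.Re (Phi j (toC (c t)) * toC (derive1 c t))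
      = \int[lebesgue_measure]_(t in `[0, 1])
          complex.Re (laurent (formPhi m l j) (toC (c t)) * toC (derive1 c t)).
    apply: eq_Rintegral => t /set_mem /= t01; rewrite PhiE // toC_eq0.
    by apply: cU.2; rewrite in_itv in t01.
  rewrite (FTC_laurent cU (laurent_primPhi l hm j)) => E.
  apply: subM; apply: etrans E _; exact/esym/incr.
have seg p q : p != 0 -> (forall t, 0 <= t <= 1 -> segment p q t != 0) ->
    x q - row_Re 1 prim q = x p - row_Re 1 prim p.
  move=> p0 H; have := step (segment p q); rewrite segment0 segment1; apply.
  by split => //; exact: C1_segment.
exists (x (1, 0) - row_Re 1 prim (1, 0)) => p p0.
suff <- : x p - row_Re 1 prim p = x (1, 0) - row_Re 1 prim (1, 0) by rewrite subrK.
have segE (a b : R * R) (t : R) : segment a b t =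
    (a.1 + t * (b.1 - a.1), a.2 + t * (b.2 - a.2)) by [].
have e0 : (1, 0) != 0 :> R * R by rewrite -pair_eqE /= oner_eq0.
(* The segment from (1, 0) to p meets the origin only if p lies on the negative axis; the path then
   passes through (0, 1). *)
have [/andP[p1 p2]|np] := boolP ((p.1 <= 0) && (p.2 == 0)).
  have e1 : (0, 1) != 0 :> R * R by rewrite -pair_eqE /= oner_eq0 andbF.
  apply: (etrans (seg (0, 1) p e1 _) (seg (1, 0) (0, 1) e0 _)) => t /andP[t0 t1]; last first.
    apply/eqP => -[] h1 h2; lra.
  apply/eqP; rewrite segE /= (eqP p2) => -[] h1 h2.
  have tE : t = 1 by lra.
  move: h1; rewrite tE mul1r subr0 add0r => h1.
  by move: p0; rewrite -pair_eqE /= h1 (eqP p2) eqxx.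
apply: seg => // t /andP[t0 t1]; apply/eqP; rewrite segE /= => -[].
rewrite add0r subr0 => h1 /eqP; rewrite mulf_eq0 => /orP[/eqP tE|p2].
  by move: h1; rewrite tE mul0r addr0 => /eqP; rewrite oner_eq0.
move: np; rewrite p2 andbT -ltNge => p1; have : 0 <= t * p.1 by rewrite mulr_ge0 // ltW.
have [t1'|t1'] := eqVneq t 1.
  by move: h1; rewrite t1'; lra.
have : 0 < 1 - t by rewrite subr_gt0 lt_neqAle t1' t1.
lra.
Unshelve. all: by end_near. Qed.

End Weierstrass.

(** * Invariance under the antipode *)

Section Antipode.
Variables (R : realType) (m : nat) (l : R[i]).
Hypothesis hm : (1 <= m)%N.
Implicit Types (p q : R * R) (z : R[i]).
Local Notation lb := (l^*%C).
Local Notation prim := (fun j => laurent_prim (formPhi m l j)).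
Local Notation PA := (laurent (laurent_prim (formA m l))).
Local Notation PB := (laurent (laurent_prim (formB m l))).
Local Notation PC := (laurent (laurent_prim (formC l))).
Local Notation PD := (laurent (laurent_prim (formD l))).

Lemma toC_antipode p : toC (antipode p) = - ((toC p)^*%C)^-1.
Proof. by rewrite /antipode ofCK. Qed.

Lemma antipode_neq0 p : p != 0 -> antipode p != 0.
Proof.
by rewrite -!toC_eq0 toC_antipode oppr_eq0 invr_eq0 conjc_eq0.
Qed.

Lemma laurent_prim_formPhi j z : laurent (laurent_prim (formPhi m l j)) z =
  null_form (PA z) (PB z) (PC z) (PD z) j.
Proof.
rewrite /formPhi /null_form.
case: j => -[|[|[|[|//]]]] hj.
- rewrite -[LHS]/(laurent (laurent_prim (formA m l ++ formB m l)) z).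
  by rewrite laurent_prim_cat laurent_cat.
- rewrite -[LHS]/(laurent (laurent_prim (laurent_scale (- 'i%C)
    (formA m l ++ laurent_scale (-1) (formB m l)))) z).
  by rewrite laurent_prim_scale laurent_scaleE laurent_prim_cat
    laurent_prim_scale laurent_cat laurent_scaleE mulN1r.
- rewrite -[LHS]/(laurent (laurent_prim (formD l ++ laurent_scale (-1) (formC l))) z).
  by rewrite laurent_prim_cat laurent_prim_scale laurent_cat laurent_scaleE mulN1r.
- rewrite -[LHS]/(laurent (laurent_prim (formD l ++ formC l)) z).
  by rewrite laurent_prim_cat laurent_cat.
Qed.

Let expz z (k : nat) : z ^ (- k%:Z) = (z ^+ k)^-1.
Proof. by rewrite exprnN. Qed.

Lemma conjc_neq0 z : z != 0 -> z^*%C != 0. Proof. by rewrite conjc_eq0. Qed.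

(** Comparing primitives rather than forms yields the invariance of x with no integration constant
    left to determine. The signs match because the lowest exponent 2 m - 1 of the primitive of A is
    odd. *)
Lemma prim_formA z : z != 0 -> PA (- z^*%C^-1) = (PB z)^*%C.
Proof.
move=> z0; have zb0 := conjc_neq0 z0.
have [k kE ko] : exists2 k, (2 * m)%N = k.+1 & odd k.
  exists (2 * m).-1; first by rewrite prednK // muln_gt0.
  by case: m hm => // n _; rewrite mulnS /= oddM.
have N1k : (-1) ^+ k = -1 :> R[i] by rewrite -signr_odd ko.
rewrite !laurent_cons !laurent_nil /= kE.
have -> : k.+1%:Z - 2 + 1 = k%:Z by lia.
have -> : k.+1%:Z - 1 + 1 = k.+1%:Z by lia.
have -> : k.+1%:Z + 1 = k.+2%:Z by lia.
have -> : - k.+1%:Z - 2 + 1 = - k.+2%:Z by lia.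
have -> : - k.+1%:Z - 1 + 1 = - k.+1%:Z by lia.
have -> : - k.+1%:Z + 1 = - k%:Z by lia.
rewrite !expz -![_ ^ (Posz _)]/(_ ^+ _) !rmorphN /= -!pmulrn.
have k0 : k%:R != 0 :> R[i] by rewrite pnatr_eq0; case: k ko {kE N1k}.
have k1 : k.+1%:R != 0 :> R[i] by rewrite pnatr_eq0.
have k2 : k.+2%:R != 0 :> R[i] by rewrite pnatr_eq0.
have zk : z^*%C ^+ k != 0 by rewrite expf_neq0.
have eN j : (- z^*%C^-1) ^+ j = (-1) ^+ j / z^*%C ^+ j .
  by rewrite (exprNn (z^*%C^-1) j) exprVn.
rewrite !addr0 !eN !conjcD !conjcM !conjcV !conjcN !conjcX !conjcM conjcB.
rewrite !conjc_nat !conjci conjcX conjc1 !conjcK.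
rewrite 2![(-1) ^+ _.+1]exprS [(-1) ^+ k.+1]exprS N1k 2![z^*%C ^+ _.+1]exprS [z^*%C ^+ k.+1]exprS.
move: (k%:R : R[i]) (k.+1%:R : R[i]) (k.+2%:R : R[i]) k0 k1 k2 => a b c a0 b0 c0.
by field; rewrite a0 b0 c0 zb0 zk.
Qed.

Lemma prim_formC z : z != 0 -> PC (- z^*%C^-1) = (PC z)^*%C.
Proof.
move=> z0; have zb0 := conjc_neq0 z0.
rewrite !laurent_cons !laurent_nil /=.
have -> : - 2 + 1 = - (1%N%:Z) :> int by [].
have -> : 0 + 1 = 1%N%:Z :> int by [].
rewrite !expz -![_ ^ (Posz _)]/(_ ^+ _) !expr1 !rmorphN /= -!pmulrn.
rewrite !addr0 !divr1 !(conjcE, conjc_nat).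
by field; rewrite zb0 /=.
Qed.

Lemma prim_formD z : z != 0 -> PD (- z^*%C^-1) = (PD z)^*%C.
Proof.
move=> z0; have zb0 := conjc_neq0 z0.
rewrite !laurent_cons !laurent_nil /=.
have -> : - 2 + 1 = - (1%N%:Z) :> int by [].
have -> : 0 + 1 = 1%N%:Z :> int by [].
rewrite !expz -![_ ^ (Posz _)]/(_ ^+ _) !expr1 !rmorphN /= -!pmulrn.
rewrite !addr0 !divr1 !(conjcE, conjc_nat).
by field; rewrite zb0 /=.
Qed.

Lemma prim_formB z : z != 0 -> PB (- z^*%C^-1) = (PA z)^*%C.
Proof.
move=> z0; have w0 : - z^*%C^-1 != 0 by rewrite oppr_eq0 invr_eq0 conjc_neq0.
have := prim_formA w0; rewrite conjcN conjcV conjcK invrN invrK opprK => ->.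
by rewrite conjcK.
Qed.

(** Exchanging a and b changes the sign of a - b, which compensates conj i = - i. *)
Lemma Re_null_form_conj (a b c d : R[i]) j :
  complex.Re (null_form b^*%C a^*%C c^*%C d^*%C j) = complex.Re (null_form a b c d j).
Proof.
rewrite /null_form; case: j => -[|[|[|[|//]]]] hj /=; rewrite !cReImE /=; ring.
Qed.

Let null_form_congr (a b c d a' b' c' d' : R[i]) : a = a' -> b = b' -> c = c' ->
  d = d' -> null_form a b c d = null_form a' b' c' d'.
Proof. by move=> -> -> -> ->. Qed.

Lemma row_Re_antipode p : p != 0 -> row_Re 1 prim (antipode p) = row_Re 1 prim p.
Proof.
rewrite -toC_eq0 => p0; apply/rowP => j.
apply: etrans (row_Re_prim m l _ j) _; apply/esym.
apply: etrans (row_Re_prim m l _ j) _; apply/esym.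
apply: (congr1 (fun r => 2 * r)).
apply: etrans (congr1 (fun z => complex.Re (laurent _ z)) (toC_antipode p)) _.
apply: etrans (congr1 (@complex.Re R) (laurent_prim_formPhi j _)) _; apply/esym.
apply: etrans (congr1 (@complex.Re R) (laurent_prim_formPhi j _)) _; apply/esym.
have E := congr1 (fun f : 'I_4 -> R[i] => complex.Re (f j))
  (null_form_congr (prim_formA p0) (prim_formB p0) (prim_formC p0) (prim_formD p0)).
exact: etrans E (Re_null_form_conj _ _ _ _ j).
Qed.

Lemma quotient_proj_eq (a b : punctured_plane R) :
  (quotient_proj a = quotient_proj b) <-> antipodal a b.
Proof.
split; first by move=> /eqmodP.
by move=> ?; apply/eqmodP.
Qed.

Lemma quotient_proj_repr (P : antipodal_quotient R) :
  exists a : punctured_plane R, quotient_proj a = P.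
Proof. by exists (repr (P : {eq_quot (antipodal_equiv R)}%qT)); exact: reprK. Qed.

Lemma factor_quotient (T : Type) (x : R * R -> T) :
  (forall p, p != 0 -> x (antipode p) = x p) ->
  exists X : antipodal_quotient R -> T,
    forall p : punctured_plane R, X (quotient_proj p) = x (val p).
Proof.
move=> xI; have [r rK] := choice quotient_proj_repr.
exists (fun P => x (val (r P))) => p.
have /quotient_proj_eq /orP[/eqP -> //|/eqP E] := rK (quotient_proj p).
by rewrite E xI //; exact: (set_valP (r (quotient_proj p))).
Qed.

End Antipode.

(** * Completeness *)

Section Length.
Variables (R : realType) (g : R * R -> 'M[R]_2) (e : R * R -> R).
Hypothesis gE : forall p, p != 0 -> g p = (e p)%:M.
Hypothesis e_gt0 : forall p, p != 0 -> 0 < e p.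
Hypothesis e_cont : forall p, p != 0 -> {for p, continuous e}.
Variable k : R.
Hypothesis k_gt0 : 0 < k.
Hypothesis e_lower : forall p, p != 0 -> k ^+ 2 * (1 + (nq p)^-1) ^+ 2 <= e p.
Implicit Types (p q v : R * R) (c : R -> R * R).
Local Notation mu := (@lebesgue_measure R).
Import Normc.

Lemma nq_continuous : continuous (@nq R).
Proof.
have -> : @nq R = fun p => p.1 * p.1 + p.2 * p.2.
  by apply/funext => p; rewrite /nq !expr2.
move=> p; apply: cvgD; apply: cvgM; [exact: cvg_fst|exact: cvg_fst|exact: cvg_snd|exact: cvg_snd].
Qed.

Lemma nq_coord v (r : R) : 0 < r -> nq v < r ^+ 2 -> `|v.1| < r /\ `|v.2| < r.
Proof.
move=> r0; have s1 := sqr_ge0 v.1; have s2 := sqr_ge0 v.2.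
by rewrite /nq => h; split;
  rewrite -(ltr_pXn2r (n := 2)) // ?nnegrE ?ltW // real_normK ?num_real //; lra.
Qed.

Lemma sqrt_nq v : Num.sqrt (nq v) = normc (toC v).
Proof. by case: v. Qed.

Lemma speedE c t : c t != 0 ->
  speed g c t = Num.sqrt (e (c t)) * Num.sqrt (nq (derive1 c t)).
Proof.
move=> ct0; rewrite -sqrtrM ?(ltW (e_gt0 ct0)) // /speed gE //; congr Num.sqrt.
rewrite !sum_ord2 !mxE /coord_val /= !(mulr1n, mulr0n) /nq; ring.
Qed.

Lemma speed_within c : curve_in (punctured_plane R) c ->
  {within `[0, 1], continuous (speed g c)}.
Proof.
move=> [c1 cU].
have H : {within `[0, 1],
    continuous (fun t => Num.sqrt (e (c t)) * Num.sqrt (nq (derive1 c t)) : R)}.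
  apply: continuous_in_subspaceT => t /set_mem; rewrite /= in_itv /= => /cU ct0.
  apply: cvgM.
    have h1 := continuous_comp (C1_curve_continuous (t := t) c1) (e_cont ct0).
    exact: (continuous_comp h1 (@sqrt_continuous _ _)).
  have h2 := continuous_comp (c1.2 t) (@nq_continuous (derive1 c t)).
  exact: (continuous_comp h2 (@sqrt_continuous _ _)).
apply: subspace_eq_continuous H => t /set_mem; rewrite /= in_itv /= => /cU ct0.
exact/esym/speedE.
Qed.

Lemma curve_length_ge0 c : (0 <= curve_length g c)%E.
Proof. by apply: integral_ge0 => t _; rewrite lee_fin sqrtr_ge0. Qed.

(** Along c, |dF| <= |h| |c'| <= (1 + 1 / rho) |c'|, and [e_lower] bounds this by the speed divided
    by k. *)
Lemma increment_le_length c (F : R * R -> R) (h : R * R -> R[i]) :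
  curve_in (punctured_plane R) c ->
  (forall p, p != 0 -> is_diff p F (fun v => complex.Re (h p * toC v) : R)) ->
  (forall p, p != 0 -> {for p, continuous (fun q => complex.Re (h q) : R)} /\
    {for p, continuous (fun q => complex.Im (h q) : R)}) ->
  (forall p, p != 0 -> normc (h p) <= 1 + (nq p)^-1) ->
  (`|F (c 1) - F (c 0)|%:E <= k^-1%:E * curve_length g c)%E.
Proof.
move=> cU Fh hc hb; have [cD E] := FTC_curve cU Fh hc.
have mI : measurable (`[0%R, 1%R]%classic : set (measurableTypeR R)) by exact: measurable_itv.
have mD : measurable_fun (`[0%R, 1%R]%classic : set (measurableTypeR R))
    (fun t => complex.Re (h (c t) * toC (derive1 c t)) : R).
  exact: subspace_continuous_measurable_fun.
have mS : measurable_fun (`[0%R, 1%R]%classic : set (measurableTypeR R)) (speed g c).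
  by apply: subspace_continuous_measurable_fun => //; exact: speed_within.
rewrite -abse_EFin -E /curve_length -ge0_integralZl_EFin //; last 3 first.
- by move=> t _; rewrite lee_fin sqrtr_ge0.
- exact/measurable_EFinP.
- by rewrite invr_ge0 ltW.
apply: le_trans (le_abse_integral _ mI _) _; first exact/measurable_EFinP.
apply: ge0_le_integral => //.
- by apply: measurableT_comp => //; exact/measurable_EFinP.
- by apply/measurable_EFinP; apply: measurable_funM => //; exact: measurable_cst.
move=> t /=; rewrite in_itv /= => /cU.2 ct0.
rewrite -EFinM lee_fin speedE // [k^-1 * _]mulrC ler_pdivlMr //.
apply: le_trans (ler_wpM2r (ltW k_gt0) (ler_Re_normc _)) _.
rewrite normcM sqrt_nq mulrAC ler_wpM2r ?normc_ge0 //.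
apply: le_trans (ler_wpM2r (ltW k_gt0) (hb _ ct0)) _.
have r0 := nq_gt0 ct0.
have s0 : 0 <= 1 + (nq (c t))^-1 by rewrite addr_ge0 // invr_ge0 ltW.
rewrite mulrC -[leLHS]ger0_norm ?mulr_ge0 ?(ltW k_gt0) // -sqrtr_sqr ler_wsqrtr //.
by rewrite exprMn e_lower.
Qed.

Lemma segment_length_le p q (M : R) :
  (forall t, 0 <= t <= 1 -> segment p q t != 0 /\ e (segment p q t) <= M) ->
  (curve_length g (segment p q) <= (Num.sqrt M * Num.sqrt (nq (q - p)))%:E)%E.
Proof.
move=> H.
have cU : curve_in (punctured_plane R) (segment p q).
  by split; [exact: C1_segment|move=> t /H[]].
have mI : measurable (`[0%R, 1%R]%classic : set (measurableTypeR R)) by exact: measurable_itv.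
have mS : measurable_fun (`[0%R, 1%R]%classic : set (measurableTypeR R)) (speed g (segment p q)).
  by apply: subspace_continuous_measurable_fun => //; exact: speed_within.
have -> : (Num.sqrt M * Num.sqrt (nq (q - p)))%:E =
  (\int[mu]_(t in `[0%R, 1%R]) (cst (Num.sqrt M * Num.sqrt (nq (q - p)))%:E t))%E.
  rewrite integral_cst //; transitivity ((Num.sqrt M * Num.sqrt (nq (q - p)))%:E * 1)%E.
    by rewrite mule1.
  by congr (_ * _)%E; rewrite [RHS]lebesgue_measure_itv /= lte_fin ltr01 sube0.
apply: ge0_le_integral => //.
- by move=> t _; rewrite lee_fin sqrtr_ge0.
- exact/measurable_EFinP.
- move=> t /=; rewrite in_itv /= => /H[h1 h2].
  rewrite lee_fin speedE // derive1_segment ler_wpM2r ?sqrtr_ge0 //.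
  exact: ler_wsqrtr.
Qed.

Lemma quotient_dist_ge0 P Q : (0 <= quotient_dist g P Q)%E.
Proof. by apply: le_ereal_inf_tmp => _ [c _ <-]; exact: curve_length_ge0. Qed.

(** Straight segments near z have length at most a local bound of sqrt e times the Euclidean length;
    so Euclidean convergence of lifts gives convergence in the quotient. *)
Lemma quotient_dist_small (z : punctured_plane R) : exists M d, [/\ 0 <= M, 0 < d &
  forall p : punctured_plane R, nq (val p - val z) < d ^+ 2 ->
   (quotient_dist g (quotient_proj p) (quotient_proj z) <=
     (M * Num.sqrt (nq (val p - val z)))%:E)%E].
Proof.
have z0 : val z != 0 by exact: (set_valP z).
have : \forall q \near val z, q != 0 /\ e q <= e (val z) + 1.
  apply: filterI.
    by apply: open_nbhs_nbhs; split; [exact: open_punctured|].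
  have := e_cont z0; move=> /cvgrPdist_le /(_ 1 ltr01); apply: filterS => q.
  by rewrite ler_distlC => /andP[].
move=> /nbhs_ballP[d /= d0 H].
exists (Num.sqrt (e (val z) + 1)), d; split => // p hp.
have hseg t : 0 <= t <= 1 -> ball (val z) d (segment (val p) (val z) t).
  move=> /andP[t0 t1]; have [h1 h2] := nq_coord d0 hp.
  have B (a b : R) : `|a - b| < d -> `|b - (a + t * (b - a))| < d.
    have -> : b - (a + t * (b - a)) = (1 - t) * (b - a) by ring.
    rewrite normrM distrC => h; rewrite ger0_norm ?subr_ge0 //.
    by apply: le_lt_trans h; rewrite ler_piMl //; lra.
  by split; rewrite /ball /=; apply: B.
have nqC : nq (val z - val p) = nq (val p - val z) by rewrite /nq /=; ring.
rewrite -nqC.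
apply: le_trans (segment_length_le (M := e (val z) + 1) _); last first.
  by move=> t /hseg /H.
apply: ereal_inf_lbound; exists (segment (val p) (val z)) => //=.
split.
  by split; [exact: C1_segment|move=> t /hseg /H[]].
by exists p, z; rewrite segment0 segment1.
Qed.

(** F descends to a function on the quotient with Lipschitz constant 1 / k. Since the distance is an
    extended real infimum, the bound is stated through a strict real majorant eps and for all
    lifts. *)
Definition invariant_lipschitz (F : R * R -> R) := forall P Q (eps : R),
  (quotient_dist g P Q < eps%:E)%E -> forall p q : punctured_plane R,
  quotient_proj p = P -> quotient_proj q = Q -> `|F (val p) - F (val q)| <= k^-1 * eps.

Lemma wirtinger_lipschitz (f a b : R * R -> R[i]) :
  (forall p, p != 0 -> wirtinger f p (a p) (b p)) ->
  (forall p, p != 0 -> exists u w : R[i], wirtinger a p u w) ->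
  (forall p, p != 0 -> exists u w : R[i], wirtinger b p u w) ->
  (forall p, p != 0 -> normc (a p) + normc (b p) <= 1 + (nq p)^-1) ->
  (forall p, p != 0 -> f (antipode p) = f p) ->
  invariant_lipschitz (fun p => complex.Re (f p)) /\
  invariant_lipschitz (fun p => complex.Im (f p)).
Proof.
have main (f0 a0 b0 : R * R -> R[i]) :
  (forall p, p != 0 -> wirtinger f0 p (a0 p) (b0 p)) ->
  (forall p, p != 0 -> exists u w : R[i], wirtinger a0 p u w) ->
  (forall p, p != 0 -> exists u w : R[i], wirtinger b0 p u w) ->
  (forall p, p != 0 -> normc (a0 p) + normc (b0 p) <= 1 + (nq p)^-1) ->
  (forall p, p != 0 -> f0 (antipode p) = f0 p) ->
  invariant_lipschitz (fun p => complex.Re (f0 p)).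
  move=> Hf Ha Hb Hn HI P Q eps.
  move=> /ereal_inf_lt[_ [c [cU [p' [q' [pP qQ c0 c1]]]] <-] hlt] p q pP' qQ'.
  have same (r r' : punctured_plane R) : quotient_proj r = quotient_proj r' ->
      f0 (val r) = f0 (val r').
    by move=> /quotient_proj_eq /orP[/eqP -> //|/eqP ->]; rewrite HI //; exact: (set_valP r).
  (* The short curve may join other lifts than p and q; invariance gives the same values there. *)
  rewrite (same p p') ?pP // (same q q') ?qQ // -c0 -c1 distrC.
  have H : (`|complex.Re (f0 (c 1)) - complex.Re (f0 (c 0))|%:E <= k^-1%:E * curve_length g c)%E.
    apply: (increment_le_length (F := fun p => complex.Re (f0 p))
      (h := fun p => a0 p + (b0 p)^*%C)) => // r r0.
    - have [H _] := Hf _ r0; apply: is_diff_eq H _; apply/funext => v.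
      by rewrite !cReImE; ring.
    - have [c' [d' Hc]] := Ha _ r0; have [c'' [d'' Hd]] := Hb _ r0.
      exact: wirtinger_continuous (wirtingerD Hc (wirtingerC Hd)).
    - by apply: le_trans (normcD _ _) _; rewrite normcC; exact: Hn.
  rewrite -lee_fin EFinM; apply: le_trans H _.
  by rewrite lee_wpmul2l ?ltW // lte_fin invr_gt0.
move=> Hf Ha Hb Hn HI; split; first exact: main Hf Ha Hb Hn HI.
have -> : (fun p => complex.Im (f p)) = fun p => complex.Re (- 'i%C * f p).
  by apply/funext => p; rewrite !cReImE /=; ring.
apply: (main _ (fun p => - 'i%C * a p) (fun p => - 'i%C * b p)) => p p0.
- exact: wirtingerZ (Hf _ p0).
- by have [c [d H]] := Ha _ p0; exists (- 'i%C * c), (- 'i%C * d); exact: wirtingerZ.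
- by have [c [d H]] := Hb _ p0; exists (- 'i%C * c), (- 'i%C * d); exact: wirtingerZ.
- by rewrite !normcM normcN normc_i !mul1r; exact: Hn.
- by rewrite HI.
Qed.

(* Two antipode-invariant functions with |df| <= 1 + 1 / |z|^2; together they
   separate the points of the quotient. *)
Definition inv1 p : R[i] := toC p - ((toC p)^*%C)^-1.
Definition inv2 p : R[i] := toC p / (toC p)^*%C.

Lemma normcV (z : R[i]) : normc z^-1 = (normc z)^-1.
Proof.
have [->|z0] := eqVneq z 0; first by rewrite invr0 normc0 invr0.
have nz : normc z != 0 by rewrite gt_eqF // normc_gt0.
by apply: (mulfI nz); rewrite -normcM !divff // normc1.
Qed.

Lemma inv1_lipschitz : invariant_lipschitz (fun p => complex.Re (inv1 p)) /\
  invariant_lipschitz (fun p => complex.Im (inv1 p)).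
Proof.
have zb0 p : p != 0 -> (toC p)^*%C != 0 by rewrite conjc_eq0 toC_eq0.
have zb2 p : p != 0 -> (toC p)^*%C ^+ 2 != 0 by move=> ?; rewrite expf_neq0 ?zb0.
apply: (wirtinger_lipschitz (a := fun=> 1) (b := fun p => ((toC p)^*%C ^+ 2)^-1)) => p p0.
- apply: wirtinger_eq (wirtingerB (wirtinger_id p)
    (wirtingerV (zb0 _ p0) (wirtingerC (wirtinger_id p)))) _ _.
    by rewrite conjc0 oppr0 mul0r subr0.
  by rewrite conjc1 sub0r mulN1r opprK.
- by exists 0, 0; exact: wirtinger_cst.
- by do 2 eexists; exact: wirtingerV (zb2 _ p0) (wirtingerX 2 (wirtingerC (wirtinger_id p))).
- by rewrite normc1 normcV normcX normcC -sqrt_nq sqr_sqrtr ?nq_ge0.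
- rewrite /inv1 toC_antipode conjcN conjcV conjcK invrN invrK opprK addrC.
  by [].
Qed.

Lemma inv2_lipschitz : invariant_lipschitz (fun p => complex.Re (inv2 p)) /\
  invariant_lipschitz (fun p => complex.Im (inv2 p)).
Proof.
have zb0 p : p != 0 -> (toC p)^*%C != 0 by rewrite conjc_eq0 toC_eq0.
have zb2 p : p != 0 -> (toC p)^*%C ^+ 2 != 0 by move=> ?; rewrite expf_neq0 ?zb0.
apply: (wirtinger_lipschitz (a := fun p => ((toC p)^*%C)^-1)
  (b := fun p => - toC p / (toC p)^*%C ^+ 2)) => p p0.
- apply: wirtinger_eq (wirtingerM (wirtinger_id p)
    (wirtingerV (zb0 _ p0) (wirtingerC (wirtinger_id p)))) _ _.
    by rewrite conjc0 oppr0 mul0r mulr0 addr0 mul1r.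
  by rewrite conjc1 mul0r add0r mulNr mulrN mul1r mulNr.
- by do 2 eexists; exact: wirtingerV (zb0 _ p0) (wirtingerC (wirtinger_id p)).
- by do 2 eexists; apply: wirtingerM (wirtingerN (wirtinger_id p))
    (wirtingerV (zb2 _ p0) (wirtingerX 2 (wirtingerC (wirtinger_id p)))).
- rewrite !(normcM, normcN, normcV, normcX, normcC) -sqrt_nq.
  have r0 := nq_gt0 p0; have s0 : 0 < Num.sqrt (nq p) by rewrite sqrtr_gt0.
  rewrite -[in leRHS](sqr_sqrtr (ltW r0)); move: (Num.sqrt (nq p)) s0 => s s0.
  (* The two derivatives of z / conj z have moduli adding up to 2 / |z|. *)
  rewrite -subr_ge0; have -> : 1 + (s ^+ 2)^-1 - (s^-1 + s / s ^+ 2) = (1 - s^-1) ^+ 2.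
    by field; rewrite gt_eqF.
  exact: sqr_ge0.
- rewrite /inv2 toC_antipode conjcN conjcV conjcK invrN invrK mulrNN mulrC.
  by [].
Qed.

End Length.

(** * Limits of lifts from limits of the two invariants *)

Section InvariantLimit.
Variable R : realType.
Implicit Types (p q v : R * R).
Import Normc.

Lemma real_cauchy_cvg (u : nat -> R) :
  (forall eps, 0 < eps -> exists M : nat, forall j k, (M <= j)%N -> (M <= k)%N ->
    `|u j - u k| <= eps) -> cvg (u @ \oo).
Proof.
move=> H; apply/cauchy_cvgP/cauchyP => eps e0.
have [M HM] := H (eps / 2) (divr_gt0 e0 (ltr0Sn _ 1)).
exists (u M); have : \forall n \near \oo, (M <= n)%N by exact: nbhs_infty_ge.
apply: filterS => n Mn; rewrite /ball /=.
by apply: le_lt_trans (HM M n (leqnn _) Mn) _; lra.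
Qed.

(** The larger root of rho + 1 / rho = s; it recovers rho because |[inv1]|^2 + 2 = rho + 1 / rho. *)
Let rho_of (s : R) := (s + Num.sqrt (s * s - 4)) / 2.

Lemma rho_ofK (rho : R) : 1 <= rho -> rho_of (rho + rho^-1) = rho.
Proof.
move=> r1; have r0 : 0 < rho by lra.
rewrite /rho_of; have -> : (rho + rho^-1) * (rho + rho^-1) - 4 = (rho - rho^-1) ^+ 2.
  by field; rewrite gt_eqF.
rewrite sqrtr_sqr ger0_norm; first by field; rewrite gt_eqF.
by rewrite subr_ge0 (le_trans _ r1) // invf_le1.
Qed.

Lemma rho_of_cvg (s : nat -> R) (a : R) : s n @[n --> \oo] --> a ->
  rho_of (s n) @[n --> \oo] --> rho_of a.
Proof.
move=> H; rewrite /rho_of; apply: cvgM; last exact: cvg_cst.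
apply: cvgD => //.
have h : s n * s n - 4 @[n --> \oo] --> a * a - 4.
  by apply: cvgB; [exact: cvgM|exact: cvg_cst].
exact: (continuous_cvg _ (@sqrt_continuous _ _) h).
Qed.

Lemma inv1_Re p : complex.Re (inv1 p) = p.1 * (1 - (nq p)^-1).
Proof.
case: p => x y; rewrite /inv1 cReD cReN cReV cReC cImC sqrrN /nq /=; ring.
Qed.

Lemma inv1_Im p : complex.Im (inv1 p) = p.2 * (1 - (nq p)^-1).
Proof.
case: p => x y; rewrite /inv1 cImD cImN cImV cReC cImC sqrrN /nq /=; ring.
Qed.

Lemma inv2_Re p : p != 0 -> complex.Re (inv2 p) * nq p = p.1 ^+ 2 - p.2 ^+ 2.
Proof.
move=> /nq_gt0; case: p => x y; rewrite /inv2 cReM cReV cImV cReC cImC sqrrN /nq /= => h.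
by field; rewrite gt_eqF.
Qed.

Lemma inv2_Im p : p != 0 -> complex.Im (inv2 p) * nq p = 2 * p.1 * p.2.
Proof.
move=> /nq_gt0; case: p => x y; rewrite /inv2 cImM cReV cImV cReC cImC sqrrN /nq /= => h.
by field; rewrite gt_eqF.
Qed.

Lemma nqV_antipode p : nq (antipode p) = (nq p)^-1.
Proof.
have E q : nq q = normc (toC q) ^+ 2 by rewrite sqr_normc.
by rewrite !E toC_antipode normcN normcV normcC exprVn.
Qed.

Lemma antipodeE p : antipode p = (- p.1 / nq p, - p.2 / nq p).
Proof.
rewrite /antipode /ofC cReN cImN cReV cImV cReC cImC sqrrN /nq /=.
by rewrite !mulNr opprK.
Qed.

(** For |q| = 1 one has |1 + q conj p| = |p + q|, so |p| |I p - q| = |p + q|, I being the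
    antipode. *)
Lemma nq_antipode p q : p != 0 -> nq q = 1 -> 1 <= nq p ->
  nq (antipode p - q) <= nq (p + q).
Proof.
move=> p0 q1 p1; have r0 := nq_gt0 p0.
have E : nq p * nq (antipode p - q) = nq (p + q).
  rewrite antipodeE /nq /= -/(nq p); have := q1; rewrite /nq /= => q1'.
  move: r0 p1; rewrite /nq; case: p {p0} => x y /= r0 p1.
  move: q.1 q.2 q1' => a b /(canRL (addrK _)) aE.
  transitivity (1 + 2 * (x * a + y * b) + (x ^+ 2 + y ^+ 2) * (a ^+ 2 + b ^+ 2)).
    by field; rewrite gt_eqF.
  by rewrite aE subrK mulr1; have := aE; lra.
have := nq_ge0 (antipode p - q); nra.
Qed.

Let min_lt (A B C D : R) : 0 <= A -> 0 <= B -> C <= B -> 0 < D ->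
  A * B < D ^+ 2 -> A < D \/ C < D.
Proof.
move=> A0 B0 CB D0 H; have [AB|BA] := leP A B; [left|right; apply: le_lt_trans CB _];
  rewrite ltNge; apply/negP; nra.
Qed.

Lemma invariants_limit (p : nat -> R * R) :
  (forall n, 1 <= nq (p n)) ->
  cvg (complex.Re (inv1 (p n)) @[n --> \oo]) ->
  cvg (complex.Im (inv1 (p n)) @[n --> \oo]) ->
  cvg (complex.Re (inv2 (p n)) @[n --> \oo]) ->
  cvg (complex.Im (inv2 (p n)) @[n --> \oo]) ->
  exists2 z, z != 0 & forall d, 0 < d -> \forall n \near \oo,
    nq (p n - z) < d ^+ 2 \/ nq (antipode (p n) - z) < d ^+ 2.
Proof.
move=> p1 /cvg_ex[a1 A1] /cvg_ex[a2 A2] /cvg_ex[b1 B1] /cvg_ex[b2 B2].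
have p0 n : p n != 0.
  by apply: contraTneq (p1 n) => ->; rewrite /nq /= expr0n addr0 -ltNge ltr01.
pose s n := complex.Re (inv1 (p n)) * complex.Re (inv1 (p n)) +
            complex.Im (inv1 (p n)) * complex.Im (inv1 (p n)) + 2.
have sE n : s n = nq (p n) + (nq (p n))^-1.
  rewrite /s inv1_Re inv1_Im; have := nq_gt0 (p0 n); rewrite /nq => h.
  by field; rewrite gt_eqF.
pose r := rho_of (a1 * a1 + a2 * a2 + 2).
have Cr : nq (p n) @[n --> \oo] --> r.
  have -> : (fun n => nq (p n)) = fun n => rho_of (s n).
    by apply/funext => n; rewrite sE rho_ofK.
  apply: rho_of_cvg; apply: cvgD; last exact: cvg_cst.
  by apply: cvgD; apply: cvgM.
have r1 : 1 <= r.
  by apply: (cvgr_to_ge Cr); near=> n.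
(* If r > 1, the relation [inv1] = p (1 - 1 / rho) can be solved for p in the limit. *)
have [r_eq|r_ne] := eqVneq r 1; last first.
  have u0 : 1 - r^-1 != 0.
    by rewrite subr_eq0 eq_sym invr_eq1.
  have Cu : (1 - (nq (p n))^-1)^-1 @[n --> \oo] --> (1 - r^-1)^-1.
    apply: cvgV => //; apply: cvgB; first exact: cvg_cst.
    by apply: cvgV => //; rewrite gt_eqF // (lt_le_trans ltr01).
  pose z := (a1 / (1 - r^-1), a2 / (1 - r^-1)).
  have N1 : \forall n \near \oo, 1 < nq (p n).
    by apply: (cvgr_gt _ Cr); rewrite lt_neqAle eq_sym r_ne.
  have C1 : (p n).1 @[n --> \oo] --> z.1.
    apply: cvg_trans (cvgM A1 Cu); apply: near_eq_cvg; near=> n.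
    have h : 1 < nq (p n) by near: n.
    by rewrite /GRing.mul_fun inv1_Re mulfK // subr_eq0 eq_sym invr_eq1 gt_eqF.
  have C2 : (p n).2 @[n --> \oo] --> z.2.
    apply: cvg_trans (cvgM A2 Cu); apply: near_eq_cvg; near=> n.
    have h : 1 < nq (p n) by near: n.
    by rewrite /GRing.mul_fun inv1_Im mulfK // subr_eq0 eq_sym invr_eq1 gt_eqF.
  have nqC q : nq (p n - q) @[n --> \oo] --> nq (z - q).
    rewrite /nq; under eq_fun do rewrite !expr2; rewrite !expr2.
    by apply: cvgD; apply: cvgM; apply: cvgB => //; exact: cvg_cst.
  exists z.
    apply/eqP => z0; have := nqC 0; rewrite subr0 z0.
    under eq_fun do rewrite subr0.
    move=> /(cvg_unique (@Rhausdorff _) Cr) rE; move: r1.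
    by rewrite rE /nq /= expr0n addr0 leNgt ltr01.
  move=> d d0; have := nqC z; rewrite subrr.
  have -> : nq (0 : R * R) = 0 by rewrite /nq /= expr0n addr0.
  move=> /cvgr_lt /(_ (d ^+ 2) (exprn_gt0 2 d0)); apply: filterS => n; by left.
rewrite r_eq in Cr.
(* If r = 1, [inv1] tends to 0 and carries no direction; but [inv2] is p^2 / rho, so p^2 tends to b1
   + i b2 and p is known up to sign. *)
have zz : sqrtc (b1 +i* b2) ^+ 2 = b1 +i* b2 by exact: sqr_sqrtc.
case: (sqrtc _) zz => a b; rewrite expr2 => zz.
have b1E : b1 = a * a - b * b by have := congr1 (@complex.Re R) zz.
have b2E : b2 = a * b + b * a by have := congr1 (@complex.Im R) zz.
have W1 : (p n).1 ^+ 2 - (p n).2 ^+ 2 @[n --> \oo] --> b1.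
  rewrite -[X in _ --> X]mulr1.
  apply: cvg_trans (cvgM B1 Cr); apply: near_eq_cvg; near=> n; by rewrite /GRing.mul_fun inv2_Re.
have W2 : 2 * (p n).1 * (p n).2 @[n --> \oo] --> b2.
  rewrite -[X in _ --> X]mulr1.
  apply: cvg_trans (cvgM B2 Cr); apply: near_eq_cvg; near=> n; by rewrite /GRing.mul_fun inv2_Im.
have z1 : nq (a, b) = 1.
  have h : b1 * b1 + b2 * b2 = 1 * 1.
    apply: (cvg_unique (@Rhausdorff _) (cvgD (cvgM W1 W1) (cvgM W2 W2))).
    apply: cvg_trans (cvgM Cr Cr); apply: near_eq_cvg; near=> n.
    by rewrite ?fctE /GRing.mul_fun /nq; ring.
  have h2 : nq (a, b) ^+ 2 = 1 ^+ 2.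
    by rewrite [RHS]expr2 -h b1E b2E /nq /=; ring.
  by apply/eqP; rewrite -(eqrXn2 (n := 2)) ?nq_ge0 //; apply/eqP.
exists (a, b).
  by apply: contra_eq_neq z1 => ->; rewrite /nq /= expr0n addr0 eq_sym oner_eq0.
move=> d d0.
(* The product is |p^2 - (a + i b)^2|^2. Hence p is close to a + i b or to its negative, and in the
   second case [nq_antipode] brings the antipode of p close to a + i b. *)
have prod0 : nq (p n - (a, b)) * nq (p n + (a, b)) @[n --> \oo] --> (0 : R).
  have -> : 0 = (b1 - b1) * (b1 - b1) + (b2 - b2) * (b2 - b2) by rewrite !subrr mulr0 addr0.
  apply: cvg_trans (cvgD (cvgM (cvgB W1 (cvg_cst b1)) (cvgB W1 (cvg_cst b1)))
    (cvgM (cvgB W2 (cvg_cst b2)) (cvgB W2 (cvg_cst b2)))); apply: near_eq_cvg; near=> n.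
  by rewrite ?fctE /GRing.mul_fun ?fctE b1E b2E /nq /=; ring.
move/cvgr_lt : prod0 => /(_ _ (exprn_gt0 2 (exprn_gt0 2 d0))).
apply: filterS => n H.
exact: (min_lt (nq_ge0 _) (nq_ge0 _) (nq_antipode (p0 n) z1 (p1 n)) (exprn_gt0 2 d0) H).
Unshelve. all: by end_near. Qed.

End InvariantLimit.

Section Complete.
Variables (R : realType) (g : R * R -> 'M[R]_2) (e : R * R -> R).
Hypothesis gE : forall p, p != 0 -> g p = (e p)%:M.
Hypothesis e_gt0 : forall p, p != 0 -> 0 < e p.
Hypothesis e_cont : forall p, p != 0 -> {for p, continuous e}.
Variable k : R.
Hypothesis k_gt0 : 0 < k.
Hypothesis e_lower : forall p, p != 0 -> k ^+ 2 * (1 + (nq p)^-1) ^+ 2 <= e p.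
Implicit Types (p q v : R * R).

(** The lift with |z| >= 1 is taken because [rho_of] inverts rho + 1 / rho only on that side. *)
Lemma large_lift (P : antipodal_quotient R) : exists p : punctured_plane R,
  quotient_proj p = P /\ 1 <= nq (val p).
Proof.
have [p pP] := quotient_proj_repr P; have p0 : val p != 0 := set_valP p.
have [h|h] := leP 1 (nq (val p)); first by exists p.
have a0 := antipode_neq0 p0.
pose q : punctured_plane R := exist _ (antipode (val p)) (mem_set a0).
exists q; split.
  by rewrite -pP; apply/quotient_proj_eq; rewrite /antipodal /= antipodeK eqxx orbT.
by rewrite /= nqV_antipode invf_ge1 ?ltW // nq_gt0.
Qed.

Lemma complete_of_lower_bound : quotient_complete g.
Proof.
move=> u uC; have [p pP] := choice (fun n => large_lift (u n)).
have cauchy F : invariant_lipschitz g k F -> cvg (F (val (p n)) @[n --> \oo]).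
  move=> FL; apply: real_cauchy_cvg => eps eps0.
  (* The factor k cancels the Lipschitz constant 1 / k. *)
  have [M HM] := uC (k * eps) (mulr_gt0 k_gt0 eps0).
  exists M => i j iM jM; have := FL _ _ _ (HM i j iM jM) _ _ (pP i).1 (pP j).1.
  by rewrite mulrA mulVf ?gt_eqF // mul1r.
have [L1 L2] := inv1_lipschitz gE e_gt0 e_cont k_gt0 e_lower.
have [L3 L4] := inv2_lipschitz gE e_gt0 e_cont k_gt0 e_lower.
have [z z0 Hz] := invariants_limit (fun n => (pP n).2) (cauchy _ L1) (cauchy _ L2)
  (cauchy _ L3) (cauchy _ L4).
pose Z : punctured_plane R := exist _ z (mem_set z0).
have [M [d [M0 d0 HM]]] := quotient_dist_small gE e_gt0 e_cont Z.
have small eps : 0 < eps -> \forall n \near \oo,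
    (quotient_dist g (u n) (quotient_proj Z) < eps%:E)%E.
  move=> eps0; pose d' := Num.min d (eps / (M + 1)).
  have d'0 : 0 < d' by rewrite lt_min d0 divr_gt0 // ltr_wpDl.
  have := Hz d' d'0; apply: filterS => n Hn.
  have H (q : punctured_plane R) : quotient_proj q = u n -> nq (val q - z) < d' ^+ 2 ->
      (quotient_dist g (u n) (quotient_proj Z) < eps%:E)%E.
    move=> <- hq; apply: le_lt_trans (HM q _) _.
      by apply: lt_le_trans hq _; rewrite lerXn2r ?nnegrE ?(ltW d'0) ?(ltW d0) // ge_min lexx.
    rewrite lte_fin; have : Num.sqrt (nq (val q - z)) < d'.
      by rewrite -[d']gtr0_norm // -sqrtr_sqr ltr_sqrt // exprn_gt0.
    have : d' <= eps / (M + 1) by rewrite ge_min lexx orbT.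
    rewrite ler_pdivlMr; last by rewrite ltr_wpDl.
    have := sqrtr_ge0 (nq (val q - z)).
    move: (Num.sqrt _) d'0 => s d'0 s0 h1 h2; nra.
  case: Hn => Hn; first exact: (H (p n) (pP n).1).
  have pn0 : val (p n) != 0 := set_valP (p n).
  pose q : punctured_plane R := exist _ (antipode (val (p n))) (mem_set (antipode_neq0 pn0)).
  apply: (H q) => //; rewrite -(pP n).1; apply/quotient_proj_eq.
  by rewrite /antipodal /= antipodeK eqxx orbT.
have ge0 n : (0 <= quotient_dist g (u n) (quotient_proj Z))%E by exact: quotient_dist_ge0.
exists (quotient_proj Z); apply/fine_cvgP; split.
  apply: filterS (small 1 ltr01) => n h.
  by rewrite ge0_fin_numE // (lt_trans h) // ltry.
apply/cvgrPdist_lt => eps eps0; apply: filterS (small eps eps0) => n h.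
rewrite sub0r normrN /= ger0_norm ?fine_ge0 //.
by rewrite -lte_fin fineK // ge0_fin_numE // (lt_trans h) // ltry.
Qed.

End Complete.

(** * Values of phi and psi at the ends *)

Section RegularEnds.
Variables (R : realType) (m : nat) (l : R[i]).
Hypothesis hm : (1 <= m)%N.
Hypothesis hl : l * l^*%C = 1.
Implicit Types (a b c d z : R[i]).

(** Common shape of phi and 1 / psi near 0, and of 1 / phi and psi near infinity in the coordinate 1
    / z. With n > 0 it vanishes at 0, so at each end one of phi, psi is 0 and the other infinite. *)
Definition homography_pow a b c d n z : R[i] := (a + b * z) / (c + d * z) * z ^+ n.

Lemma near_affine_neq0 c d : c != 0 -> \forall z \near (0 : R[i]^o), c + d * z != 0.
Proof.
move=> c0; have h : 0 < `|c| / (`|d| + 1).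
  by rewrite divr_gt0 ?normr_gt0 // ltr_wpDl.
apply/nbhs_ballP; exists (`|c| / (`|d| + 1)) => //= z.
rewrite -ball_normE /= sub0r normrN => hz; apply: contraTneq hz => E.
have {E} -> : c = - (d * z) by apply/eqP; rewrite -addr_eq0 E.
have le : `|- (d * z)| / (`|d| + 1) <= `|z|.
  by rewrite normrN normrM ler_pdivrMr ?ltr_wpDl // mulrDr mulr1 mulrC lerDl.
by apply/negP => lt; have := lt_le_trans lt le; rewrite ltxx.
Qed.

Lemma holomorphic_homography_pow a b c d n : c != 0 ->
  holomorphic_at (homography_pow a b c d n) 0.
Proof.
move=> c0; apply: filterS (near_affine_neq0 d c0) => z hz.
have D (u v : R[i]) : derivable ((fun z => u + v * z) : R[i]^o -> R[i]^o) (z : R[i]^o) 1.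
  exact: (derivableD (derivable_cst (u : R[i]^o) (z : R[i]^o) 1)
    (derivableZ (k := v) (@derivable_id _ R[i]^o z 1))).
apply: derivableM; last exact: exprn_derivable.
apply: derivableM => //; exact: (@derivableV _ _ (fun z : R[i]^o => (c + d * z : R[i]^o))).
Qed.

Lemma homography_pow0 a b c d n : (0 < n)%N -> homography_pow a b c d n 0 = 0.
Proof. by case: n => // n _; rewrite /homography_pow expr0n mulr0. Qed.

Lemma value_at_0_zero f a b c d n : (0 < n)%N -> c != 0 ->
  (forall z, z != 0 -> c + d * z != 0 -> f z = homography_pow a b c d n z) ->
  value_at_0 f (Some 0).
Proof.
move=> n0 c0 fE; exists (homography_pow a b c d n); split.
- exact: holomorphic_homography_pow.
- exact: homography_pow0.
- have h1 : \forall z \near (0 : R[i]^o)^', z != 0 by exact: nbhs_dnbhs_neq.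
  have h2 : \forall z \near (0 : R[i]^o)^', c + d * z != 0.
    by apply: nbhs_dnbhs; exact: near_affine_neq0.
  by apply: filterS2 h1 h2 => z; exact: fE.
Qed.

Lemma value_at_0_pole f a b c d n : (0 < n)%N -> a != 0 -> c != 0 ->
  (forall z, z != 0 -> a + b * z != 0 -> c + d * z != 0 ->
    f z = (homography_pow a b c d n z)^-1) ->
  value_at_0 f None.
Proof.
move=> n0 a0 c0 fE; exists (homography_pow a b c d n); split.
- exact: holomorphic_homography_pow.
- exact: homography_pow0.
- have h1 : \forall z \near (0 : R[i]^o)^', z != 0 by exact: nbhs_dnbhs_neq.
  have h2 : \forall z \near (0 : R[i]^o)^', c + d * z != 0.
    by apply: nbhs_dnbhs; exact: near_affine_neq0.
  have h3 : \forall z \near (0 : R[i]^o)^', a + b * z != 0.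
    by apply: nbhs_dnbhs; exact: near_affine_neq0.
  apply: filterS3 h1 h2 h3 => z z0 cz az; split; last exact: fE.
  by rewrite !mulf_neq0 ?invr_eq0 ?expf_neq0.
Qed.

Let l0 : l != 0.
Proof. by apply: contraTneq (oner_neq0 R[i]) => l0; rewrite -hl l0 mul0r eqxx. Qed.
Let lb0 : l^*%C != 0. Proof. by rewrite conjc_eq0. Qed.
Let n0 : (0 < 2 * m)%N. Proof. by rewrite muln_gt0. Qed.

Lemma regular_at_0 : regular_end_at_0 (ex_phi m l) (ex_psi m l).
Proof.
exists (Some 0), None; split=> //.
- apply: (value_at_0_zero (a := - l) (b := 1) (c := - l^*%C) (d := 1) n0).
    by rewrite oppr_eq0.
  by move=> z z0 _; rewrite /ex_phi /homography_pow !mul1r ![- _ + z]addrC.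
- apply: (value_at_0_pole (a := 1) (b := l) (c := 1) (d := l^*%C) n0); rewrite ?oner_eq0 //.
  by move=> z z0 h1 h2; rewrite /ex_psi /homography_pow !invfM invrK [_ / (1 + l * z)]mulrC.
Qed.

Lemma regular_at_infty : regular_end_at_infty (ex_phi m l) (ex_psi m l).
Proof.
exists None, (Some 0); split=> //.
- apply: (value_at_0_pole (a := 1) (b := - l^*%C) (c := 1) (d := - l) n0); rewrite ?oner_eq0 //.
  move=> z z0 h1 h2; rewrite /ex_phi /homography_pow.
  have h3 : z ^+ (2 * m) != 0 by rewrite expf_neq0.
  have h4 : z^-1 - l^*%C != 0.
    have -> : z^-1 - l^*%C = (1 + - l^*%C * z) / z by field.
    by rewrite mulf_neq0 ?invr_eq0.
  by rewrite exprVn; field; rewrite ?z0 ?h1 ?h2 ?h3 ?h4.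
- apply: (value_at_0_zero (a := l^*%C) (b := 1) (c := l) (d := 1) n0) => // z z0 h1.
  rewrite /ex_psi /homography_pow mul1r; rewrite mul1r in h1.
  have h3 : z ^+ (2 * m) != 0 by rewrite expf_neq0.
  have h4 : 1 + l / z != 0.
    have -> : 1 + l / z = (l + z) / z by field.
    by rewrite mulf_neq0 ?invr_eq0.
  by rewrite exprVn; field; rewrite h1 h3 z0.
Qed.

End RegularEnds.

(** * The Moebius strip *)

Section MoebiusStrip.
Variable R : realType.
Implicit Types (p q z : R * R) (s t : R).

(* (s, t) |-> e^t e^{i pi s} intertwines (s, t) |-> (s + 1, - t) and the
   antipode. *)
Definition polar p : R * R :=
  (expR p.2 * cos (pi * p.1), expR p.2 * sin (pi * p.1)).

Lemma nq_polar p : nq (polar p) = expR p.2 ^+ 2.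
Proof. by rewrite /nq /polar /= !exprMn -mulrDr cos2Dsin2 mulr1. Qed.

Lemma nq0 : nq (0 : R * R) = 0.
Proof. by rewrite /nq /= expr0n addr0. Qed.

Lemma polar_neq0 p : polar p != 0.
Proof.
apply/negP => /eqP E; have := nq_polar p; rewrite E nq0 => /esym/eqP.
by rewrite expf_eq0 /= gt_eqF ?expR_gt0.
Qed.

Lemma polar_antipode s t : polar (s + 1, - t) = antipode (polar (s, t)).
Proof.
rewrite antipodeE nq_polar /polar /= mulrDr mulr1 cosDpi sinDpi expRN.
have h := expR_gt0 t; congr (_, _); by field; rewrite gt_eqF.
Qed.

Definition polar_pt p : punctured_plane R := exist _ (polar p) (mem_set (polar_neq0 p)).

Definition polar_quotient p : antipodal_quotient R := quotient_proj (polar_pt p).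

Lemma polar_quotientS s t : polar_quotient (s + 1, - t) = polar_quotient (s, t).
Proof.
apply/quotient_proj_eq; rewrite /antipodal /= polar_antipode.
by rewrite antipodeK eqxx orbT.
Qed.

Lemma polar_quotient_moebius p q : moebius p q -> polar_quotient p = polar_quotient q.
Proof.
case: p => s t /asboolP[n ->] /=; elim/int_rec: n => [|n IH|n IH].
- by rewrite addr0 expr0z mul1r.
- rewrite {}IH -polar_quotientS -addrA; congr polar_quotient; congr (_, _).
    by rewrite intS rmorphD /= [1 + _]addrC.
  by rewrite -!exprnP exprS mulN1r mulNr.
- rewrite {}IH -[RHS]polar_quotientS; congr polar_quotient; congr (_, _).
    rewrite !rmorphN /= -addrA; congr (_ + _).
    by rewrite intS rmorphD /= opprD addrC addrA subrr add0r.
  rewrite -!exprnN exprS -mulNr; congr (_ * _).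
  by rewrite invfM invrN invr1 mulN1r opprK.
Qed.

(** By periodicity s reduces to r in [0, 2); then 1 - cos (pi r) = 2 sin^2 (pi r / 2), and the sine
    is positive between 0 and pi. *)
Lemma cos_pi_eq1 s : cos (pi * s) = 1 -> exists n : int, s = 2 * n%:~R.
Proof.
move=> E; pose n := Num.floor (s / 2); pose r := s - 2 * n%:~R.
have /andP[n1 n2] : n%:~R <= s / 2 < (n + 1)%:~R by exact: floor_itv.
have r0 : 0 <= r by rewrite /r; lra.
have r2 : r < 2 by rewrite /r; rewrite rmorphD /= in n2; lra.
have Er : cos (pi * r) = 1.
  have per (k : int) a : cos (a + pi * (2 * k%:~R)) = cos a.
    elim/int_rec: k => [|k IH|k IH]; first by rewrite !mulr0 addr0.
      rewrite -[RHS]IH -[RHS]cosD2pi intS rmorphD /=; congr cos; ring.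
    rewrite -[RHS]IH -[LHS]cosD2pi intS !rmorphN rmorphD /=; congr cos; ring.
  by rewrite /r mulrBr -[- (pi * _)]mulrN -mulrN -rmorphN per.
have S0 : sin (pi * r / 2) = 0.
  have e2 : (pi * r / 2) *+ 2 = pi * r by rewrite -mulr_natr; field.
  have := cos_mulr2n (pi * r / 2); rewrite e2 Er.
  have := cos2Dsin2 (pi * r / 2); move: (cos _) (sin _) => c d h1 h2.
  have : d ^+ 2 = 0 by lra.
  by move/eqP; rewrite sqrf_eq0 => /eqP.
have pi0 := pi_gt0 R.
have [r_eq|r_ne] := eqVneq r 0; first by exists n; rewrite /r in r_eq; lra.
have : 0 < sin (pi * r / 2).
  apply: sin_gt0_pi; apply/andP; split; first by rewrite !mulr_gt0 // lt_neqAle eq_sym r_ne.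
  rewrite -mulrA gtr_pMr //; lra.
by rewrite S0 ltxx.
Qed.

Lemma moebius_step s t : moebius (s, t) (s + 1, - t).
Proof. by apply/asboolP; exists 1; rewrite /= expr1z mulN1r. Qed.

Lemma polar_inj p q : polar p = polar q -> moebius p q.
Proof.
case: p q => s t [s' t'] E; have := congr1 (@nq R) E; rewrite !nq_polar /= => /eqP.
rewrite eqrXn2 ?expR_ge0 // => /eqP/expR_inj tE; subst t'.
have h := gt_eqF (expR_gt0 t).
case: E => /(mulfI (negbT h)) E1 /(mulfI (negbT h)) E2.
have [n nE] : exists n : int, s' - s = 2 * n%:~R.
  by apply: cos_pi_eq1; rewrite mulrBr cosB E1 E2 -!expr2 cos2Dsin2.
(* A full turn shifts s by 2, an even number, and so does not flip t. *)
apply/asboolP; exists (2 * n); rewrite /= -exprz_exp.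
rewrite -[(-1) ^ 2]/((-1) ^+ 2) sqrrN expr1n exp1rz mul1r rmorphM /=.
by congr (_, _); rewrite -nE addrC subrK.
Qed.

Lemma polar_quotient_inj p q : polar_quotient p = polar_quotient q -> moebius p q.
Proof.
move=> /quotient_proj_eq; rewrite /antipodal /= => /orP[/eqP E|/eqP E].
  exact/polar_inj.
case: p E => s t; rewrite -polar_antipode => /esym/polar_inj.
exact: moebius_trans (moebius_step s t).
Qed.

(** The inverse of [polar] on the open half-plane around the direction e^(i pi s): the quotient is
    the slope of z rotated by - pi s. *)
Definition polar_branch s z : R * R :=
  let c := cos (pi * s) in let d := sin (pi * s) in
  (s + atan ((z.2 * c - z.1 * d) / (z.1 * c + z.2 * d)) / pi,
   ln (Num.sqrt (nq z))).

Lemma polar_branchK s z : 0 < z.1 * cos (pi * s) + z.2 * sin (pi * s) ->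
  polar (polar_branch s z) = z.
Proof.
case: z => x y; rewrite /polar /polar_branch /=.
have := cos2Dsin2 (pi * s); set c := cos (pi * s); set d := sin (pi * s) => cd.
set u := x * c + y * d; set v := y * c - x * d => u0.
have nE : nq (x, y) = u ^+ 2 + v ^+ 2.
  transitivity ((x ^+ 2 + y ^+ 2) * (c ^+ 2 + d ^+ 2)); first by rewrite cd mulr1.
  by rewrite /u /v; ring.
have n0 : 0 < nq (x, y) by rewrite nE ltr_wpDr ?sqr_ge0 // exprn_gt0.
set n := Num.sqrt _; have n_gt0 : 0 < n by rewrite sqrtr_gt0.
have n2 : n ^+ 2 = u ^+ 2 + v ^+ 2 by rewrite sqr_sqrtr ?ltW // nE.
rewrite lnK ?posrE // mulrDr -[pi * (_ / pi)]mulrC divfK ?gt_eqF ?pi_gt0 //.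
have ca : cos (atan (v / u)) = u / n.
  rewrite cos_atan; have -> : 1 + (v / u) ^+ 2 = (n / u) ^+ 2.
    by rewrite !exprMn n2 exprVn; field; rewrite gt_eqF.
  by rewrite sqrtr_sqr ger0_norm ?invf_div // divr_ge0 ?ltW.
have sa : sin (atan (v / u)) = v / n.
  have := atanK (v / u); rewrite /tan ca => /(canRL (mulfVK _)) ->; last first.
    by rewrite mulf_neq0 ?invr_eq0 ?lt0r_neq0.
  by field; rewrite !gt_eqF.
rewrite cosD sinD ca sa -/c -/d; congr (_, _).
  transitivity (x * (c ^+ 2 + d ^+ 2)); last by rewrite cd mulr1.
  by rewrite /u /v; field; rewrite gt_eqF.
transitivity (y * (c ^+ 2 + d ^+ 2)); last by rewrite cd mulr1.
by rewrite /u /v; field; rewrite gt_eqF.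
Qed.

(** The half-planes around the four axis directions cover the punctured plane. *)
Lemma polar_surj z : z != 0 -> exists p, polar p = z.
Proof.
case: z => x y z0.
have K s : 0 < x * cos (pi * s) + y * sin (pi * s) -> exists p, polar p = (x, y).
  by move=> h; exists (polar_branch s (x, y)); exact: polar_branchK.
have [x0|x0|x0] := ltrgtP x 0.
- by apply: (K 1); rewrite mulr1 cospi sinpi; lra.
- by apply: (K 0); rewrite mulr0 cos0 sin0; lra.
have [y0|y0|y0] := ltrgtP y 0; last by move: z0; rewrite x0 y0 eqxx.
- by apply: (K (- 2^-1)); rewrite mulrN cosN sinN cos_pihalf sin_pihalf; lra.
- by apply: (K 2^-1); rewrite cos_pihalf sin_pihalf; lra.
Qed.

Lemma continuous_polar : continuous polar.
Proof.
move=> p; have h1 : cos (pi * q.1) @[q --> p] --> cos (pi * p.1).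
  apply: continuous_cvg; first exact: continuous_cos.
  by apply: cvgM; [exact: cvg_cst|exact: cvg_fst].
have h2 : sin (pi * q.1) @[q --> p] --> sin (pi * p.1).
  apply: continuous_cvg; first exact: continuous_sin.
  by apply: cvgM; [exact: cvg_cst|exact: cvg_fst].
have h3 : expR q.2 @[q --> p] --> expR p.2.
  by apply: continuous_cvg; [exact: continuous_expR|exact: cvg_snd].
exact: (cvg_pair (cvgM h3 h1) (cvgM h3 h2)).
Qed.

Lemma continuous_polar_branch s z : 0 < z.1 * cos (pi * s) + z.2 * sin (pi * s) ->
  {for z, continuous (polar_branch s)}.
Proof.
move=> u0.
have f1 : q.1 @[q --> z] --> z.1 by exact: cvg_fst.
have f2 : q.2 @[q --> z] --> z.2 by exact: cvg_snd.
have n0 : 0 < nq z.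
  apply: contraTT u0; rewrite -!leNgt => n0.
  have /eqP : nq z = 0 by apply/eqP; rewrite eq_le n0 nq_ge0.
  rewrite /nq paddr_eq0 ?sqr_ge0 // !sqrf_eq0 => /andP[/eqP -> /eqP ->].
  by rewrite !mul0r addr0.
have fc a : cst a q @[q --> z] --> (a : R) by exact: cvg_cst.
have k1 : s + atan ((q.2 * cos (pi * s) - q.1 * sin (pi * s)) /
    (q.1 * cos (pi * s) + q.2 * sin (pi * s))) / pi @[q --> z] --> (polar_branch s z).1.
  apply: cvgD; first exact: cvg_cst.
  apply: cvgM; last exact: cvg_cst.
  apply: continuous_cvg; first exact: continuous_atan.
  apply: cvgM; last (apply: cvgV; first by rewrite gt_eqF).
    by apply: cvgB; apply: cvgM => //; exact: cvg_cst.
  by apply: cvgD; apply: cvgM => //; exact: cvg_cst.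
have k2 : ln (Num.sqrt (nq q)) @[q --> z] --> (polar_branch s z).2.
  apply: continuous_cvg; first by apply: continuous_ln; rewrite sqrtr_gt0.
  apply: continuous_cvg; first exact: sqrt_continuous.
  exact: nq_continuous.
exact: (cvg_pair k1 k2).
Qed.

Definition strip_proj p : moebius_strip R := (\pi_({eq_quot (moebius_equiv R)}) p)%qT.

Lemma strip_proj_eq p q : strip_proj p = strip_proj q <-> moebius p q.
Proof.
split; first by move=> /eqmodP.
by move=> ?; apply/eqmodP.
Qed.

Lemma homeomorphic_moebius : homeomorphic (antipodal_quotient R) (moebius_strip R).
Proof.
have surj (P : antipodal_quotient R) : exists p, polar_quotient p = P.
  have [z <-] := quotient_proj_repr P; have [p pE] := polar_surj (set_valP z).
  exists p; apply/quotient_proj_eq; rewrite /antipodal /= pE eqxx; by [].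
have [L LK] := choice surj.
pose f P := strip_proj (L P).
pose g (Q : moebius_strip R) := polar_quotient (repr (Q : {eq_quot (moebius_equiv R)}%qT)).
have gE p : g (strip_proj p) = polar_quotient p.
  by apply: polar_quotient_moebius; apply/strip_proj_eq; exact: reprK.
have fE p : f (polar_quotient p) = strip_proj p.
  by apply/strip_proj_eq; apply: polar_quotient_inj; rewrite LK.
exists f, g; split.
- by move=> P; rewrite gE LK.
- by move=> Q; rewrite fE; exact: reprK.
(* [L] is an arbitrary choice of polar coordinates. Near z, f composed with the projection agrees
   with the continuous branch around the argument pi s of z, since any two choices have the same
   class in the strip. *)
- apply/quotient_continuous => z.
  have [[s t] pE] := polar_surj (set_valP z).
  have u0 : 0 < (val z).1 * cos (pi * s) + (val z).2 * sin (pi * s).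
    rewrite -pE /polar /= -!mulrA -!expr2 -mulrDr cos2Dsin2 mulr1.
    exact: expR_gt0.
  have cval := @initial_continuous (punctured_plane R) (R * R)%type
    (@set_val _ (punctured_plane R)) z.
  have near0 : \forall q \near z, 0 < (val q).1 * cos (pi * s) + (val q).2 * sin (pi * s).
    apply: (cval [set q : R * R | 0 < q.1 * cos (pi * s) + q.2 * sin (pi * s)]).
    have c3 : q.1 * cos (pi * s) + q.2 * sin (pi * s) @[q --> (val z : R * R)] -->
        (val z).1 * cos (pi * s) + (val z).2 * sin (pi * s).
      apply: cvgD; apply: cvgM; [exact: cvg_fst|exact: cvg_cst|exact: cvg_snd|exact: cvg_cst].
    exact: (cvgr_gt _ c3 _ u0).
  have E (q : punctured_plane R) : 0 < (val q).1 * cos (pi * s) + (val q).2 * sin (pi * s) ->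
      strip_proj (polar_branch s (val q)) = f (quotient_proj q).
    move=> /polar_branchK qE; rewrite -fE /polar_quotient; congr (f (quotient_proj _)).
    by apply: val_inj; rewrite /= qE.
  have C0 : {for val z, continuous (strip_proj \o polar_branch s)}.
    by apply: continuous_comp; [exact: continuous_polar_branch|exact: pi_continuous].
  have C := continuous_comp cval C0.
  rewrite /continuous_at -[X in _ --> X](E z u0).
  apply: cvg_trans C; apply: (@near_eq_cvg _ _ _ (nbhs_filter z)).
  by apply: filterS near0 => q /E.
- apply/quotient_continuous.
  have -> : g \o \pi_(moebius_strip R)%qT = @quotient_proj R \o polar_pt.
    by apply/funext => p; exact: gE.
  move=> p; apply: continuous_comp; last exact: pi_continuous.
  apply: continuous_comp_initial; exact: continuous_polar.
Qed.

End MoebiusStrip.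

Section MainTheorem.
Variables (R : realType) (m : nat) (l : R[i]).
Hypothesis hm : (1 <= m)%N.
Hypothesis hl : l * l^*%C = 1.
Hypothesis hb : complex.Im l != 0.
Variables (x : R * R -> 'rV[R]_4) (x0 : 'rV[R]_4).
Hypothesis xE : forall p, p != 0 ->
  x p = x0 + row_Re 1 (fun j => laurent_prim (formPhi m l j)) p.

Lemma x_antipode p : p != 0 -> x (antipode p) = x p.
Proof.
move=> p0; apply: etrans (xE (antipode_neq0 p0)) _; apply/esym.
apply: etrans (xE p0) _; exact: (congr1 (fun u => x0 + u) (esym (row_Re_antipode l hm p0))).
Qed.

Lemma complete_x : quotient_complete (induced_metric x).
Proof.
have [c c0 Hc] := Ec_lower hm hl hb.
have ce p : p != 0 -> {for p, continuous (fun q => complex.Re (Ec m l q) : R)}.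
  by move=> p0; have [] := wirtinger_continuous (wirtinger_Ec m hl hb p0).
exact: (complete_of_lower_bound (metric_x hm hl xE) (@Ec_gt0 R m l hl hb) ce c0 Hc).
Qed.

End MainTheorem.

Lemma unit_mul_conjc (R : realType) (l : R[i]) : `|l| = 1 -> l * l^*%C = 1.
Proof.
rewrite mul_conjc normc_norm => /(congr1 (@complex.Re R)) /= ->.
by rewrite expr1n.
Qed.

Lemma unit_Im_neq0 (R : realType) (l : R[i]) : l * l^*%C = 1 -> l <> 1 -> l <> -1 ->
  complex.Im l != 0.
Proof.
case: l => a b /(congr1 (@complex.Re R)) /= h l1 lN1; apply/eqP => b0.
have : (a - 1) * (a + 1) = 0 by rewrite b0 in h; lra.
move=> /eqP; rewrite mulf_eq0 => /orP[]/eqP h1; [apply: l1|apply: lN1];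
  apply: ReIm_eq; rewrite /= ?b0 ?oppr0 //; lra.
Qed.

Unset Implicit Arguments.

Theorem proposition4p5 (R : realType) (m : nat) (l : R[i])
  (hm : (1 <= m)%N) (hl : `|l| = 1) (hl1 : l <> 1) (hlN1 : l <> -1) :
  homeomorphic (antipodal_quotient R) (moebius_strip R) /\
  regular_end_at_0 (ex_phi m l) (ex_psi m l) /\
  regular_end_at_infty (ex_phi m l) (ex_psi m l) /\
  (exists x : R * R -> 'rV[R]_4,
     weierstrass_integral (ex_phi m l) (ex_psi m l) (ex_h l) (ex_poles l) x) /\
  (forall x : R * R -> 'rV[R]_4,
     weierstrass_integral (ex_phi m l) (ex_psi m l) (ex_h l) (ex_poles l) x ->
     [/\ exists X : antipodal_quotient R -> 'rV[R]_4,
           forall p : punctured_plane R, X (quotient_proj p) = x (val p),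
         stationary_on (punctured_plane R) x,
         quotient_complete (induced_metric x),
         (lebesgue_measure \x lebesgue_measure)%E.-integrable
           (punctured_plane R)
           (EFin \o curvature_density (induced_metric x)) &
         (- total_curvature (induced_metric x))%E =
           (2 * (2 * m%:R + 1) * pi)%:E]).
Proof.
have hl' := unit_mul_conjc hl.
have hb := unit_Im_neq0 hl' hl1 hlN1.
split; first exact: homeomorphic_moebius.
split; first exact: regular_at_0.
split; first exact: regular_at_infty.
split; first exact: weierstrass_exists.
move=> x /(weierstrass_unique hm hl')[x0 xE]; split.
- exact: factor_quotient (x_antipode hm xE).
- exact: stationary_x xE.
- exact: complete_x xE.
- exact: integrable_curvature xE.
- exact: total_curvature_x xE.
Qed.
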